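(* Let $\mathcal{U}$ be the uniform spanning tree on $\mathbb{Z}^3$, with law $\mathbf{P}$. Then, $\mathbf{P}$-almost surely, $\mathcal{U}$ has the infinite collision property.
   Context: The uniform spanning tree (UST) on a finite connected graph is a uniformly random element of the set of its spanning trees. The UST $\mathcal{U}$ on $\mathbb{Z}^3$ (nearest-neighbour lattice) is the weak limit as $n\to\infty$ of the USTs on the finite boxes $\mathbb{Z}^3\cap[-n,n]^3$; it is almost surely a (one-ended) spanning tree of $\mathbb{Z}^3$. For a connected graph $G$, let $X=(X_n)_{n\ge0}$ and $Y=(Y_n)_{n\ge0}$ be independent discrete-time simple random walks on $G$ (each step goes to a uniformly chosen neighbour), and let $P_{a,b}$ be the law of $(X_n,Y_n)_{n\ge0}$ with $(X_0,Y_0)=(a,b)$. Let $Z=\sum_{n=0}^\infty\mathbf{1}(X_n=Y_n)$ be the total number of collisions. The graph $G$ has the infinite collision property if $P_{a,a}(Z=\infty)=1$ for every vertex $a$ of $G$. *)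

(* Defs.v *)
From HB Require Import structures.
From mathcomp Require Import all_boot all_order all_algebra finmap.
From mathcomp Require Import all_classical all_reals all_analysis.
Import Order.TTheory GRing.Theory Num.Theory.
Import numFieldNormedType.Exports.

Set Implicit Arguments.
Unset Strict Implicit.
Unset Printing Implicit Defensive.

Local Open Scope classical_set_scope.
Local Open Scope ring_scope.

(* A simple graph is given by its set of ordered adjacent pairs, so each
   undirected edge {x, y} is represented by both (x, y) and (y, x). *)

Section SpanningTrees.
Variables (T : finType) (e : rel T).

Definition tree_rel (t : {set T * T}) : rel T := fun x y => (x, y) \in t.

Definition acyclic (t : {set T * T}) : Prop :=
  forall c : seq T, (2 < size c)%N -> ~ ucycle (tree_rel t) c.

Definition is_spanning_tree (t : {set T * T}) : Prop :=
  [/\ subrel (tree_rel t) e,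
      symmetric (tree_rel t),
      (forall x y, connect (tree_rel t) x y)
    & acyclic t].

Definition spanning_trees : {set {set T * T}} :=
  [set t | `[< is_spanning_tree t >]].

End SpanningTrees.

Notation Zd d := {ffun 'I_d -> int}.
HB.instance Definition _ d := isPointed.Build (Zd d) [ffun=> 0].

Definition lattice_adj d (x y : Zd d) : bool :=
  \sum_(i < d) `|x i - y i| == 1.

(* The coordinate k : 'I_(2n+1) stands for the integer k - n in [-n, n]. *)
Definition box (d n : nat) : finType := {ffun 'I_d -> 'I_(n.*2.+1)}.

Definition box_point d n (u : box d n) : Zd d :=
  [ffun i => (u i : nat)%:Z - n%:Z].

Definition box_adj d n (u v : box d n) : bool :=
  lattice_adj (box_point u) (box_point v).

(* The product topology over the discrete space bool, with its Borel sets. *)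
Notation config V := {ptws V * V -> bool}.
Notation borel_config V := (g_sigma_algebraType (@open (config V))).

Section UniformSpanningTree.
Variables (R : realType) (d : nat).

Definition box_config n (t : {set box d n * box d n}) : borel_config (Zd d) :=
  fun xy => [exists uv in t, (box_point uv.1, box_point uv.2) == xy].

Definition box_tree_configs n : seq (borel_config (Zd d)) :=
  [seq box_config t | t <- enum (spanning_trees (@box_adj d n))].

Definition box_ust n : {measure set (borel_config (Zd d)) -> \bar R} :=
  let s := box_tree_configs n in
  mscale ((size s)%:R^-1)%:nng
    (msum (fun k => @dirac _ (borel_config (Zd d)) (nth point s k) R) (size s)).

Definition weak_limit (V : choiceType)
    (mu_ : nat -> {measure set (borel_config V) -> \bar R})
    (mu : {measure set (borel_config V) -> \bar R}) : Prop :=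
  forall f : config V -> R, continuous f -> (exists M, forall G, `|f G| <= M) ->
    (\int[mu_ n]_G (f G)%:E)%E @[n --> \oo] --> (\int[mu]_G (f G)%:E)%E.

Definition is_ust_law (P : probability (borel_config (Zd d)) R) : Prop :=
  weak_limit box_ust P.

End UniformSpanningTree.

Section Collisions.
Variables (R : realType) (V : pointedType).
Implicit Type G : config V.

Definition cylinders : set (set (nat -> V)) :=
  [set A | exists n x, A = [set w | w n = x]].

Local Notation paths := (g_sigma_algebraType cylinders).

Definition degree G (x : V) : nat := #|` fset_set [set y | G (x, y)]|.

(* The degree is meant for locally finite G (fset_set of an infinite set is
   empty). A vertex of degree 0 has a zero row, so that no mu satisfies srw_law
   below for a walk started there. *)
Definition srw_step G (x y : V) : R :=
  if G (x, y) then (degree G x)%:R^-1 else 0.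

(* For countable V these finite-dimensional distributions determine mu
   uniquely. *)
Definition srw_law G (a : V) (mu : probability paths R) : Prop :=
  forall (n : nat) (x : nat -> V),
    mu [set w | forall i, (i <= n)%N -> w i = x i] =
    ((x 0%N == a)%:R * \prod_(i < n) srw_step G (x i) (x i.+1))%:E.

Definition collisions (w : paths * paths) : \bar R :=
  (\sum_(0 <= n <oo) (w.1 n == w.2 n)%:R%:E)%E.

(* The product mu \x mu is the joint law of two independent walks from a. *)
Definition infinite_collision_property G : Prop :=
  forall a : V, exists2 mu : probability paths R,
    srw_law G a mu
    & (mu \x mu)%E [set w | collisions w = +oo%E] = 1%E.

End Collisions.

(* Main.v *)
(* By Rayleigh monotonicity, the probability that the uniform spanning tree of a
   box contains given edges can only decrease when the box grows; hence the limit
   law is invariant under translations, the mean degree is at most 2, and mass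
   may be transported between the vertices of the random graph.

   Let each vertex [x] send to its neighbour [y] the probability that a walk from
   [x], killed at a small rate, dies in the branch beyond [y]. Every vertex sends
   almost mass 1, whereas an edge carries in both directions together at most
   [1 - (1 - h x y) * (1 - h y x)], where [h x y] is the probability that the walk
   without killing ever moves from [x] to [y]. As the mean degree is at most 2,
   [h x y] or [h y x] is 1 for every edge, which makes the graph recurrent.

   Next let [u] send to [z] the probability that two walks from [u] collide at [z]
   for the last time; the total is at most 1. By reversibility, the mass received
   by [u] is, up to a factor depending on the degrees, at least the probability
   that two walks from [u] never collide again times the sum of the return
   probabilities to [u]. The latter is infinite by recurrence, so almost surely no
   collision is the last one. *)

From HB Require Import structures.
Require Import Defs.
From mathcomp Require Import all_boot all_order all_algebra finmap.
From mathcomp Require Import all_classical all_reals all_analysis.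
From mathcomp Require Import measurable_realfun ring lra zify.
Import Order.TTheory GRing.Theory Num.Theory.
Import numFieldNormedType.Exports.

Set Implicit Arguments.
Unset Strict Implicit.
Unset Printing Implicit Defensive.

Local Open Scope ring_scope.

(** * Rayleigh monotonicity for Gram determinants *)

(** Monotonicity is obtained from linear algebra. Trees through given edges are counted by bordered
    determinants of Gram matrices of edge vectors, and Rayleigh's inequality becomes negative
    correlation of such determinants. Vertices outside the smaller box are first grounded, so that
    both boxes live in one matrix, and are then attached one by one through pendant edges, which
    change no count.

    A weak limit only controls functions of finitely many edges. Every infinite-volume quantity is
    therefore a bounded pointwise limit of such functions: [hit] truncates branches at a depth [n],
    [avoid] looks at [M] steps, and sums over the lattice become sums over boxes. Killing serves the
    same purpose, since it keeps the denominator of [harm] away from 0.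

    The mass that a vertex fails to send is the probability of dying at the vertex itself. It is
    small because every tree of a large box joins the vertex to a far corner: almost surely paths of
    every length start at it, and a deep branch returns the killed walk too rarely for death at the
    vertex to matter. *)

Section BorderedDeterminant.
Variable F : realFieldType.

(* For invertible [A] this is [\det A * \det (W *m A^-1 *m W^T)]; the bordered form
   also makes sense for singular [A]. *)
Definition bdet n k (A : 'M[F]_n) (W : 'M[F]_(k, n)) : F :=
  \det (block_mx A W^T (- W) 0).

Lemma bdet_castr n k k' (A : 'M[_]_n) (W : 'M[_]_(k, n)) (W' : 'M[_]_(k', n)) :
  k = k' -> (forall i i' j, val i = val i' -> W i j = W' i' j) ->
  bdet A W = bdet A W'.
Proof.
move=> ek; case: k' / ek W' => W' eW; congr bdet.
by apply/matrixP => i j; apply: eW.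
Qed.

Lemma det_add_rank1 n (M : 'M[F]_n) (c : 'cV_n) (r : 'rV_n) :
  \det (M + c *m r) = \det M + \det (block_mx M c (- r) 0).
Proof.
have -> : \det (M + c *m r) = \det (block_mx M c (- r) 1%:M).
  have -> : block_mx M c (- r) 1%:M =
      block_mx (M + c *m r) c 0 1%:M *m block_mx 1%:M 0 (- r) 1%:M.
    rewrite mulmx_block !(mulmx1, mulmx0, mul0mx, mul1mx, add0r).
    by rewrite mulmxN addrK.
  by rewrite det_mulmx det_ublock det_lblock !det1 !mulr1.
(* The last row [(- r, 1)] is split as [(0, 1) + (- r, 0)], so [M] may be singular. *)
rewrite (@determinant_multilinear _ _ (block_mx M c (- r) 1%:M)
  (block_mx M c 0 1%:M) (block_mx M c (- r) 0) (rshift n ord0) 1 1).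
- by rewrite det_ublock det1 mulr1 !mul1r.
- rewrite !block_mxEv !rowKd !row_id !scale1r add_row_mx addr0 add0r.
  by [].
- apply/matrixP=> i j; rewrite !mxE; case: split_ordP => k.
    by move=> _; rewrite ?mxE; case: fintype.split => l; rewrite ?mxE.
  by rewrite (ord1 k) => E; have := neq_lift (rshift n ord0) i; rewrite E eqxx.
- apply/matrixP=> i j; rewrite !mxE; case: split_ordP => k.
    by move=> _; rewrite ?mxE; case: fintype.split => l; rewrite ?mxE.
  by rewrite (ord1 k) => E; have := neq_lift (rshift n ord0) i; rewrite E eqxx.
Qed.

Lemma det_castmx n m (e : n = m) (M : 'M[F]_n) : \det (castmx (e, e) M) = \det M.
Proof. by case: m / e; rewrite castmx_id. Qed.

(** Deletion and contraction. Iterated down to [A = 0], it is the Cauchy-Binet expansion: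
    [bdet (gram s) W] sums the squared determinants of the square systems made of all rows of [W]
    and some vectors of [s]. *)
Lemma bdet_rank1 n k (A : 'M[_]_n) (W : 'M[_]_(k, n)) (b : 'rV_n) :
  bdet (A + b^T *m b) W = bdet A W + bdet A (col_mx W b).
Proof.
rewrite /bdet.
have -> : block_mx (A + b^T *m b) W^T (- W) 0 =
   block_mx A W^T (- W) 0 + col_mx b^T 0 *m row_mx b (0 : 'M[_]_(1, k)).
  by rewrite mul_col_row !mulmx0 !mul0mx add_block_mx !addr0.
rewrite det_add_rank1; congr (_ + _).
rewrite -(det_castmx (esym (addnA n k 1))); congr (\det _).
rewrite tr_col_mx opp_col_mx opp_row_mx.
apply/matrixP=> i j; rewrite castmxE /=.
have cast_l (u : 'I_n) :
    cast_ord (esym (esym (addnA n k 1))) (lshift (k + 1) u) = lshift 1 (lshift k u).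
  exact: val_inj.
have cast_m (u : 'I_k) : cast_ord (esym (esym (addnA n k 1)))
    (rshift n (lshift 1 u)) = lshift 1 (rshift n u).
  exact: val_inj.
have cast_r (u : 'I_1) : cast_ord (esym (esym (addnA n k 1)))
    (rshift n (rshift k u)) = rshift (n + k) u.
  by apply: val_inj; rewrite /= addnA.
case: (split_ordP i) => i1 ->; last case: (split_ordP i1) => i2 ->;
  case: (split_ordP j) => j1 ->; try case: (split_ordP j1) => j2 ->;
  rewrite ?cast_l ?cast_m ?cast_r.
all: rewrite ?(block_mxEul, block_mxEur, block_mxEdl, block_mxEdr).
all: by rewrite ?(block_mxEul, block_mxEur, block_mxEdl, block_mxEdr,
  col_mxEu, col_mxEd, row_mxEl, row_mxEr) // !mxE ?oppr0.
Qed.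

Lemma bdet_unit n k (A : 'M[_]_n) (W : 'M[_]_(k, n)) : A \in unitmx ->
  bdet A W = \det A * \det (W *m invmx A *m W^T).
Proof.
move=> Au; rewrite /bdet.
have -> : block_mx A W^T (- W) 0 =
   block_mx A 0 (- W) (W *m invmx A *m W^T) *m block_mx 1%:M (invmx A *m W^T) 0 1%:M.
  rewrite mulmx_block !mulmx1 !mulmx0 ?mul0mx !addr0 ?mulmxA mulmxV // mul1mx.
  by rewrite !mulNmx addNr.
by rewrite det_mulmx det_ublock det_lblock !det1 !mulr1.
Qed.

Lemma det_eq0_ker n (A : 'M[F]_n) (x : 'rV_n) : x != 0 -> x *m A = 0 -> \det A = 0.
Proof. by move=> x0 xA; apply/eqP/det0P; exists x. Qed.

Lemma bdet_ker n k (A : 'M[_]_n) (W : 'M[_]_(k, n)) (x : 'rV_n) : x != 0 ->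
  x *m A = 0 -> W *m x^T = 0 -> bdet A W = 0.
Proof.
move=> x0 xA xW; apply: (@det_eq0_ker _ _ (row_mx x 0)).
  by apply: contra_neq x0 => /eqP; rewrite row_mx_eq0 => /andP[/eqP].
rewrite mul_row_block xA !mul0mx !addr0 -(trmxK (x *m W^T)) trmx_mul trmxK xW.
by rewrite trmx0 row_mx0.
Qed.

Lemma bdet_ker_row n k (A : 'M[_]_n) (W : 'M[_]_(k, n)) (x : 'rV_k) : x != 0 ->
  x *m W = 0 -> bdet A W = 0.
Proof.
move=> x0 xW; apply: (@det_eq0_ker _ _ (row_mx 0 x)).
  by apply: contra_neq x0 => /eqP; rewrite row_mx_eq0 => /andP[_ /eqP].
by rewrite mul_row_block !mul0mx mulmxN xW oppr0 mulmx0 !addr0 row_mx0.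
Qed.

Lemma bdet_conj n k (U A : 'M[_]_n) (W : 'M[_]_(k, n)) :
  bdet (U^T *m A *m U) (W *m U) = \det U ^+ 2 * bdet A W.
Proof.
rewrite /bdet.
have -> : block_mx (U^T *m A *m U) (W *m U)^T (- (W *m U)) 0 =
   block_mx U^T 0 0 1%:M *m block_mx A W^T (- W) 0 *m block_mx U 0 0 1%:M.
  rewrite !mulmx_block !mulmx1 !mulmx0 ?mul0mx ?mul1mx !addr0 ?add0r.
  by rewrite trmx_mul mulNmx ?mul0mx ?mulmx0 ?addr0.
by rewrite !det_mulmx !det_ublock !det1 !mulr1 det_tr; ring.
Qed.

Lemma bdet0_square n (W : 'M[_]_n) : bdet 0 W = \det W ^+ 2.
Proof.
rewrite /bdet.
have H : \det (block_mx 0 (- 1%:M) 1%:M 0 : 'M[F]_(n + n)) = 1.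
  have -> : block_mx 0 (- 1%:M) 1%:M 0 =
     block_mx 1%:M (- 1%:M) 0 1%:M *m block_mx 1%:M 0 1%:M 1%:M
     *m block_mx 1%:M (- 1%:M) 0 1%:M :> 'M[F]_(n + n).
    rewrite !mulmx_block !(mulmx1, mulmx0, mul0mx, mul1mx, addr0, add0r, mulNmx, mulmxN).
    by rewrite ?addrN ?addNr !(oppr0, add0r, addr0, mul0mx, mulmx0, mulmxN, mulmx1, addNr, addrN).
  by rewrite !det_mulmx !det_ublock !det_lblock !det1 !mulr1.
rewrite -[LHS]mulr1 -[X in _ * X = _]H -det_mulmx mulmx_block.
rewrite !(mulmx1, mulmx0, mul0mx, mul1mx, addr0, add0r, mulNmx, mulmxN) opprK.
by rewrite det_ublock det_tr expr2.
Qed.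

Lemma bdet0_nonsquare n k (W : 'M[_]_(k, n)) : k != n -> bdet 0 W = 0.
Proof.
move=> kn; apply/eqP/negPn/negP; rewrite -unitfE -/(_ \in unitmx).
move=> Mu; have := mxrank_unit Mu.
have -> : block_mx 0 W^T (- W) 0 = col_mx (row_mx 0 W^T) (row_mx (- W) 0) :> 'M[_]_(n + k).
  by rewrite block_mxEv.
move=> E.
have L1 : (\rank (row_mx 0 W^T : 'M[_]_(n, n + k)) = \rank W)%N.
  by rewrite -mxrank_tr tr_row_mx trmxK trmx0 rank_col_0mx.
have L2 : (\rank (row_mx (- W) 0 : 'M[_]_(k, n + k)) = \rank W)%N.
  by rewrite -mxrank_tr tr_row_mx trmx0 rank_col_mx0 mxrank_tr mxrank_opp.
have := (rank_leq_row W, rank_leq_col W); case=> Wk Wn.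
have : (n + k <= \rank W + \rank W)%N.
  by rewrite -{1}E -addsmxE -{1}L1 -{1}L2 mxrank_adds_leqif.
by move: kn Wk Wn; lia.
Qed.

End BorderedDeterminant.

Section Gram.
Variable F : realFieldType.

(** For the edge vectors of a graph this is its Laplacian. *)
Definition gram n (s : seq 'rV[F]_n) : 'M[F]_n := \sum_(b <- s) b^T *m b.

Lemma gram_cons n (b : 'rV[F]_n) s : gram (b :: s) = b^T *m b + gram s.
Proof. by rewrite /gram big_cons. Qed.

Lemma gram_sym n (s : seq 'rV[F]_n) : (gram s)^T = gram s.
Proof.
rewrite /gram linear_sum /=; apply: eq_bigr => b _.
by rewrite trmx_mul trmxK.
Qed.

Lemma gram_form n (s : seq 'rV[F]_n) (x : 'rV_n) :
  (x *m gram s *m x^T) 0 0 = \sum_(b <- s) (x *m b^T) 0 0 ^+ 2.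
Proof.
elim: s => [|b s IH]; first by rewrite /gram !big_nil mulmx0 mul0mx mxE.
rewrite gram_cons big_cons mulmxDr mulmxDl mxE IH; congr (_ + _).
rewrite mulmxA -mulmxA -[b *m x^T]trmxK trmx_mul trmxK.
by rewrite mxE big_ord1 expr2; congr (_ * _); rewrite mxE.
Qed.

Lemma gram_form_ge0 n (s : seq 'rV[F]_n) (x : 'rV_n) :
  0 <= (x *m gram s *m x^T) 0 0.
Proof. by rewrite gram_form; apply: sumr_ge0 => b _; apply: sqr_ge0. Qed.

Lemma gram_form_eq0 n (s : seq 'rV[F]_n) (x : 'rV_n) :
  (x *m gram s *m x^T) 0 0 = 0 -> x *m gram s = 0.
Proof.
elim: s => [|b s IH]; first by rewrite /gram !big_nil mulmx0.
rewrite gram_cons mulmxDr mulmxDl mxE => /eqP; rewrite paddr_eq0; last first.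
- exact: gram_form_ge0.
- by have := gram_form_ge0 [:: b] x; rewrite /gram big_seq1.
move=> /andP[/eqP H1 /eqP /IH ->]; rewrite addr0.
have := gram_form [:: b] x; rewrite {1}/gram !big_seq1 H1 => /esym/eqP.
rewrite sqrf_eq0 => /eqP E.
by rewrite mulmxA [x *m b^T]mx11_scalar E raddf0 mul0mx.
Qed.

Lemma bdet_gram_ge0 n k (s : seq 'rV[F]_n) (W : 'M[_]_(k, n)) :
  0 <= bdet (gram s) W.
Proof.
elim: s k W => [|b s IH] k W.
  rewrite /gram big_nil; have [e|kn] := eqVneq k n; last first.
    by rewrite bdet0_nonsquare.
  by case: n / e W => W; rewrite bdet0_square sqr_ge0.
by rewrite gram_cons addrC bdet_rank1 addr_ge0.
Qed.

Lemma invmx_gram_form n (s : seq 'rV[F]_n) (x : 'rV_n) : gram s \in unitmx ->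
  let y := x *m invmx (gram s) in
  x *m invmx (gram s) *m x^T = y *m gram s *m y^T.
Proof.
move=> Au /=; rewrite trmx_mul trmx_inv gram_sym.
by rewrite mulmxKV // mulmxA.
Qed.

(** In the inner product given by [invmx (gram s)], appending [b] to independent rows [W] multiplies
    their Gram determinant by the squared distance of [b] to the span of [W], which is at most the
    squared length of [b]. For a random basis this is negative correlation between containing [W]
    and containing [b]. *)
Lemma bdet_rayleigh n k (s : seq 'rV[F]_n) (W : 'M[_]_(k, n)) (b : 'rV_n) :
  gram s \in unitmx ->
  bdet (gram s) (col_mx W b) * \det (gram s) <= bdet (gram s) W * bdet (gram s) b.
Proof.
set A := gram s => Au; rewrite !bdet_unit //.
set K := invmx A.
have Ksym : K^T = K by rewrite /K trmx_inv gram_sym.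
have Apos : 0 < \det A.
  rewrite lt_def; apply/andP; split; first by move: Au; rewrite unitmxE unitfE.
  have := bdet_gram_ge0 s (0 : 'M[_]_(0, n)).
  by rewrite bdet_unit // det_mx00 mulr1.
set Y := W *m K *m W^T; pose y := W *m K *m b^T.
have Ysym : Y^T = Y by rewrite /Y !trmx_mul trmxK Ksym mulmxA.
have -> : col_mx W b *m K *m (col_mx W b)^T =
    block_mx Y y y^T (b *m K *m b^T).
  rewrite mul_col_mx tr_col_mx mul_col_row /y !trmx_mul trmxK Ksym.
  by rewrite mulmxA.
have Yform (c : 'rV_k) : c *m Y *m c^T = (c *m W) *m K *m (c *m W)^T.
  by rewrite /Y trmx_mul !mulmxA.
have Y0 : 0 <= \det Y.
  by have := bdet_gram_ge0 s W; rewrite bdet_unit // pmulr_rge0.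
(* If [Y] is singular, some nontrivial combination of the rows of [W] has length zero, so it is
   orthogonal to [b] as well and both sides vanish. *)
have [Yu|Yn] := boolP (Y \in unitmx); last first.
  have : \det Y = 0 by apply/eqP; move: Yn; rewrite unitmxE unitfE negbK.
  move=> Yd; rewrite Yd mulr0 mul0r.
  move/eqP/det0P: Yd => [c c0 cY].
  suff -> : \det (block_mx Y y y^T (b *m K *m b^T)) = 0.
    by rewrite mulr0 mul0r.
  apply: (@det_eq0_ker _ _ _ (row_mx c 0)).
    by apply: contra_neq c0 => /eqP; rewrite row_mx_eq0 => /andP[/eqP].
  rewrite mul_row_block !mul0mx !addr0 cY.
  suff -> : c *m y = 0 by rewrite row_mx0.
  have : (c *m W) *m K *m (c *m W)^T = 0 by rewrite -Yform cY mul0mx.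
  rewrite invmx_gram_form // => H.
  have := @gram_form_eq0 _ s (c *m W *m K); rewrite H mxE => /(_ erefl) cWA.
  have cW0 : c *m W *m K = 0 by rewrite -[LHS]mulmx1 -(mulmxV Au) mulmxA cWA mul0mx.
  by rewrite /y mulmxA (mulmxA c) cW0 mul0mx.
have -> : block_mx Y y y^T (b *m K *m b^T) = 
    block_mx Y 0 y^T (b *m K *m b^T - y^T *m invmx Y *m y) *m
    block_mx 1%:M (invmx Y *m y) 0 1%:M.
  rewrite mulmx_block !(mulmx1, mulmx0, mul0mx, mul1mx, addr0, add0r).
  by rewrite !mulmxA mulmxV // mul1mx addrC subrK.
rewrite det_mulmx det_lblock det_ublock !det1 !mulr1.
rewrite !det_mx11.
have Q0 : 0 <= (y^T *m invmx Y *m y) 0 0.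
  have -> : y^T *m invmx Y *m y = (y^T *m invmx Y) *m Y *m (y^T *m invmx Y)^T.
    rewrite [(y^T *m invmx Y)^T]trmx_mul trmx_inv Ysym trmxK mulmxKV //.
    by rewrite !mulmxA.
  rewrite Yform /K invmx_gram_form //.
  exact: gram_form_ge0.
set q := (y^T *m invmx Y *m y) 0 0 in Q0 *.
set bb := (b *m K *m b^T) 0 0.
have -> : (b *m K *m b^T - y^T *m invmx Y *m y) 0 0 = bb - q.
  by rewrite mxE [(- _ : 'M[_]_1) _ _]mxE.
have : 0 <= \det A * \det Y * \det A * q by do !apply: mulr_ge0 => //; exact: ltW.
by set d := \det A; set e := \det Y; lra.
Qed.

End Gram.

Section ListForm.
Variable F : realFieldType.

Definition bdetl n (A : 'M[F]_n) (l : seq 'rV[F]_n) : F :=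
  bdet A (\matrix_(i < size l) l`_i).

Lemma bdetl_nil n (A : 'M[F]_n) : bdetl A [::] = \det A.
Proof.
rewrite /bdetl /bdet /=.
have -> : block_mx A (\matrix_(i < 0) [::]`_i)^T (- \matrix_(i < 0) [::]`_i) 0
   = block_mx A 0 0 0 :> 'M[_]_(n + 0).
  by congr block_mx; rewrite ?flatmx0 // thinmx0.
by rewrite det_ublock det_mx00 mulr1.
Qed.

Lemma bdetl_col n (A : 'M[F]_n) l b :
  bdetl A (rcons l b) = bdet A (col_mx (\matrix_(i < size l) l`_i) b).
Proof.
apply: bdet_castr => [|i i' j ii']; first by rewrite size_rcons addn1.
rewrite mxE nth_rcons ii'; case: (split_ordP i') => k ->.
  by rewrite col_mxEu mxE.
by rewrite col_mxEd (ord1 k) /= addn0 eqxx.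
Qed.

Lemma bdetl_rank1 n (A : 'M[F]_n) l b :
  bdetl (A + b^T *m b) l = bdetl A l + bdetl A (rcons l b).
Proof. by rewrite bdetl_col -bdet_rank1. Qed.

Lemma mul_rows_eq0 n (l : seq 'rV[F]_n) (x : 'rV[F]_n) :
  (forall b, b \in l -> b *m x^T = 0) -> (\matrix_(i < size l) l`_i) *m x^T = 0.
Proof.
move=> H; apply/row_matrixP => i; rewrite row_mul rowK row0; apply: H.
exact: mem_nth.
Qed.

Lemma bdetl_ker n (A : 'M[F]_n) l (x : 'rV_n) : x != 0 -> x *m A = 0 ->
  (forall b, b \in l -> b *m x^T = 0) -> bdetl A l = 0.
Proof. by move=> x0 xA H; apply: (bdet_ker x0 xA); apply: mul_rows_eq0. Qed.

Lemma mul_gram_eq0 n (s : seq 'rV[F]_n) (x : 'rV_n) :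
  (forall b, b \in s -> b *m x^T = 0) -> x *m gram s = 0.
Proof.
move=> H; rewrite /gram mulmx_sumr big_seq big1 // => b bs.
by rewrite mulmxA -[x *m _]trmxK trmx_mul trmxK H // trmx0 mul0mx.
Qed.

Lemma gram_perm n (s s' : seq 'rV[F]_n) : perm_eq s s' -> gram s = gram s'.
Proof. by move=> ss'; apply: perm_big. Qed.

(* Every basis contained in [s] extended by [l] must contain the vectors of
   [idx], hence wiring them by rank-one terms or by borders is the same. *)
Lemma bdetl_wire n (I : eqType) (vec fn : I -> 'rV[F]_n) (idx : seq I) l :
  uniq idx ->
  (forall i, i \in idx -> fn i != 0) ->
  {in idx &, forall i j, i != j -> vec j *m (fn i)^T = 0} ->
  (forall i, i \in idx -> forall b, b \in l -> b *m (fn i)^T = 0) ->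
  bdetl (gram (map vec idx)) l = bdetl 0 (l ++ map vec idx).
Proof.
elim: idx l => [|i idx IH] l /=; first by rewrite cats0 /gram big_nil.
case/andP=> iidx uidx H1 H2 H3.
rewrite gram_cons addrC bdetl_rank1 -cat_rcons -IH //.
- rewrite (_ : bdetl _ l = 0) ?add0r //; apply: (@bdetl_ker _ _ _ (fn i)).
  + by apply: H1; rewrite mem_head.
  + apply: mul_gram_eq0 => b /mapP [j jidx ->].
    apply: H2; rewrite ?inE ?eqxx ?jidx ?orbT //.
    by apply: contraNneq iidx => ->.
  + by apply: H3; rewrite mem_head.
- by move=> j jidx; apply: H1; rewrite inE jidx orbT.
- by move=> j k jidx kidx; apply: H2; rewrite inE ?jidx ?kidx orbT.
- move=> j jidx b; rewrite mem_rcons inE => /orP[/eqP ->|bl].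
    apply: H2; rewrite ?inE ?eqxx ?jidx ?orbT //.
    by apply: contraNneq iidx => <-.
  by apply: H3 => //; rewrite inE jidx orbT.
Qed.

(** A further vector lowers the probability that a random basis contains [l]: after expanding both
    sides by [bdet_rank1] a common term cancels, and [bdet_rayleigh] compares the others. *)
Lemma bdetl_gram_step n (s : seq 'rV[F]_n) l b : 0 < \det (gram s) ->
  bdetl (gram (b :: s)) l * \det (gram s) <= bdetl (gram s) l * \det (gram (b :: s))
  /\ 0 < \det (gram (b :: s)).
Proof.
move=> dpos; have Au : gram s \in unitmx by rewrite unitmxE unitfE gt_eqF.
rewrite gram_cons addrC bdetl_rank1 bdetl_col.
rewrite -(bdetl_nil (_ + _)) bdetl_rank1 bdetl_nil.
have -> : bdetl (gram s) (rcons [::] b) = bdet (gram s) b.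
  apply: bdet_castr => // i i' j; rewrite mxE => /= ii'.
  by rewrite (ord1 i) (ord1 i').
split; last by apply: ltr_wpDr => //; apply: bdet_gram_ge0.
rewrite mulrDl mulrDr lerD2l; exact: bdet_rayleigh.
Qed.

Lemma bdetl_gram_mono n (s s' : seq 'rV[F]_n) l : 0 < \det (gram s) ->
  bdetl (gram (s' ++ s)) l * \det (gram s) <= bdetl (gram s) l * \det (gram (s' ++ s))
  /\ 0 < \det (gram (s' ++ s)).
Proof.
move=> dpos; elim: s' => [|b s' [IH1 IH2]] //=.
have [H1 H2] := bdetl_gram_step l b IH2; split => //.
rewrite -(ler_pM2r IH2) mulrAC [X in X <= _]mulrC.
have := ler_wpM2l (ltW dpos) H1.
have := ler_wpM2r (ltW H2) IH1.
move: (bdetl _ l) (bdetl _ l) (bdetl _ l) => x y z.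
move: (\det _) (\det _) (\det _) => a b' c; nra.
Qed.

Lemma bdetl_gram_conj n (U : 'M[F]_n) (s s' l : seq 'rV[F]_n) :
  \det U = 1 -> s' = map (mulmx^~ U) s -> map (mulmx^~ U) l = l ->
  bdetl (gram s') l = bdetl (gram s) l.
Proof.
move=> dU -> lU.
have -> : gram (map (mulmx^~ U) s) = U^T *m gram s *m U.
  rewrite /gram big_map mulmx_sumr mulmx_suml; apply: eq_bigr => b _.
  by rewrite trmx_mul !mulmxA.
rewrite -[in LHS]lU /bdetl -[RHS]mul1r -[X in X * _](expr1n _ 2) -dU -bdet_conj.
apply: bdet_castr => [|i i' j ii']; first by rewrite size_map.
have il : (i < size l)%N by rewrite (leq_trans (ltn_ord i)) // size_map.
rewrite mxE (nth_map 0) //.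
rewrite !mxE; apply: eq_bigr => k _; congr (_ * _).
by rewrite mxE ii'.
Qed.

End ListForm.

(** * Incidence vectors, and growth of a grounded vertex set *)

Section Incidence.
Variables (R : comRingType) (T : finType).

Definition vx (x : T) : 'rV[R]_#|T| := delta_mx 0 (enum_rank x).
Definition ev (p : T * T) : 'rV[R]_#|T| := vx p.1 - vx p.2.
Definition chi (S : {set T}) : 'rV[R]_#|T| := \row_i (enum_val i \in S)%:R.

Lemma vx_mul (x : T) (y : 'rV[R]_#|T|) : vx x *m y^T = (y 0 (enum_rank x))%:M.
Proof.
by rewrite /vx -rowE; apply/rowP => i; rewrite !mxE (ord1 i).
Qed.

Lemma chiE (S : {set T}) x : chi S 0 (enum_rank x) = (x \in S)%:R.
Proof. by rewrite mxE enum_rankK. Qed.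

Lemma vx_chi (S : {set T}) x : vx x *m (chi S)^T = (x \in S)%:R%:M.
Proof. by rewrite vx_mul chiE. Qed.

Lemma ev_chi (S : {set T}) p : ev p *m (chi S)^T = ((p.1 \in S)%:R - (p.2 \in S)%:R)%:M.
Proof. by rewrite /ev mulmxBl !vx_chi -raddfB. Qed.

Lemma ev_chi0 (S : {set T}) p : (p.1 \in S) = (p.2 \in S) -> ev p *m (chi S)^T = 0.
Proof. by move=> e; rewrite ev_chi e subrr raddf0. Qed.

End Incidence.

Lemma chi_neq0 (R : comRingType) (T : finType) (S : {set T}) x :
  x \in S -> chi R S != 0.
Proof.
move=> xS; apply/eqP => /rowP /(_ (enum_rank x)).
by rewrite chiE xS mxE; apply/eqP; rewrite oner_eq0.
Qed.

Section Growth.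
Variables (F : realFieldType) (T : finType) (r : T).

(* Vertices outside [S] are wired individually to the ground, as is [r], so
   the determinant of the Gram matrix counts the spanning trees of [S]. *)
Definition wl (S : {set T}) (E : seq (T * T)) : seq 'rV[F]_#|T| :=
  map (@vx F T) (r :: enum (~: S)) ++ map (@ev F T) E.

Lemma ev_swap (p : T * T) : ev F (p.2, p.1) = - ev F p.
Proof. by rewrite /ev opprB. Qed.

(** This transvection sends [x] to [x - x_v * vx u]. It turns the ground vector [vx v] into the edge
    vector of [(v, u)] and fixes every vector that vanishes at [v]. *)
Lemma transvection_det (u v : T) : u != v ->
  \det (1%:M + (vx F v)^T *m (- vx F u)) = 1.
Proof.
move=> uv; rewrite det_add_rank1 det1.
have -> : block_mx 1%:M (vx F v)^T (- - vx F u) 0 =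
  block_mx 1%:M 0 (vx F u) 0 *m block_mx 1%:M (vx F v)^T 0 1%:M.
  rewrite mulmx_block !(mulmx1, mulmx0, mul0mx, mul1mx, addr0, add0r) opprK.
  rewrite vx_mul {2}/vx mxE eqxx /= (inj_eq enum_rank_inj) (negPf uv).
  by rewrite raddf0.
by rewrite det_mulmx det_lblock det_mx11 mxE mulr0 mul0r addr0.
Qed.

Lemma transvection_id (u v : T) (x : 'rV[F]_#|T|) : x 0 (enum_rank v) = 0 ->
  x *m (1%:M + (vx F v)^T *m (- vx F u)) = x.
Proof.
move=> xv; rewrite mulmxDr mulmx1 mulmxA -[x *m _]trmxK trmx_mul trmxK.
by rewrite vx_mul xv raddf0 trmx0 mul0mx addr0.
Qed.

Lemma vx_neq (x v : T) : x != v -> vx F x 0 (enum_rank v) = 0.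
Proof.
by move=> xv; rewrite mxE eqxx (inj_eq enum_rank_inj) eq_sym (negPf xv).
Qed.

Lemma gram_wl (S : {set T}) E : gram (wl S E) =
  (vx F r)^T *m vx F r + \sum_(x in ~: S) (vx F x)^T *m vx F x
  + gram (map (@ev F T) E).
Proof.
by rewrite /gram /wl big_cat /= big_cons big_map big_enum /=.
Qed.

Lemma gram_wlU (S : {set T}) E v : v \notin S ->
  gram (wl S E) = gram (vx F v :: wl (v |: S) E).
Proof.
move=> vS; rewrite [RHS]gram_cons !gram_wl (bigD1 v) ?inE //=.
rewrite (eq_bigl (fun x => x \in ~: (v |: S))) => [|x].
  by rewrite !addrA; congr (_ + _ + _); rewrite addrC.
by rewrite !inE negb_or andbC.
Qed.

Lemma gram_wl_cons (S : {set T}) E p : gram (wl S (p :: E)) = gram (ev F p :: wl S E).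
Proof. by rewrite [RHS]gram_cons !gram_wl /= gram_cons addrCA. Qed.

(** A vertex attached to [S] by its only edge counts like a grounded vertex: a transvection
    exchanges the edge vector with the ground vector and leaves all others alone. *)
Lemma pendant_bdetl (S : {set T}) (E : seq (T * T)) (l : seq 'rV[F]_#|T|)
    (u v : T) (p : T * T) :
  r \in S -> u \in S -> v \notin S -> p = (u, v) \/ p = (v, u) ->
  (forall q, q \in E -> (q.1 \in S) && (q.2 \in S)) ->
  (forall b, b \in l -> b 0 (enum_rank v) = 0) ->
  bdetl (gram (wl (v |: S) (p :: E))) l = bdetl (gram (wl S E)) l.
Proof.
move=> rS uS vS puv ES lv.
have uv : u != v by apply: contraNneq vS => <-.
set s0 := wl (v |: S) E.
have -> : bdetl (gram (wl S E)) l = bdetl (gram (vx F v :: s0)) l.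
  by rewrite (gram_wlU _ vS).
have -> : gram (wl (v |: S) (p :: E)) = gram ((vx F v - vx F u) :: s0).
  rewrite gram_wl_cons [LHS]gram_cons [RHS]gram_cons; congr (_ + _).
  case: puv => -> //; rewrite -[vx F v - _]/(ev F (v, u)).
  have -> : ev F (u, v) = - ev F (v, u) by exact: (ev_swap (v, u)).
  by rewrite [(- _)^T]linearN /= mulNmx mulmxN opprK.
apply: (bdetl_gram_conj (transvection_det uv)).
  rewrite /=; congr (_ :: _).
    rewrite mulmxDr mulmx1 mulmxA vx_mul mxE !eqxx /=.
    by rewrite mulmxN mul1mx.
  rewrite -[LHS]map_id; apply/eq_in_map => b bs.
  rewrite /= transvection_id //.
  move: bs; rewrite mem_cat => /orP[/mapP[x]|/mapP[q qE ->]].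
    rewrite inE => xr ->; apply: vx_neq.
    case/orP: xr => [/eqP ->|]; first by apply: contraNneq vS => <-.
    by rewrite mem_enum !inE negb_or => /andP[].
  have /andP[q1 q2] := ES _ qE.
  rewrite /ev mxE [X in _ + X]mxE !vx_neq ?subr0 //.
    by apply: contraNneq vS => <-.
  by apply: contraNneq vS => <-.
rewrite -[RHS]map_id; apply/eq_in_map => b bs; apply: transvection_id; exact: lv.
Qed.

Lemma gram_wl_perm (S : {set T}) E E' : perm_eq E E' -> gram (wl S E) = gram (wl S E').
Proof. by move=> EE'; rewrite !gram_wl (gram_perm (perm_map _ EE')). Qed.

(** Induction on the number of vertices outside [S]. Connectedness provides an edge that leaves [S];
    using it as a pendant edge for its outer end changes neither determinant. *)
Lemma grow (S : {set T}) (E rest : seq (T * T)) (l : seq 'rV[F]_#|T|) :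
  r \in S ->
  (forall q, q \in E -> (q.1 \in S) && (q.2 \in S)) ->
  (forall b v, b \in l -> v \notin S -> b 0 (enum_rank v) = 0) ->
  (forall (S' : {set T}) x, r \in S' -> x \notin S' ->
     exists2 p, p \in E ++ rest & (p.1 \in S') != (p.2 \in S')) ->
  0 < \det (gram (wl S E)) ->
  bdetl (gram (wl finset.setT (E ++ rest))) l * \det (gram (wl S E)) <=
  bdetl (gram (wl S E)) l * \det (gram (wl finset.setT (E ++ rest))).
Proof.
move: {2}#|~: S| (leqnn #|~: S|) => m.
elim: m S E rest => [|m IH] S E rest Sm rS ES lS conn dpos; last first.
  have [/existsP[x xS]|/existsPn noS] := boolP [exists x, x \notin S]; last first.
    apply: IH => //; rewrite (_ : ~: S = finset.set0) ?cards0 //.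
    by apply/setP => x; rewrite !inE; have := noS x; rewrite negbK => ->.
  have [p pE pS] := conn S x rS xS.
  have pnE : p \notin E by apply/negP => /ES /andP[p1 p2]; rewrite p1 p2 in pS.
  have prest : p \in rest by move: pE; rewrite mem_cat (negPf pnE).
  have perm_p : perm_eq (E ++ rest) ((p :: E) ++ seq.rem p rest).
    rewrite (perm_trans (y := E ++ (p :: seq.rem p rest))) //.
      by rewrite perm_cat2l perm_to_rem.
    by rewrite -cat1s perm_catCA.
  have [u [v [uS vS puv]]] : exists u v, [/\ u \in S, v \notin S & p = (u, v) \/ p = (v, u)].
    case: p pS {pE pnE prest perm_p} => a b /=.
    case aS: (a \in S); case bS: (b \in S) => // _.
      by exists a, b; rewrite aS bS; split=> //; left.
    by exists b, a; rewrite aS bS; split=> //; right.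
  rewrite !(gram_wl_perm _ perm_p) -!bdetl_nil.
  rewrite -(pendant_bdetl rS uS vS puv ES (l := [::])) //.
  rewrite -(pendant_bdetl rS uS vS puv ES (l := l)); last by move=> b bl; exact: lS.
  rewrite !bdetl_nil; apply: IH.
  - rewrite -ltnS; apply: leq_trans Sm; apply: proper_card; apply/properP; split.
      by apply/fintype.subsetP => y; rewrite !inE negb_or => /andP[].
    by exists v; rewrite !inE ?eqxx.
  - by rewrite !inE rS orbT.
  - move=> q; rewrite !inE => /orP[/eqP ->|/ES /andP[-> ->]]; last by rewrite !orbT.
    by case: puv => -> /=; rewrite uS eqxx !orbT.
  - by move=> b w bl; rewrite !inE negb_or => /andP[_]; apply: lS.
  - move=> S' y rS' yS'; have [q qE qS'] := conn S' y rS' yS'.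
    by exists q => //; rewrite -(perm_mem perm_p).
  - rewrite -bdetl_nil (pendant_bdetl rS uS vS puv ES (l := [::])) //.
    by rewrite bdetl_nil.
(* All vertices are attached now, so the remaining edges are mere additions to the Gram matrix. *)
have ST : S = finset.setT.
  by apply/setP => x; move: Sm; rewrite inE leqn0 cards_eq0 => /eqP/setP/(_ x);
     rewrite !inE => /negbFE.
rewrite ST in dpos *.
have -> : gram (wl finset.setT (E ++ rest)) = gram (map (@ev F T) rest ++ wl finset.setT E).
  apply: gram_perm; rewrite /wl map_cat catA perm_sym.
  by rewrite perm_catC.
exact: (bdetl_gram_mono _ _ dpos).1.
Qed.

End Growth.

(** * Spanning trees containing given edges *)

Section EdgeLists.
Variable T : finType.
Implicit Types (L : seq (T * T)) (p : T * T).

Definition swap p : T * T := (p.2, p.1).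

Lemma swapK : involutive swap. Proof. by case. Qed.

Definition sym_edges L : {set T * T} := [set p | (p \in L) || (swap p \in L)]%SET.

(** Every undirected edge is listed at most once, in one orientation; loops are excluded too, being
    equal to their own swap. *)
Definition edge_list L : bool := uniq (L ++ map swap L).

Definition conn L : Prop := forall x y, connect (tree_rel (sym_edges L)) x y.

Lemma sym_edges_sym L : symmetric (tree_rel (sym_edges L)).
Proof. by move=> x y; rewrite /tree_rel !inE orbC. Qed.

Lemma edge_list_uniq L : edge_list L -> uniq L.
Proof. by rewrite /edge_list cat_uniq => /andP[]. Qed.

Lemma edge_list_swap L p : edge_list L -> p \in L -> swap p \notin L.
Proof.
rewrite /edge_list cat_uniq => /and3P[_ /hasPn H _] pL.
apply: H; exact: map_f.
Qed.

Lemma edge_list_neq L p : edge_list L -> p \in L -> p.1 != p.2.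
Proof.
move=> uL pL; apply/eqP => e; have := edge_list_swap uL pL.
by case: p e pL => a b /= <- ->.
Qed.

Lemma mem_rem_edge L p q : edge_list L -> p \in L -> q \in L -> q != p ->
  q \in seq.rem p L.
Proof. by move=> uL pL qL qp; rewrite mem_rem_uniq ?edge_list_uniq // inE qp. Qed.

Lemma conn_component L (x : T) :
  let C := [set y | connect (tree_rel (sym_edges L)) x y]%SET in
  forall p, p \in L -> (p.1 \in C) = (p.2 \in C).
Proof.
move=> C p pL; rewrite !inE.
have p12 : tree_rel (sym_edges L) p.1 p.2 by rewrite /tree_rel inE -surjective_pairing pL.
by apply: same_connect_r;
   [exact/sym_connect_sym/sym_edges_sym | exact: connect1].
Qed.

Lemma acyclic_cut L p : edge_list L -> p \in L -> acyclic (sym_edges L) ->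
  ~~ connect (tree_rel (sym_edges (seq.rem p L))) p.1 p.2.
Proof.
move=> uL pL ac; apply/negP => /connectP[q0 pth lst].
case/shortenP: pth lst => q pq uq _ lst.
have sub : subrel (tree_rel (sym_edges (seq.rem p L))) (tree_rel (sym_edges L)).
  move=> x y; rewrite /tree_rel !inE => /orP[] /mem_rem ->; rewrite ?orbT //.
have p12 := edge_list_neq uL pL.
(* A path of length 0 would make [p] a loop and one of length 1 would be the removed edge itself;
   only a longer path closes up to a cycle of at least three vertices, as [acyclic] demands. *)
case: q pq uq lst => [|a [|b q]] pq uq lst.
- by move: p12; rewrite lst eqxx.
- move: pq; rewrite /= andbT /tree_rel inE /= in lst *; rewrite -lst.
  rewrite -surjective_pairing mem_rem_uniqF ?edge_list_uniq //=.
  by move/mem_rem; apply/negP; exact: edge_list_swap.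
- apply: (ac [:: p.1, a, b & q]) => //; apply/andP; split=> //.
  change (path (tree_rel (sym_edges L)) p.1 (rcons [:: a, b & q] p.1)).
  rewrite rcons_path (sub_path sub pq) -lst /tree_rel inE /swap /=.
  by rewrite -surjective_pairing pL orbT.
Qed.

Lemma cycle_cut L (c : seq T) : edge_list L -> (2 < size c)%N ->
  ucycle (tree_rel (sym_edges L)) c -> conn L ->
  exists2 p, p \in L & conn (seq.rem p L).
Proof.
move=> uL; case: c => [|x [|y [|z s]]] //= _ /andP[cyc unq] cL.
have /and3P[exy eyz pth] := cyc.
have [p pL pxy] : exists2 p, p \in L & p = (x, y) \/ p = (y, x).
  move: exy; rewrite /tree_rel inE => /orP[] ?; first by exists (x, y); [|left].
  by exists (y, x); [|right].
exists p => //.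
have keep a b : tree_rel (sym_edges L) a b -> (a, b) != (x, y) -> (a, b) != (y, x) ->
    tree_rel (sym_edges (seq.rem p L)) a b.
  rewrite /tree_rel !inE => /orP[] H n1 n2; apply/orP; [left|right].
    by apply: mem_rem_edge => //; case: pxy => ->.
  apply: mem_rem_edge => //; apply: contraTneq n1 => E.
  move: E n2; rewrite /swap /=; case: pxy => -> [-> ->]; rewrite ?eqxx //.
move: unq; rewrite /= !inE !negb_or => /and4P[/and3P[xy xz xs] /andP[yz ys] zs us].
have kyz : tree_rel (sym_edges (seq.rem p L)) y z.
  by apply: keep eyz _ _; rewrite xpair_eqE negb_and ?[_ == z]eq_sym ?(eq_sym z x) ?xz ?yz ?orbT // eq_sym xy.
have kpth : path (tree_rel (sym_edges (seq.rem p L))) z (rcons s x).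
  apply: (@sub_in_path _ (predC1 y) (tree_rel (sym_edges L))) pth.
    move=> a b; rewrite !inE => ay by_ eab; apply: keep eab _ _;
      by rewrite xpair_eqE negb_and ?ay ?by_ ?orbT.
  rewrite /= eq_sym yz /= all_rcons /= xy /=; apply/allP => w ws /=.
  by apply: contraNneq ys => <-.
have cyx : connect (tree_rel (sym_edges (seq.rem p L))) y x.
  apply: connect_trans (connect1 kyz) _; apply/connectP.
  by exists (rcons s x) => //; rewrite last_rcons.
have cxy : connect (tree_rel (sym_edges (seq.rem p L))) x y.
  by rewrite (sym_connect_sym (@sym_edges_sym _)).
move=> a b; apply: (connect_sub _ (cL a b)) => {}a {}b eab.
have [[-> ->] //|n1] := eqVneq (a, b) (x, y).
have [[-> ->] //|n2] := eqVneq (a, b) (y, x).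
exact/connect1/keep.
Qed.

End EdgeLists.

(** * Integral bases and determinants of spanning trees *)

Section IntegerSpan.
Variables (n : nat) (l : seq 'rV[int]_n).

Definition zspan (x : 'rV[int]_n) : Prop :=
  exists c : 'rV_(size l), c *m (\matrix_(i < size l) l`_i) = x.

Lemma zspan_mem x : x \in l -> zspan x.
Proof.
move=> xl; have il : (index x l < size l)%N by rewrite index_mem.
exists (delta_mx 0 (Ordinal il)); rewrite -rowE rowK /= nth_index //.
Qed.

Lemma zspanD x y : zspan x -> zspan y -> zspan (x + y).
Proof. by case=> c <- [d <-]; exists (c + d); rewrite mulmxDl. Qed.

Lemma zspanN x : zspan x -> zspan (- x).
Proof. by case=> c <-; exists (- c); rewrite mulNmx. Qed.

Lemma zspan_full : (forall i, zspan (delta_mx 0 i)) ->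
  exists C : 'M[int]_(n, size l), C *m (\matrix_(i < size l) l`_i) = 1%:M.
Proof.
move=> H; have [f Hf] := boolp.choice H.
exists (\matrix_(i < n) f i); apply/row_matrixP => i.
by rewrite row_mul rowK Hf row1.
Qed.

End IntegerSpan.

(** This replaces total unimodularity: an integral inverse forces rank [n], and for square [W] it
    makes the determinant a unit of the integers, whose square is 1. *)
Lemma bdet0_int_right_inverse (F : realFieldType) n k (W : 'M[int]_(k, n))
    (C : 'M[int]_(n, k)) :
  C *m W = 1%:M -> (n <= k)%N /\ (k = n -> bdet 0 (map_mx intr W : 'M[F]_(k, n)) = 1).
Proof.
move=> CW; split.
  have : map_mx intr C *m map_mx intr W = 1%:M :> 'M[rat]_n.
    by rewrite -map_mxM CW map_mx1.
  move=> E; have := mulmx_max_rank (map_mx intr C : 'M[rat]_(n, k)) (map_mx intr W).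
  by rewrite E mxrank1.
move=> e; case: n / e W C CW => W C CW; rewrite bdet0_square.
have := congr1 (fun M : 'M[int]_k => \det M) CW; rewrite det_mulmx det1 => H.
rewrite det_map_mx -rmorphXn /=.
have : \det W \is a GRing.unit by apply/unitrP; exists (\det C); split; rewrite // mulrC.
by rewrite qualifE /= => /orP[]/eqP ->; rewrite ?sqrrN expr1n.
Qed.

Section RootedEmbedding.
Variables (T0 T : finType) (phi : T0 -> T) (r0 : T0).
Hypothesis phi_inj : injective phi.

Definition phi2 (p : T0 * T0) : T * T := (phi p.1, phi p.2).
Definition im (C : {set T0}) : {set T} := [set phi x | x in C]%SET.
(** The vectors form a square system exactly when [L] has [#|T0| - 1] edges, as a spanning tree
    does. *)
Definition rl (R : comRingType) (L : seq (T0 * T0)) : seq 'rV[R]_#|T| :=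
  map (fun p => ev R (phi2 p)) L ++
  map (@vx R T) (phi r0 :: enum (~: im finset.setT)).

Lemma mem_im C x : (phi x \in im C) = (x \in C).
Proof. exact: mem_imset. Qed.

Lemma im_out C v : v \notin im finset.setT -> v \in im C = false.
Proof.
move=> vS; apply/negbTE; apply: contraNN vS => /imsetP[x _ ->].
by rewrite mem_im inE.
Qed.

Lemma size_rl R L : size (rl R L) = (size L + (#|T| - #|T0|).+1)%N.
Proof.
rewrite /rl size_cat !size_map /= -cardE cardsCs finset.setCK.
by rewrite card_imset // cardsT.
Qed.

Lemma zspan_rl L : conn L -> forall v, zspan (rl int L) (vx int v).
Proof.
move=> cL v; have [/imsetP[x _ ->]|vS] := boolP (v \in im finset.setT); last first.
  by apply: zspan_mem; rewrite mem_cat map_f ?orbT // inE mem_enum inE vS orbT.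
have /connectP[q pth ->] := cL r0 x.
have : zspan (rl int L) (vx int (phi r0)).
  by apply: zspan_mem; rewrite mem_cat map_f ?orbT // mem_head.
elim: q r0 pth => [|b q IH] a //= /andP[eab pth] Ha; apply: IH pth _.
have mem p : p \in L -> zspan (rl int L) (ev int (phi2 p)).
  by move=> pL; apply: zspan_mem; rewrite mem_cat (map_f (fun p => ev int (phi2 p))).
move: eab; rewrite /tree_rel inE => /orP[] /mem.
  by move=> /zspanN /(zspanD Ha); rewrite /ev /= opprB addrC subrK.
by move=> /(zspanD Ha); rewrite /ev /= addrC subrK.
Qed.

Lemma map_rl (F : realFieldType) L i :
  map_mx intr (rl int L)`_i = (rl F L)`_i.
Proof.
have [il|il] := ltnP i (size (rl int L)); last first.
  by rewrite !nth_default ?map_mx0 // size_rl -(size_rl int L).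
rewrite -(nth_map 0 0 (map_mx intr)) //; congr nth.
have mvx x : map_mx intr (vx int x) = vx F x by rewrite /vx map_delta_mx.
rewrite map_cat -!map_comp; congr (_ ++ _).
  by apply: eq_map => p /=; rewrite /ev map_mxB !mvx.
by apply: eq_map => x /=.
Qed.

Lemma conn_rl (F : realFieldType) L : conn L -> (#|T| <= size (rl F L))%N /\
  (size (rl F L) = #|T| -> bdetl 0 (rl F L) = 1).
Proof.
move=> /zspan_rl H.
have [i|C HC] := @zspan_full _ (rl int L).
  by have := H (enum_val i); rewrite /vx enum_valK.
have [H1 H2] := bdet0_int_right_inverse F HC.
rewrite size_rl -(size_rl int L); split=> // /H2 <-.
apply: bdet_castr => [|i i' j ii']; first by rewrite !size_rl.
by rewrite !mxE -map_rl mxE ii'.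
Qed.

(** The indicator of a component that misses the root is orthogonal to all rows. *)
Lemma nconn_rl (F : realFieldType) L : ~ conn L -> bdetl 0 (rl F L) = 0.
Proof.
move=> ncL.
have [a ra] : exists a, ~~ connect (tree_rel (sym_edges L)) a r0.
  apply/existsP; apply: contra_notT ncL => /existsPn H x y.
  have := H x; have := H y; rewrite !negbK => yr xr.
  apply: connect_trans xr _; by rewrite (sym_connect_sym (@sym_edges_sym _ L)).
pose C := [set y | connect (tree_rel (sym_edges L)) a y]%SET.
apply: (@bdetl_ker _ _ _ _ (chi F (im C))).
- by apply: (@chi_neq0 _ _ _ (phi a)); rewrite mem_im inE connect0.
- by rewrite mulmx0.
- move=> b; rewrite mem_cat => /orP[/mapP[p pL ->]|/mapP[v vr ->]].
    by apply: ev_chi0; rewrite /= !mem_im; apply: conn_component.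
  rewrite vx_chi; move: vr; rewrite inE mem_enum inE => /orP[/eqP ->|vS].
    by rewrite mem_im inE (negPf ra) raddf0.
  by rewrite im_out // raddf0.
Qed.

(** The rows of a forest are linearly independent. In a linear relation, the coefficients are shown
    to vanish by pairing with indicators of suitable vertex sets. *)
Lemma acyclic_size_rl L : edge_list L -> acyclic (sym_edges L) ->
  (size (rl rat L) <= #|T|)%N.
Proof.
move=> uL ac; rewrite leqNgt; apply/negP => gt.
set l := rl rat L in gt *.
pose M := \matrix_(i < size l) l`_i.
have : kermx M != 0.
  rewrite kermx_eq0 /row_free; apply/eqP => E.
  by have := rank_leq_col M; rewrite E leqNgt gt.
rewrite -nz_row_eq0; set c := nz_row _; case/negP; apply/eqP.
have cM : c *m M = 0 by apply/sub_kermxP; apply: nz_row_sub.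
(* It suffices that [D] detects row [i0] and no other row whose coefficient could still be
   nonzero. *)
have key (i0 : 'I_(size l)) (D : {set T}) : l`_i0 *m (chi rat D)^T != 0 ->
    (forall i : 'I_(size l), i != i0 -> c 0 i = 0 \/ l`_i *m (chi rat D)^T = 0) ->
    c 0 i0 = 0.
  move=> n0 H; set y := chi rat D in n0 H *.
  have Mi i : (M *m y^T) i 0 = (l`_i *m y^T) 0 0.
    by rewrite -(rowK (fun i : 'I_(size l) => l`_i)) -row_mul [RHS]mxE.
  have : (c *m M *m y^T) 0 0 = 0 by rewrite cM mul0mx mxE.
  rewrite -mulmxA mxE (bigD1 i0) //= big1 ?addr0 => [|i ii0]; last first.
    by rewrite Mi; case: (H i ii0) => ->; rewrite ?mul0r ?mxE ?mulr0.
  move/eqP; rewrite Mi mulf_eq0 => /orP[/eqP //|E].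
  by case/eqP: n0; rewrite [_ *m _]mx11_scalar (eqP E) raddf0.
pose ws := phi r0 :: enum (~: im finset.setT).
have uws : uniq ws by rewrite /= enum_uniq mem_enum inE negbK mem_im inE.
have sl : size l = (size L + size ws)%N by rewrite /l size_cat !size_map.
have nthl i : (i < size l)%N -> l`_i = if (i < size L)%N
    then ev rat (phi2 (nth (r0, r0) L i)) else vx rat (nth (phi r0) ws (i - size L)).
  rewrite sl => il; rewrite /l /rl nth_cat size_map.
  case: ltnP => Hi; first by rewrite (nth_map (r0, r0)).
  by rewrite (nth_map (phi r0)) // ltn_subLR.
(* Ground rows: the whole image of [T0] isolates the root, and a singleton isolates each vertex
   outside the image. The edge rows are then isolated by the component that is cut off when the edge
   is removed. *)
have cA (i : 'I_(size l)) : (size L <= i)%N -> c 0 i = 0.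
  move=> Li; set w := nth (phi r0) ws (i - size L).
  have iw : (i - size L < size ws)%N by rewrite ltn_subLR // -sl.
  have wws : w \in ws by apply: mem_nth.
  apply: (key i (if w == phi r0 then im finset.setT else [set w]%SET)).
    rewrite nthl // ltnNge Li /= -/w vx_chi; set bb := (_ \in _).
    have -> : bb = true.
      by rewrite /bb; case: eqP => [->|_]; rewrite ?mem_im !inE ?eqxx.
    by apply/eqP => /matrixP /(_ 0 0); rewrite !mxE.
  move=> j ji; right; rewrite nthl //; case: ltnP => Lj.
    apply: ev_chi0 => /=; case: eqP => wr; first by rewrite !mem_im !inE.
    have wS : w \notin im finset.setT.
      by move: wws; rewrite inE => /orP[/eqP//|]; rewrite mem_enum inE.
    rewrite !inE; suff H x : (phi x == w) = false by rewrite !H.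
    by apply/negbTE; apply: contraNneq wS => <-; rewrite mem_im inE.
  rewrite vx_chi; set w' := nth _ _ _.
  have jw : (j - size L < size ws)%N by rewrite ltn_subLR // -sl.
  have ww' : w' != w.
    rewrite nth_uniq //; apply: contra_neq ji => E; apply: val_inj => /=.
    by rewrite -(subnK Lj) E subnK.
  case: eqP => wr; last by rewrite inE (negPf ww') raddf0.
  have : w' \in ws by apply: mem_nth.
  rewrite inE -wr (negPf ww') /= mem_enum inE => /negbTE ->.
  by rewrite raddf0.
apply/rowP => i; rewrite mxE; have [Li|Li] := leqP (size L) i; first exact: cA.
set p := nth (r0, r0) L i; have pL : p \in L by apply: mem_nth.
have cut := acyclic_cut uL pL ac.
pose C := [set y | connect (tree_rel (sym_edges (seq.rem p L))) p.1 y]%SET.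
apply: (key i (im C)).
  rewrite nthl // Li -/p ev_chi /= !mem_im !inE connect0 (negPf cut) subr0.
  by apply/eqP => /matrixP /(_ 0 0); rewrite !mxE.
move=> j ji; have [Lj|Lj] := leqP (size L) j; [left; exact: cA | right].
rewrite nthl // Lj; apply: ev_chi0; rewrite /= !mem_im.
apply: conn_component; apply: mem_rem_edge => //; first exact: mem_nth.
by rewrite /p nth_uniq // edge_list_uniq.
Qed.

(** Connectedness forces at least [#|T|] rows and acyclicity at most as many. A connected square
    system has an integral inverse, hence the value 1; it has no cycle, because removing a cycle
    edge would keep it connected with too few rows. *)
Theorem spanning_tree_bdetl (F : realFieldType) (e0 : rel T0) L :
  symmetric e0 -> edge_list L -> (forall p, p \in L -> e0 p.1 p.2) ->
  bdetl 0 (rl F L) = `[< is_spanning_tree e0 (sym_edges L) >]%:R /\ (is_spanning_tree e0 (sym_edges L) -> (size L).+1 = #|T0|).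
Proof.
move=> e0sym uL Le0.
have cardle : (#|T0| <= #|T|)%N by exact: (leq_card phi).
have [cL|ncL] := boolp.EM (conn L); last first.
  split; last by case.
  by rewrite nconn_rl //; case: boolp.asboolP => // -[].
have [gt1 eq1] := conn_rl F cL.
split; last first.
  case=> _ _ _ /(acyclic_size_rl uL); move: gt1; rewrite !size_rl.
  by move: (size L) (#|T|) (#|T0|) cardle; lia.
have [e|ne] := eqVneq (size (rl F L)) #|T|; last first.
  rewrite /bdetl bdet0_nonsquare //; case: boolp.asboolP => // -[_ _ _ ac].
  have := acyclic_size_rl uL ac; rewrite size_rl -(size_rl F L) => lt1.
  by case/eqP: ne; apply/eqP; rewrite eqn_leq lt1.
rewrite eq1 //; case: boolp.asboolP => // H; case: H; split=> //.
- by move=> x y; rewrite /tree_rel inE => /orP[] /Le0 //=; rewrite e0sym.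
- exact: sym_edges_sym.
- move=> c sc /(cycle_cut uL sc) /(_ cL) [p pL /(conn_rl F) [+ _]].
  move: e; rewrite !size_rl size_rem //.
  have : (0 < size L)%N by case: (L) pL.
  by move: (size L) (#|T| - _)%N; lia.
Qed.

End RootedEmbedding.

Definition trees_with (T : finType) (e : rel T) (L : seq (T * T)) : {set {set T * T}} :=
  [set t in spanning_trees e | all (mem t) L]%SET.

Lemma bdetl_dup (F : realFieldType) n (A : 'M[F]_n) l b : b \in l ->
  bdetl A (rcons l b) = 0.
Proof.
move=> bl; rewrite bdetl_col.
have il : (index b l < size l)%N by rewrite index_mem.
apply: (@bdet_ker_row _ _ _ _ _ (row_mx (delta_mx 0 (Ordinal il)) (- 1%:M))).
  apply/eqP => /rowP /(_ (rshift (size l) 0)).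
  by rewrite row_mxEr !mxE /=; apply/eqP; rewrite oppr_eq0 oner_eq0.
by rewrite mul_row_col -rowE rowK nth_index // mulNmx mul1mx subrr.
Qed.

(** * The matrix-tree theorem with prescribed edges *)

Section CountTrees.
Variables (T0 T : finType) (phi : T0 -> T) (r0 : T0) (e0 : rel T0).
Hypotheses (phi_inj : injective phi) (e0sym : symmetric e0).
Variable F : realFieldType.

Local Notation S := (im phi finset.setT).
Local Notation evs L := (map (fun p => ev F (phi2 phi p)) L).

Lemma tree_sym t p : t \in spanning_trees e0 -> (swap p \in t) = (p \in t).
Proof.
rewrite inE => /boolp.asboolP [_ + _ _] => /(_ p.2 p.1).
by rewrite /tree_rel -surjective_pairing.
Qed.

Lemma wired_bdetl L : bdetl (gram (wl F (phi r0) S [::])) (evs L) = bdetl 0 (rl phi r0 F L).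
Proof.
rewrite /wl cats0; pose fn v := chi F (if v == phi r0 then S else [set v]%SET).
rewrite (@bdetl_wire _ _ _ _ fn) //.
- by rewrite /= enum_uniq mem_enum inE negbK mem_im // inE.
- move=> v vws; apply: (@chi_neq0 _ _ _ v); case: eqP => [->|_].
    by rewrite mem_im // inE.
  by rewrite inE.
- move=> v w vws wws vw; rewrite vx_chi /=.
  case: eqP => [vr|_]; last by rewrite inE eq_sym (negPf vw) raddf0.
  move: wws; rewrite inE -vr eq_sym (negPf vw) /= mem_enum inE => /negbTE ->.
  by rewrite raddf0.
- move=> v vws b /mapP[p pL ->]; apply: ev_chi0 => /=.
  case: eqP => vr; first by rewrite !mem_im // !inE.
  have vS : v \notin S by move: vws; rewrite inE => /orP[/eqP//|]; rewrite mem_enum inE.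
  have H x : (phi x == v) = false.
    by apply/negbTE; apply: contraNneq vS => <-; rewrite mem_im // inE.
  by rewrite !inE !H.
Qed.

(** Deletion and contraction of the first edge of [es]: the trees without it and the trees with it
    are the two terms of [bdet_rank1]. Without further edges, [sym_edges L] is the only
    candidate. *)
Lemma count_between es L : edge_list (L ++ es) ->
  (forall p, p \in L ++ es -> e0 p.1 p.2) ->
  #|[set t in trees_with e0 L | t \subset sym_edges (L ++ es)]%SET|%:R =
  bdetl (gram (wl F (phi r0) S (map (phi2 phi) es))) (evs L).
Proof.
elim: es L => [|p es IH] L uL eL.
  rewrite cats0 in uL eL *; rewrite wired_bdetl.
  rewrite (spanning_tree_bdetl r0 phi_inj F e0sym uL eL).1.
  case: boolp.asboolP => H; last first.
    rewrite (_ : [set _ in _ | _]%SET = finset.set0) ?cards0 //.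
    apply/setP => t; rewrite !inE; apply/negbTE/negP => /andP[/andP[/boolp.asboolP tT tL] tsub].
    apply: H; rewrite (_ : sym_edges L = t) //; apply/setP => q; apply/idP/idP.
      have tST : t \in spanning_trees e0 by rewrite inE; apply/boolp.asboolP.
      rewrite inE => /orP[|] /(allP tL) //=; by rewrite tree_sym.
    exact/fintype.subsetP.
  rewrite (_ : [set _ in _ | _]%SET = [set sym_edges L]%SET) ?cards1 //.
  apply/setP => t; rewrite !inE; apply/idP/idP; last first.
    move/eqP => ->; rewrite fintype.subxx andbT; apply/andP; split; first exact/boolp.asboolP.
    by apply/allP => q qL /=; rewrite inE qL.
  move=> /andP[/andP[tT tL] tsub]; apply/eqP/setP => q; apply/idP/idP.
    exact/fintype.subsetP.
  rewrite inE => /orP[|] /(allP tL) //=; by rewrite tree_sym // inE.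
have catE : perm_eq (L ++ p :: es) (rcons L p ++ es) by rewrite cat_rcons.
rewrite /= gram_wl_cons gram_cons addrC bdetl_rank1 -map_rcons.
rewrite -IH; last 2 first.
- have sub : subseq (L ++ es) (L ++ p :: es) by rewrite cat_subseq // subseq_cons.
  by apply: subseq_uniq uL; rewrite cat_subseq // map_subseq.
- move=> q qL; apply: eL; move: qL; rewrite !mem_cat inE => /orP[->|->] //; by rewrite !orbT.
rewrite -IH; last 2 first.
- by rewrite cat_rcons.
- by rewrite cat_rcons.
rewrite -natrD; congr (_%:R).
have pn : p \notin L ++ es.
  by move: (edge_list_uniq uL); rewrite (perm_uniq (s2 := p :: L ++ es)) /= => [/andP[]|];
     rewrite // -cat1s perm_catCA.
have spn : swap p \notin L ++ es.
  have := edge_list_swap uL (p := p).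
  rewrite [_ \in L ++ _]mem_cat mem_head orbT => /(_ erefl).
  by rewrite !mem_cat inE !negb_or => /and3P[-> _ ->].
rewrite -(cardsID [set t : {set T0 * T0} | p \in t]%SET) addnC; congr (_ + _)%N.
  apply: eq_card => t; rewrite !inE.
  case: (boolp.asbool _) / boolp.asboolP => //= tT; rewrite ?andbF //.
  case tL : (all (mem t) L); rewrite ?andbF //=.
  have tST : t \in spanning_trees e0 by rewrite inE; apply/boolp.asboolP.
  apply/idP/idP => [/andP[pt tsub]|tsub].
    apply/fintype.subsetP => q qt; have := fintype.subsetP tsub q qt.
    rewrite !inE !mem_cat !inE.
    have -> : (q == p) = false by apply: contraNF pt => /eqP <-.
    have -> : (swap q == p) = false.
      by apply: contraNF pt => /eqP <-; rewrite tree_sym.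
    by [].
  apply/andP; split.
    apply/negP => pt; have := fintype.subsetP tsub p pt.
    by rewrite inE (negPf pn) (negPf spn).
  apply/fintype.subsetP => q qt; have := fintype.subsetP tsub q qt.
  by rewrite !inE !mem_cat !inE => /orP[/orP[]|/orP[]] ->; rewrite ?orbT.
apply: eq_card => t; rewrite !inE all_rcons cat_rcons /=.
by case: (p \in t); rewrite ?andbT ?andbF //=.
Qed.

Lemma bdetl_absorb (A : seq 'rV[F]_#|T|) l l' : {subset l' <= l} ->
  bdetl (gram (l' ++ A)) l = bdetl (gram A) l.
Proof.
elim: l' => //= b l' IH sub.
rewrite gram_cons addrC bdetl_rank1 (bdetl_dup _ (b := b)).
  by rewrite addr0 IH // => c cl; apply: sub; rewrite inE cl orbT.
by apply: sub; rewrite mem_head.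
Qed.

(** The Gram matrix contains the edges of [L] as well, so that it does not depend on [L]; their
    rank-one terms contribute nothing, because they repeat a row of the border. *)
Theorem matrix_tree (Es L : seq (T0 * T0)) : edge_list Es ->
  (forall p, p \in Es -> e0 p.1 p.2) ->
  (forall p, e0 p.1 p.2 -> p \in sym_edges Es) ->
  uniq L -> {subset L <= Es} ->
  #|trees_with e0 L|%:R = bdetl (gram (wl F (phi r0) S (map (phi2 phi) Es))) (evs L).
Proof.
move=> uE Ee eE uL sL; pose es := [seq q <- Es | q \notin L].
have pE : perm_eq (L ++ es) Es.
  apply: uniq_perm; first 1 last.
  - exact: edge_list_uniq.
  - by move=> q; rewrite mem_cat mem_filter /=; case: (boolP (q \in L)) => //= /sL ->.
  rewrite cat_uniq uL filter_uniq ?edge_list_uniq // andbT.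
  by apply/hasPn => q; rewrite mem_filter => /andP[].
have -> : trees_with e0 L = [set t in trees_with e0 L | t \subset sym_edges (L ++ es)]%SET.
  apply/setP => t; rewrite [in RHS]inE; case tT : (t \in trees_with e0 L) => //=.
  apply/esym/fintype.subsetP => q qt; have : e0 q.1 q.2.
    move: tT; rewrite !inE => /andP[/boolp.asboolP[sub _ _ _] _]; apply: sub.
    by rewrite /tree_rel -surjective_pairing.
  by move/eE; rewrite !inE !(perm_mem pE).
rewrite count_between; last 2 first.
- by rewrite /edge_list (perm_uniq (perm_cat pE (perm_map _ pE))).
- by move=> q; rewrite (perm_mem pE); apply: Ee.
have sub : {subset evs L <= evs L} by [].
rewrite -(bdetl_absorb _ sub); congr bdetl.
apply: gram_perm; rewrite /wl perm_catCA perm_cat2l.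
by rewrite (map_comp (@ev F T)) -!map_cat perm_map // perm_map.
Qed.

End CountTrees.

Section CanonicalEdges.
Variables (T : finType) (e : rel T).
Hypotheses (esm : symmetric e) (eirr : irreflexive e).
Implicit Types (L : seq (T * T)) (p : T * T).

Definition oriented_edges : seq (T * T) :=
  [seq p <- enum {: T * T} | e p.1 p.2 && (enum_rank p.1 < enum_rank p.2)%N].

Lemma mem_oriented_edges p :
  p \in oriented_edges = e p.1 p.2 && (enum_rank p.1 < enum_rank p.2)%N.
Proof. by rewrite mem_filter mem_enum andbT. Qed.

Lemma oriented_edges_list : edge_list oriented_edges.
Proof.
have u : uniq oriented_edges by rewrite filter_uniq ?enum_uniq.
rewrite /edge_list cat_uniq u (map_inj_uniq (can_inj (@swapK T))) u andbT /=.
apply/hasPn => q /mapP[p + ->] /=.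
rewrite !mem_oriented_edges => /andP[_ lt] /=.
by rewrite ltnNge (ltnW lt) andbF.
Qed.

Lemma oriented_edges_cover p : e p.1 p.2 -> p \in sym_edges oriented_edges.
Proof.
move=> ep; rewrite inE !mem_oriented_edges /= (esm p.2) ep /=.
case: ltngtP => // /val_inj /enum_rank_inj E.
by move: ep; rewrite E eirr.
Qed.

Lemma edge_list_sub L L' : edge_list L -> uniq L' -> {subset L' <= L} -> edge_list L'.
Proof.
move=> uL uL' sub; rewrite /edge_list cat_uniq uL' (map_inj_uniq (can_inj (@swapK T))) uL' andbT /=.
apply/hasPn => q /mapP[p pL' ->] /=; apply: contra (edge_list_swap uL (sub _ pL')).
exact: sub.
Qed.

Lemma edge_list_cat L L' : edge_list L -> edge_list L' ->
  (forall q, q \in L' -> q \notin sym_edges L) -> edge_list (L ++ L').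
Proof.
move=> uL uL' H; rewrite /edge_list cat_uniq (map_inj_uniq (can_inj (@swapK T))).
have -> : uniq (L ++ L').
  rewrite cat_uniq !edge_list_uniq // andbT; apply/hasPn => q /H.
  by rewrite inE negb_or => /andP[].
rewrite andbT; apply/hasPn => q /mapP[p + ->] /=.
rewrite !mem_cat negb_or => /orP[pL|pL].
  rewrite edge_list_swap //=; apply/negP => /H.
  by rewrite inE swapK pL orbT.
rewrite [X in _ && X]edge_list_swap // andbT.
by have := H _ pL; rewrite inE negb_or => /andP[].
Qed.

Lemma card_sym_edges L : edge_list L -> #|sym_edges L| = (size L).*2.
Proof.
move=> uL; rewrite (_ : (size L).*2 = size (L ++ map (@swap T) L)); last first.
  by rewrite size_cat size_map -addnn.
rewrite -(card_uniqP uL); apply: eq_card => p.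
rewrite inE mem_cat; congr (_ || _).
by rewrite -[p in RHS]swapK (mem_map (can_inj (@swapK T))).
Qed.

Lemma card_spanning_tree (r : T) t : t \in spanning_trees e -> #|t| = (#|T|.-1).*2.
Proof.
move=> tST; pose L := [seq p <- oriented_edges | p \in t].
have uL : edge_list L.
  apply: (edge_list_sub oriented_edges_list); first exact/filter_uniq/edge_list_uniq/oriented_edges_list.
  by move=> p; rewrite mem_filter => /andP[].
have eL p : p \in L -> e p.1 p.2.
  by rewrite mem_filter mem_oriented_edges => /and3P[].
have tL : t = sym_edges L.
  have memL p : (p \in L) = (p \in t) && (p \in oriented_edges) by rewrite mem_filter.
  apply/setP => p; rewrite inE !memL (tree_sym _ tST).
  case pt : (p \in t) => //=; apply/esym.
  have : e p.1 p.2.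
    move: tST; rewrite inE => /boolp.asboolP [sub _ _ _]; apply: sub.
    by rewrite /tree_rel -surjective_pairing.
  by move/oriented_edges_cover; rewrite inE.
have [_ H] := spanning_tree_bdetl r (@inj_id T) rat esm uL eL.
have {H} : (size L).+1 = #|T|.
  by apply: H; rewrite -tL; move: tST; rewrite inE => /boolp.asboolP.
by rewrite tL card_sym_edges // => <-.
Qed.

End CanonicalEdges.

Lemma edge_list_map (T0 T : finType) (phi : T0 -> T) (L : seq (T0 * T0)) :
  injective (phi2 phi) -> edge_list L -> edge_list (map (phi2 phi) L).
Proof.
move=> inj uL; rewrite /edge_list -map_comp.
by rewrite (eq_map (f := @swap T \o phi2 phi) (g := phi2 phi \o @swap T0)) //
  map_comp -map_cat map_inj_uniq.
Qed.

(** * Monotonicity of edge probabilities under enlarging the graph *)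

Section Monotonicity.
Variables (T0 T : finType) (phi : T0 -> T) (r0 : T0) (e0 : rel T0) (e : rel T).
Hypotheses (phi_inj : injective phi) (esm : symmetric e) (eirr : irreflexive e).
Hypothesis phie : forall x y, e (phi x) (phi y) = e0 x y.

Let e0sm : symmetric e0. Proof. by move=> x y; rewrite -!phie. Qed.
Let e0irr : irreflexive e0. Proof. by move=> x; rewrite -phie. Qed.

Lemma phi2_inj : injective (phi2 phi).
Proof. by move=> [a b] [c d] [/phi_inj -> /phi_inj ->]. Qed.

Lemma trees_with_notin (L : seq (T0 * T0)) p : p \in L -> ~~ e0 p.1 p.2 ->
  trees_with e (map (phi2 phi) L) = finset.set0.
Proof.
move=> pL ep; apply/setP => t; rewrite !inE; apply/negbTE/negP.
move=> /andP[/boolp.asboolP[sub _ _ _] /allP /(_ (phi2 phi p))].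
rewrite map_f // => /(_ erefl) /= pt.
by case/negP: ep; rewrite -phie; apply: sub; exact: pt.
Qed.

(** Both graphs are counted on [T] with root [phi r0]: for [T0] the vertices outside the image are
    grounded, and [grow] attaches them. The cross-multiplied form also covers graphs without
    spanning trees. *)
Theorem trees_with_mono (L : seq (T0 * T0)) :
  (#|trees_with e (map (phi2 phi) L)| * #|spanning_trees e0| <=
   #|trees_with e0 L| * #|spanning_trees e|)%N.
Proof.
have [/hasP[p pL ep]|/hasPn HL] := boolP (has (fun p => ~~ e0 p.1 p.2) L).
  by rewrite (trees_with_notin pL ep) cards0.
pose Es := oriented_edges e0.
have uEs : edge_list Es by exact: oriented_edges_list.
have eEs p : p \in Es -> e0 p.1 p.2 by rewrite mem_oriented_edges => /andP[].
have cEs p : e0 p.1 p.2 -> p \in sym_edges Es by exact: oriented_edges_cover.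
pose canon p := if p \in Es then p else swap p.
pose L' := undup (map canon L).
have sL' : {subset L' <= Es}.
  move=> q; rewrite mem_undup => /mapP[p pL ->]; rewrite /canon.
  have := HL p pL; rewrite negbK => /cEs; rewrite inE.
  by case: ifP.
have eq0 : trees_with e0 L = trees_with e0 L'.
  apply/setP => t; rewrite !inE; case: (boolp.asbool _) / boolp.asboolP => //= tT.
  have tST : t \in spanning_trees e0 by rewrite inE; apply/boolp.asboolP.
  rewrite /L' (eq_all_r (mem_undup _)) all_map; apply: eq_all => p /=.
  by rewrite /canon; case: ifP => // _; rewrite (tree_sym p tST).
have eq1 : trees_with e (map (phi2 phi) L) = trees_with e (map (phi2 phi) L').
  apply/setP => t; rewrite !inE; case: (boolp.asbool _) / boolp.asboolP => //= tT.
  have tST : t \in spanning_trees e by rewrite inE; apply/boolp.asboolP.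
  rewrite !all_map /L' (eq_all_r (mem_undup _)) all_map; apply: eq_all => p /=.
  by rewrite /canon; case: ifP => // _; rewrite -(tree_sym (phi2 phi p) tST).
rewrite {}eq0 {}eq1.
have uL' : uniq L' by apply: undup_uniq.
pose rest := [seq q <- oriented_edges e | q \notin sym_edges (map (phi2 phi) Es)].
(* The edges of [T] are listed so as to extend the image of the edges of [T0], which is the form
   that [grow] compares. *)
pose Et := map (phi2 phi) Es ++ rest.
have uEt : edge_list Et.
  apply: edge_list_cat.
  - by apply: edge_list_map uEs; exact: phi2_inj.
  - apply: (edge_list_sub (oriented_edges_list e)); last first.
      by move=> q; rewrite mem_filter => /andP[].
    exact/filter_uniq/edge_list_uniq/oriented_edges_list.
  - by move=> q; rewrite mem_filter => /andP[].
have eEt p : p \in Et -> e p.1 p.2.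
  rewrite mem_cat => /orP[/mapP[q /eEs + ->]|]; first by rewrite -phie.
  by rewrite mem_filter mem_oriented_edges => /and3P[].
have cEt p : e p.1 p.2 -> p \in sym_edges Et.
  move=> /(oriented_edges_cover esm eirr); rewrite !inE !mem_cat !mem_filter !inE swapK.
  by case: (p \in map _ _); case: (swap p \in map _ _) => //=; rewrite ?orbT.
have [t1|/existsPn no1] := boolP [exists t, t \in spanning_trees e]; last first.
  rewrite (_ : trees_with e _ = finset.set0) ?cards0 //.
  by apply/setP => t; rewrite !inE; have := no1 t; rewrite inE => /negbTE ->.
have [t0|/existsPn no0] := boolP [exists t, t \in spanning_trees e0]; last first.
  rewrite (_ : spanning_trees e0 = finset.set0) ?cards0 ?muln0 //.
  by apply/setP => t; rewrite finset.in_set0; apply/negbTE/no0.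
have sL2 : {subset map (phi2 phi) L' <= Et}.
  by move=> q /mapP[p /sL' pE ->]; rewrite mem_cat map_f.
have tw0 (T' : finType) (e' : rel T') : trees_with e' [::] = spanning_trees e'.
  by apply/setP => t; rewrite !inE andbT.
have uL2 : uniq (map (phi2 phi) L') by rewrite map_inj_uniq //; exact: phi2_inj.
have nil0 : {subset [::] <= Es} by [].
have nil1 : {subset [::] <= Et} by [].
have M0 := matrix_tree r0 phi_inj e0sm rat uEs eEs cEs uL' sL'.
have M00 := matrix_tree r0 phi_inj e0sm rat uEs eEs cEs (isT : uniq [::]) nil0.
have M1 := matrix_tree (phi r0) (@inj_id T) esm rat uEt eEt cEt uL2 sL2.
have M10 := matrix_tree (phi r0) (@inj_id T) esm rat uEt eEt cEt (isT : uniq [::]) nil1.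
rewrite !tw0 in M00 M10.
have imT : im (@id T) finset.setT = finset.setT.
  by apply/setP => x; rewrite (mem_im (@inj_id T)) !inE.
have p2id : phi2 (@id T) =1 id by case.
rewrite imT (eq_map p2id) map_id in M1 M10.
rewrite (eq_map (g := @ev rat T)) in M1 => [|p]; last by rewrite p2id.
rewrite -map_comp in M1.
rewrite !bdetl_nil in M00 M10.
rewrite -(ler_nat rat) !natrM M00 M10 M0 M1.
apply: grow.
- by rewrite mem_im // inE.
- by move=> q /mapP[p _ ->] /=; rewrite !mem_im // !inE.
- move=> b v /mapP[p _ ->] vS; rewrite /ev mxE [X in _ + X]mxE /= !vx_neq ?subr0 //.
    by apply: contraNneq vS => <-; rewrite mem_im // inE.
  by apply: contraNneq vS => <-; rewrite mem_im // inE.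
- move=> S' x rS' xS'; case/existsP: t1 => t; rewrite inE => /boolp.asboolP [sub tsm tc _].
  have [/hasP[p pE pS]|/hasPn H] := boolP (has (fun p => (p.1 \in S') != (p.2 \in S')) Et).
    by exists p.
  have cl : fingraph.closed (tree_rel t) S'.
    move=> a b /sub /(cEt (a, b)); rewrite inE => /orP[] /H; rewrite negbK => /eqP //=.
  by move: xS'; rewrite -(closed_connect cl (tc (phi r0) x)) rS'.
- by rewrite -M00 ltr0n; case/existsP: t0 => t tT; apply/card_gt0P; exists t.
Qed.

End Monotonicity.

(** * Expectations of local functions *)

Local Open Scope classical_set_scope.
Local Open Scope ring_scope.

Section BoundedMeasurable.
Context d (T : measurableType d) (R : realType) (P : probability T R).
Implicit Types f g : T -> R.

Definition bmf (M : R) f := measurable_fun setT f /\ forall x, `|f x| <= M.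

Lemma bmf_integrable M f : bmf M f -> P.-integrable setT (EFin \o f).
Proof.
case=> mf bf; apply: measurable_bounded_integrable => //.
  by apply: le_lt_trans (probability_le1 P measurableT) _; rewrite ltry.
by exists M; split; [exact: num_real | move=> y My x _; exact: le_trans (bf x) (ltW My)].
Qed.

Definition Ex f : R := \int[P]_x f x.

Lemma Ex_fin M f : bmf M f -> (\int[P]_x (f x)%:E)%E = (Ex f)%:E.
Proof.
by move=> bf; rewrite /Ex /Rintegral fineK //; apply: integrable_fin_num => //;
  apply: bmf_integrable bf.
Qed.

Lemma bmf_cst c : bmf `|c| (fun=> c).
Proof. by split. Qed.

Lemma bmfD M N f g : bmf M f -> bmf N g -> bmf (M + N) (fun x => f x + g x).
Proof.
move=> [mf bf] [mg bg]; split; first exact: measurable_funD.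
by move=> x; apply: le_trans (ler_normD _ _) _; apply: lerD.
Qed.

Lemma bmfM M N f g : bmf M f -> bmf N g -> bmf (M * N) (fun x => f x * g x).
Proof.
move=> [mf bf] [mg bg]; split; first exact: measurable_funM.
by move=> x; rewrite normrM; apply: ler_pM.
Qed.

Lemma bmf_sum (I : Type) (s : seq I) (F : I -> T -> R) (M : I -> R) :
  (forall i, bmf (M i) (F i)) ->
  bmf (\sum_(i <- s) M i) (fun x => \sum_(i <- s) F i x).
Proof.
move=> H; split; first by apply: measurable_sum => i; case: (H i).
move=> x; apply: le_trans (ler_norm_sum _ _ _) _; apply: ler_sum => i _.
by case: (H i).
Qed.

Lemma bmf_lim M (F : (T -> R)^nat) f : (forall n, bmf M (F n)) ->
  (forall x, F ^~ x @ \oo --> f x) -> bmf M f.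
Proof.
move=> H c; split.
  apply: (measurable_fun_cvg (h := F)) => // n; first by case: (H n).
move=> x; have := c x => /cvg_norm cn.
rewrite -(cvg_lim (@Rhausdorff R) cn); apply: limr_le; first exact: cvgP cn.
by apply: nearW => n; case: (H n).
Qed.

Lemma Ex_cst c : Ex (fun=> c) = c.
Proof.
rewrite /Ex Rintegral_cst //; transitivity (c * fine (1%E : \bar R)); last exact: mulr1.
by congr (c * fine _); exact: probability_setT.
Qed.

Lemma ExD M N f g : bmf M f -> bmf N g -> Ex (fun x => f x + g x) = Ex f + Ex g.
Proof.
move=> bf bg; apply: RintegralD => //.
  exact: bmf_integrable bf.
exact: bmf_integrable bg.
Qed.

Lemma ExZ M c f : bmf M f -> Ex (fun x => c * f x) = c * Ex f.
Proof. by move=> bf; apply: RintegralZl => //; exact: bmf_integrable bf. Qed.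

Lemma Ex_sum (I : Type) (s : seq I) (F : I -> T -> R) (M : I -> R) :
  (forall i, bmf (M i) (F i)) ->
  Ex (fun x => \sum_(i <- s) F i x) = \sum_(i <- s) Ex (F i).
Proof.
move=> H; elim: s => [|i s IH].
  by rewrite big_nil -[RHS](Ex_cst 0); congr Ex; apply/funext => x; rewrite big_nil.
rewrite big_cons -IH -(ExD (H i) (bmf_sum s H)).
by congr Ex; apply/funext => x; rewrite big_cons.
Qed.

Lemma Ex_le M N f g : bmf M f -> bmf N g -> (forall x, f x <= g x) -> Ex f <= Ex g.
Proof.
move=> bf bg fg; apply: le_Rintegral => //.
  exact: bmf_integrable bf.
exact: bmf_integrable bg.
Qed.

Lemma Ex_ge0 f : (forall x, 0 <= f x) -> 0 <= Ex f.
Proof. by move=> f0; apply: Rintegral_ge0. Qed.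

Lemma Ex_lim_ae M (F : (T -> R)^nat) f : (forall n, bmf M (F n)) -> bmf M f ->
  {ae P, forall x, F ^~ x @ \oo --> f x} -> Ex (F n) @[n --> \oo] --> Ex f.
Proof.
move=> H bf c.
have cE : {ae P, forall x, setT x -> (F n x)%:E @[n --> \oo] --> (f x)%:E}.
  by apply: filterS c => x cx _; apply: cvg_EFin; [exact: nearW | exact: cx].
have [_ _] := @dominated_convergence _ T R P setT measurableT
  (fun n x => (F n x)%:E) (fun x => (f x)%:E) (fun=> M%:E)
  (fun n => (measurable_EFinP _ _).2 (H n).1) ((measurable_EFinP _ _).2 bf.1) cE
  (finite_measure_integrable_cst _ M measurableT)
  (aeW _ (fun x n _ => (H n).2 x)).
rewrite (Ex_fin bf) => /fine_cvg; apply: cvg_trans; apply: near_eq_cvg.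
by apply: nearW.
Qed.

Lemma Ex_lim M (F : (T -> R)^nat) f : (forall n, bmf M (F n)) ->
  (forall x, F ^~ x @ \oo --> f x) -> Ex (F n) @[n --> \oo] --> Ex f.
Proof.
move=> H c; apply: (Ex_lim_ae H (bmf_lim H c)); exact: aeW.
Qed.

Lemma Ex_le_ae M N f g : bmf M f -> bmf N g -> {ae P, forall x, f x <= g x} ->
  Ex f <= Ex g.
Proof.
move=> bf bg fg; pose h x := Num.min (f x) (g x).
have bh : bmf (Num.max M N) h.
  split; first exact: measurable_minr bf.1 bg.1.
  by move=> x; rewrite /h minEle le_max; case: ifP; rewrite ?bf.2 ?bg.2 ?orbT.
have -> : Ex f = Ex h.
  congr fine; apply: ae_eq_integral => //.
  - exact/measurable_EFinP/bf.1.
  - exact/measurable_EFinP/bh.1.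
  - by apply: filterS fg => x fgx _; rewrite /h /= min_l.
by apply: (Ex_le bh bg) => x; rewrite /h ge_min lexx orbT.
Qed.

Lemma Ex_eq0_ae M f : bmf M f -> (forall x, 0 <= f x) -> Ex f = 0 ->
  {ae P, forall x, f x = 0}.
Proof.
move=> bf f0 E0.
have := (ae_eq_integral_abs P measurableT ((measurable_EFinP _ _).2 bf.1)).1.
under eq_integral => x _ do rewrite /= ger0_norm //.
rewrite (Ex_fin bf) E0 => /(_ erefl); apply: filterS => x /(_ I) /=.
by case.
Qed.

End BoundedMeasurable.

Section LocalFunctions.
Variable V : choiceType.
Implicit Types (G : config V) (p : V * V) (K : seq (V * V)).

Definition local_on (A : Type) K (f : config V -> A) :=
  forall G G', (forall p, p \in K -> G p = G' p) -> f G = f G'.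

Definition localf (A : Type) (f : config V -> A) := exists K, local_on K f.

Lemma localf_cst (A : Type) (a : A) : localf (fun=> a).
Proof. by exists [::]. Qed.

Lemma localf_coord p : localf (fun G => G p).
Proof. by exists [:: p] => G G' H; apply: H; rewrite inE. Qed.

Lemma localf_comp (A B : Type) (h : A -> B) (f : config V -> A) :
  localf f -> localf (fun G => h (f G)).
Proof. by case=> K H; exists K => G G' HG; rewrite (H G G'). Qed.

Lemma localf_comp2 (A B C : Type) (h : A -> B -> C) (f : config V -> A) g :
  localf f -> localf g -> localf (fun G => h (f G) (g G)).
Proof.
case=> K H [L H']; exists (K ++ L) => G G' HG.
by rewrite (H G G') ?(H' G G') // => p pK; apply: HG; rewrite mem_cat pK ?orbT.
Qed.

Lemma localf_big (R : Type) (idx : R) (op : R -> R -> R) (I : Type) (s : seq I)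
    (F : I -> config V -> R) :
  (forall i, localf (F i)) -> localf (fun G => \big[op/idx]_(i <- s) F i G).
Proof.
move=> H; elim: s => [|i s IH].
  by exists [::] => G G' _; rewrite !big_nil.
have [K HK] := localf_comp2 op (H i) IH.
by exists K => G G' HG; rewrite !big_cons; apply: HK.
Qed.

Lemma coord_nbhs p G : nbhs G [set G' : config V | G' p = G p].
Proof.
have := @proj_continuous (V * V)%type (fun=> bool) p G.
move=> /(_ [set G p]); apply; rewrite nbhs_principalE.
by apply/principal_filterP.
Qed.

Lemma cylinder_nbhs K G :
  nbhs G [set G' : config V | forall p, p \in K -> G' p = G p].
Proof.
elim: K => [|p K IH]; first by apply: filterS filterT.
apply: filterS (filterI (coord_nbhs p G) IH) => G' [/= H1 H2] q.
by rewrite inE => /orP[/eqP ->|/H2].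
Qed.

Lemma local_continuous (T : topologicalType) (f : config V -> T) : localf f -> continuous f.
Proof.
case=> K H G U /= Uf; have := cylinder_nbhs K G; apply: filterS => G' HG'.
by rewrite /= (H G' G) //; exact: nbhs_singleton.
Qed.

Lemma local_measurable (R : realType) (f : config V -> R) : localf f ->
  measurable_fun setT (f : borel_config V -> R).
Proof.
move=> /local_continuous cf.
apply: (measurability _ (RGenOpens.measurableE R)) => _ [_ [a [b ->]] <-].
rewrite setTI; apply: sub_sigma_algebra.
move/continuousP: cf; apply; exact: interval_open.
Qed.

Lemma local_bounded (R : realType) (f : config V -> R) : localf f ->
  exists M, forall G, `|f G| <= M.
Proof.
case=> K; elim: K f => [|p K IH] f H.
  by exists `|f (fun=> false)| => G; rewrite (H G (fun=> false)).
pose upd b (G : config V) : config V := fun q => if q == p then b else G q.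
have Hupd b : local_on K (fun G => f (upd b G)).
  move=> G G' HG; apply: H => q; rewrite /upd inE; case: eqP => //= _ /HG //.
have [M0 H0] := IH _ (Hupd false); have [M1 H1] := IH _ (Hupd true).
exists (Num.max M0 M1) => G.
have -> : f G = f (upd (G p) G).
  by apply: H => q _; rewrite /upd; case: eqP => [->|].
by rewrite le_max; case: (G p); rewrite ?H0 ?H1 ?orbT.
Qed.

End LocalFunctions.

(** * Averages over the spanning trees of a box *)

Section BoxAverages.
Variables (R : realType) (d : nat).
Local Notation V := (Zd d).

Definition box_avg n (f : borel_config V -> R) : R :=
  (#|spanning_trees (@box_adj d n)|%:R)^-1 *
  \sum_(t in spanning_trees (@box_adj d n)) f (box_config t).

Lemma integral_box_ust n (f : borel_config V -> R) :
  measurable_fun setT f -> (forall G, 0 <= f G) ->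
  (\int[box_ust R d n]_G (f G)%:E)%E = (box_avg n f)%:E.
Proof.
move=> mf f0; have mEf := (measurable_EFinP _ _).2 mf.
rewrite /box_ust ge0_integral_mscale //; last by move=> G _; rewrite lee_fin.
rewrite ge0_integral_measure_sum //; last by move=> G _; rewrite lee_fin.
rewrite /box_avg EFinM; congr (_ * _)%E.
  by rewrite /= size_map -cardE.
under eq_bigr => k _ do rewrite integral_dirac // diracT mul1e.
rewrite sumEFin; congr EFin.
transitivity (\sum_(G <- box_tree_configs d n) f G).
  by rewrite (big_nth point) big_mkord.
by rewrite big_map big_enum.
Qed.

Lemma ust_lim (P : probability (borel_config V) R) (f : config V -> R) :
  is_ust_law P -> localf f -> (forall G, 0 <= f G) ->
  box_avg n f @[n --> \oo] --> Ex P f.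
Proof.
move=> hP lf f0; have mf := local_measurable lf.
have := hP f (local_continuous lf) (local_bounded lf).
have [M bM] := local_bounded lf.
rewrite (Ex_fin P (conj mf bM)) => /fine_cvg; apply: cvg_trans; apply: near_eq_cvg.
by apply: nearW => n /=; rewrite integral_box_ust.
Qed.

(** Tested against the constant 1, the weak limit says that the masses of the box laws tend to 1; a
    box without spanning trees would have mass 0. *)
Lemma trees_eventually (P : probability (borel_config V) R) : is_ust_law P ->
  \forall n \near \oo, (0 < #|spanning_trees (@box_adj d n)|)%N.
Proof.
move=> hP; have := @ust_lim P (fun=> 1) hP (localf_cst _ 1) (fun=> ler01).
rewrite Ex_cst => /cvgrPdist_lt /(_ 1 ltr01); apply: filterS => n.
rewrite lt0n; apply: contraTneq => E.
by rewrite /box_avg E invr0 mul0r subr0 normr1 ltxx.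
Qed.

End BoxAverages.

Section Lattice.
Variable d : nat.
Local Notation V := (Zd d).
Implicit Types (x y z : V).

Lemma lattice_adj_sym : symmetric (@lattice_adj d).
Proof.
by move=> x y; rewrite /lattice_adj; under eq_bigr do rewrite distrC.
Qed.

Lemma lattice_adj_irr : irreflexive (@lattice_adj d).
Proof.
by move=> x; rewrite /lattice_adj big1 // => i _; rewrite subrr normr0.
Qed.

Lemma lattice_adjD z x y : lattice_adj (x + z) (y + z) = lattice_adj x y.
Proof.
rewrite /lattice_adj; under eq_bigr do rewrite !ffunE opprD addrACA subrr addr0.
by [].
Qed.

Lemma box_adj_sym n : symmetric (@box_adj d n).
Proof. by move=> u v; apply: lattice_adj_sym. Qed.

Lemma box_adj_irr n : irreflexive (@box_adj d n).
Proof. by move=> u; apply: lattice_adj_irr. Qed.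

Lemma box_point_inj n : injective (@box_point d n).
Proof.
move=> u v /ffunP H; apply/ffunP => i; apply: val_inj.
have := H i; rewrite !ffunE => /addIr; by case.
Qed.

Definition box_inv n x : box d n := [ffun i => inord (absz (x i + n%:Z))].

Definition in_box n x : bool := [forall i, `|x i| <= n%:Z].

Lemma box_invK n x : in_box n x -> box_point (box_inv n x) = x.
Proof.
move=> /forallP H; apply/ffunP => i; rewrite !ffunE.
by move: (x i) (H i) => a Ha; rewrite inordK; lia.
Qed.

Lemma box_point_in n (u : box d n) : in_box n (box_point u).
Proof. by apply/forallP => i; rewrite !ffunE; have := ltn_ord (u i); lia. Qed.

Definition box_shift m n z (u : box d m) : box d n := box_inv n (box_point u + z).

Lemma box_shiftE m n z (u : box d m) : (forall i, `|z i| + m%:Z <= n%:Z) ->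
  box_point (box_shift n z u) = box_point u + z.
Proof.
move=> H; apply: box_invK; apply/forallP => i; rewrite ffunE.
have := H i; have /forallP /(_ i) := box_point_in u.
by move: (z i) (box_point u i) => a b; lia.
Qed.

Lemma box_shift_inj m n z : (forall i, `|z i| + m%:Z <= n%:Z) ->
  injective (@box_shift m n z).
Proof.
by move=> H u v /(congr1 (@box_point d n)); rewrite !box_shiftE // => /addIr /box_point_inj.
Qed.

Lemma box_shift_adj m n z (u v : box d m) : (forall i, `|z i| + m%:Z <= n%:Z) ->
  box_adj (box_shift n z u) (box_shift n z v) = box_adj u v.
Proof. by move=> H; rewrite /box_adj !box_shiftE // lattice_adjD. Qed.

Lemma box_configE n (t : {set box d n * box d n}) u v :
  box_config t (box_point u, box_point v) = ((u, v) \in t).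
Proof.
apply/existsP/idP => [[[a b] /andP[abt /eqP[/box_point_inj <- /box_point_inj <-]]] //|uvt].
by exists (u, v); rewrite uvt eqxx.
Qed.

Lemma box_config_adj n (t : {set box d n * box d n}) x y :
  t \in spanning_trees (@box_adj d n) -> box_config t (x, y) -> lattice_adj x y.
Proof.
rewrite inE => /asboolP [sub _ _ _] /existsP[[a b] /andP[abt /eqP[<- <-]]].
exact: (sub a b abt).
Qed.

Lemma box_config_sym n (t : {set box d n * box d n}) x y :
  t \in spanning_trees (@box_adj d n) -> box_config t (x, y) = box_config t (y, x).
Proof.
rewrite inE => /asboolP [_ sm _ _].
by apply/existsP/existsP => -[[a b] /andP[abt /eqP[<- <-]]]; exists (b, a);
  rewrite eqxx andbT; have := sm a b; rewrite /tree_rel abt.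
Qed.

End Lattice.

Section Bounded.
Context d (T : measurableType d) (R : realType) (P : probability T R).
Implicit Types f g : T -> R.

Definition bm f := exists M, bmf M f.

Lemma bm_cst c : bm (fun=> c). Proof. by exists `|c|; apply: bmf_cst. Qed.

Lemma bmD f g : bm f -> bm g -> bm (fun x => f x + g x).
Proof. by case=> M ? [N ?]; exists (M + N); apply: bmfD. Qed.

Lemma bmM f g : bm f -> bm g -> bm (fun x => f x * g x).
Proof. by case=> M ? [N ?]; exists (M * N); apply: bmfM. Qed.

Lemma bm_sum (I : Type) (s : seq I) (F : I -> T -> R) :
  (forall i, bm (F i)) -> bm (fun x => \sum_(i <- s) F i x).
Proof. by move=> /choice[M H]; exists (\sum_(i <- s) M i); apply: bmf_sum. Qed.

Lemma ExpD f g : bm f -> bm g -> Ex P (fun x => f x + g x) = Ex P f + Ex P g.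
Proof. by case=> M bf [N bg]; exact: (ExD P bf bg). Qed.

Lemma ExpZ c f : bm f -> Ex P (fun x => c * f x) = c * Ex P f.
Proof. by case=> M bf; exact: (ExZ P c bf). Qed.

Lemma ExpB f g : bm f -> bm g -> Ex P (fun x => f x - g x) = Ex P f - Ex P g.
Proof.
move=> bf bg; rewrite -mulN1r -ExpZ // -ExpD //; last exact: bmM (bm_cst _) bg.
by congr Ex; apply/funext => x; rewrite mulN1r.
Qed.

Lemma Exp_sum (I : Type) (s : seq I) (F : I -> T -> R) : (forall i, bm (F i)) ->
  Ex P (fun x => \sum_(i <- s) F i x) = \sum_(i <- s) Ex P (F i).
Proof. by move=> /choice[M H]; exact: (Ex_sum P s H). Qed.

Lemma Exp_le f g : bm f -> bm g -> (forall x, f x <= g x) -> Ex P f <= Ex P g.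
Proof. by case=> M bf [N bg]; exact: (Ex_le P bf bg). Qed.

Lemma Exp_le_ae f g : bm f -> bm g -> {ae P, forall x, f x <= g x} -> Ex P f <= Ex P g.
Proof. by case=> M bf [N bg]; exact: (Ex_le_ae bf bg). Qed.

End Bounded.

Lemma local_bm (V : choiceType) (R : realType) (f : config V -> R) : localf f ->
  bm (f : borel_config V -> R).
Proof. by move=> lf; have [M bM] := local_bounded lf; exists M; split=> //; apply: local_measurable. Qed.

(** * Translation invariance of the limit law *)

Section ShiftInvariance.
Variables (R : realType) (d : nat).
Local Notation V := (Zd d).
Implicit Types (x y z : V) (L : seq (V * V)) (G : config V).

Definition cyl L G : R := (all (G : V * V -> bool) L)%:R.

Definition shift_pair z (p : V * V) : V * V := (p.1 + z, p.2 + z).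

Definition shift z G : config V := fun p => G (shift_pair z p).

Lemma cyl_shift z L G : cyl L (shift z G) = cyl (map (shift_pair z) L) G.
Proof. by rewrite /cyl all_map. Qed.

Lemma localf_cyl L : localf (cyl L).
Proof. by exists L => G G' H; rewrite /cyl; congr (_ %:R); congr nat_of_bool; apply: eq_in_all. Qed.

Lemma localf_shift (A : Type) z (f : config V -> A) : localf f -> localf (fun G => f (shift z G)).
Proof.
case=> K H; exists (map (shift_pair z) K) => G G' HG; apply: H => p pK.
by apply: HG; rewrite map_f.
Qed.

Definition bp2 n (p : box d n * box d n) : V * V := (box_point p.1, box_point p.2).

Lemma box_avg_cyl n (L0 : seq (box d n * box d n)) :
  box_avg n (cyl (map (@bp2 n) L0)) =
  #|trees_with (@box_adj d n) L0|%:R / #|spanning_trees (@box_adj d n)|%:R.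
Proof.
rewrite /box_avg mulrC; congr (_ / _); rewrite -sum1_card natr_sum.
rewrite [RHS]big_mkcond [LHS]big_mkcond; apply: eq_bigr => t _.
rewrite [t \in trees_with _ _]inE; case: (t \in spanning_trees _) => //=.
rewrite /cyl all_map (eq_all (a2 := mem t)); first by case: all.
by move=> [u v]; rewrite /= box_configE.
Qed.

(** Translation by [z] embeds the smaller box as an induced subgraph of the larger one, so
    [trees_with_mono] applies. *)
Lemma box_avg_shift_le m n z L : (forall i, `|z i| + m%:Z <= n%:Z) ->
  (forall p, p \in L -> in_box m p.1 && in_box m p.2) ->
  (0 < #|spanning_trees (@box_adj d n)|)%N -> (0 < #|spanning_trees (@box_adj d m)|)%N ->
  box_avg n (cyl (map (shift_pair z) L)) <= box_avg m (cyl L).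
Proof.
move=> zmn Lm n0 m0.
pose L0 := map (fun p => (box_inv m p.1, box_inv m p.2)) L.
have EL : L = map (@bp2 m) L0.
  rewrite -map_comp -[LHS]map_id; apply/eq_in_map => p /Lm /andP[p1 p2].
  by rewrite /bp2 /= !box_invK // -surjective_pairing.
have -> : map (shift_pair z) L = map (@bp2 n) (map (phi2 (@box_shift _ m n z)) L0).
  rewrite {1}EL -!map_comp; apply: eq_map => p.
  by rewrite /bp2 /shift_pair /phi2 /= !box_shiftE.
rewrite EL !box_avg_cyl ler_pdivrMr ?ltr0n // mulrAC ler_pdivlMr ?ltr0n //.
rewrite -!natrM ler_nat; apply: trees_with_mono.
- exact: [ffun=> ord0].
- exact: box_shift_inj.
- exact: box_adj_sym.
- exact: box_adj_irr.
- by move=> u v; apply: box_shift_adj.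
Qed.

Definition radius x : nat := \max_(i < d) absz (x i).

Lemma radiusP x i : `|x i| <= (radius x)%:Z.
Proof.
have : (absz (x i) <= radius x)%N by apply: (leq_bigmax i).
by move: (x i) (radius x) => a b; lia.
Qed.

Lemma in_box_radius x n : (radius x <= n)%N -> in_box n x.
Proof.
move=> xn; apply/forallP => i; apply: le_trans (radiusP x i) _.
by move: xn; lia.
Qed.

Lemma in_box_eventually L : exists N, forall n, (N <= n)%N ->
  forall p, p \in L -> in_box n p.1 && in_box n p.2.
Proof.
elim: L => [|q L [N IH]]; first by exists 0%N.
exists (maxn N (maxn (radius q.1) (radius q.2))) => n.
rewrite !geq_max => /and3P[Nn q1 q2] p; rewrite inE => /orP[/eqP ->|pL].
  by rewrite !in_box_radius.
exact: IH.
Qed.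

Variable P : probability (borel_config V) R.
Hypothesis hP : is_ust_law P.

Lemma cyl_ge0 L G : 0 <= cyl L G. Proof. exact: ler0n. Qed.

Lemma Ex_cyl_le m L : (forall p, p \in L -> in_box m p.1 && in_box m p.2) ->
  (0 < #|spanning_trees (@box_adj d m)|)%N -> Ex P (cyl L) <= box_avg m (cyl L).
Proof.
move=> Lm m0; have c := ust_lim hP (localf_cyl L) (cyl_ge0 L).
rewrite -(cvg_lim (@Rhausdorff R) c); apply: limr_le; first exact: cvgP c.
near=> n.
have E : cyl (map (shift_pair 0) L) = cyl L.
  congr cyl; rewrite -[RHS]map_id; apply: eq_map => -[x y].
  by rewrite /shift_pair /= !addr0.
have mn : (m <= n)%N by near: n; exists m.
rewrite -[X in box_avg _ X <= _]E; apply: box_avg_shift_le => //.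
  by move=> i; rewrite ffunE normr0 add0r; move: mn; lia.
by near: n; exact: (trees_eventually hP).
Unshelve. all: by end_near. Qed.

(** The box of radius [n] shifted by [z] lies in the box of radius [n + radius z], and both radii
    tend to infinity. The converse inequality is the same statement for [- z]. *)
Lemma Ex_cyl_shift_le z L : Ex P (cyl (map (shift_pair z) L)) <= Ex P (cyl L).
Proof.
have c := ust_lim hP (localf_cyl L) (cyl_ge0 L).
have c' := ust_lim hP (localf_cyl (map (shift_pair z) L)) (cyl_ge0 _).
rewrite -(cvg_shiftn (radius z)) in c'.
rewrite -(cvg_lim (@Rhausdorff R) c) -(cvg_lim (@Rhausdorff R) c').
apply: ler_lim; [exact: cvgP c' | exact: cvgP c |].
have [N HN] := in_box_eventually L.
near=> n; apply: box_avg_shift_le.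
- by move=> i; have := radiusP z i; move: (z i) (radius z) => a b; lia.
- by apply: HN; near: n; exists N.
- near: n; have := trees_eventually hP.
  by case=> M _ HM; exists M => // n Mn; apply: HM; rewrite /= (leq_trans Mn) // leq_addr.
- by near: n; exact: (trees_eventually hP).
Unshelve. all: by end_near. Qed.

Lemma Ex_cyl_shift z L : Ex P (fun G => cyl L (shift z G)) = Ex P (cyl L).
Proof.
have -> : (fun G => cyl L (shift z G)) = cyl (map (shift_pair z) L).
  by apply/funext => G; rewrite cyl_shift.
apply/eqP; rewrite eq_le Ex_cyl_shift_le /=.
rewrite -{1}[L](mapK (g := shift_pair (- z)) (f := shift_pair z)); last first.
  by case=> x y; rewrite /shift_pair /= !addrK.
exact: Ex_cyl_shift_le.
Qed.

Lemma Ex_local_shift z (f : config V -> R) : localf f ->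
  Ex P (fun G => f (shift z G)) = Ex P f.
Proof.
move=> [K lK].
(* Induction on the coordinates on which [f] depends. Resolving coordinate [p] yields [f] with [p]
   absent, plus the indicator of [p] times the change of [f] when [p] is switched on; the factor
   [cyl L] collects these indicators. *)
suff H L : Ex P (fun G => cyl L (shift z G) * f (shift z G)) =
           Ex P (fun G => cyl L G * f G).
  have := H [::]; rewrite /cyl /=.
  by congr (_ = _); congr Ex; apply/funext => G; rewrite mul1r.
elim: K f lK L => [|p K IH] f lK L.
  have E G : f G = f (fun=> false) by apply: lK.
  have -> : (fun G => cyl L (shift z G) * f (shift z G)) =
      (fun G => f (fun=> false) * cyl L (shift z G)).
    by apply/funext => G; rewrite (E (shift z G)) mulrC.
  have -> : (fun G => cyl L G * f G) = (fun G => f (fun=> false) * cyl L G).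
    by apply/funext => G; rewrite (E G) mulrC.
  have bm1 : bm (cyl L : borel_config V -> R) by apply/local_bm/localf_cyl.
  have bm2 : bm ((fun G => cyl L (shift z G)) : borel_config V -> R).
    by apply/local_bm/localf_shift/localf_cyl.
  by rewrite (ExpZ _ _ bm2) (ExpZ _ _ bm1) Ex_cyl_shift.
pose upd b (G : config V) : config V := fun q => if q == p then b else G q.
pose fb b G := f (upd b G).
have lfb b : local_on K (fb b).
  move=> G G' HG; apply: lK => q; rewrite /upd inE; case: eqP => //= _ /HG //.
have fE G : cyl L G * f G =
    cyl L G * fb false G + (cyl (p :: L) G * fb true G - cyl (p :: L) G * fb false G).
  have -> : f G = fb (G p) G.
    by apply: lK => q _; rewrite /upd; case: eqP => [->|].
  rewrite /cyl /=; case: (G p) => /=; first by rewrite addrCA subrr addr0.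
  by rewrite !mul0r subrr addr0.
have lf b : localf (fb b) by exists K.
have lc L' b : localf (fun G => cyl L' G * fb b G).
  by apply: (localf_comp2 *%R) => //; apply: localf_cyl.
have b1 L' b : bm ((fun G => cyl L' G * fb b G) : borel_config V -> R).
  exact/local_bm.
have b2 L' b : bm ((fun G => cyl L' (shift z G) * fb b (shift z G)) : borel_config V -> R).
  by apply/local_bm/(localf_shift z (lc L' b)).
have b3 : bm ((fun G => cyl (p :: L) G * fb true G - cyl (p :: L) G * fb false G)
    : borel_config V -> R).
  by apply/local_bm/(localf_comp2 (fun a b => a - b) (lc _ _) (lc _ _)).
have b4 : bm ((fun G => cyl (p :: L) (shift z G) * fb true (shift z G)
     - cyl (p :: L) (shift z G) * fb false (shift z G)) : borel_config V -> R).
  by apply/local_bm/(localf_shift z (localf_comp2 (fun a b => a - b) (lc _ _) (lc _ _))).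
have -> : (fun G => cyl L (shift z G) * f (shift z G)) = (fun G =>
    cyl L (shift z G) * fb false (shift z G) +
    (cyl (p :: L) (shift z G) * fb true (shift z G)
     - cyl (p :: L) (shift z G) * fb false (shift z G))).
  by apply/funext => G; rewrite fE.
have -> : (fun G => cyl L G * f G) = (fun G =>
    cyl L G * fb false G + (cyl (p :: L) G * fb true G - cyl (p :: L) G * fb false G)).
  by apply/funext => G; rewrite fE.
rewrite (ExpD _ (b2 _ _) b4) (ExpB _ (b2 _ _) (b2 _ _)).
rewrite (ExpD _ (b1 _ _) b3) (ExpB _ (b1 _ _) (b1 _ _)).
by rewrite !(IH _ (lfb _)).
Qed.

End ShiftInvariance.

(** * Degrees and long paths *)

Lemma ae_forall_count dT (T : measurableType dT) (R : realType)
    (mu : {measure set T -> \bar R}) (I : countType) (Q : I -> T -> Prop) :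
  (forall t, {ae mu, forall w, Q t w}) -> {ae mu, forall w, forall t, Q t w}.
Proof.
move=> H; have : {ae mu, forall w, forall n, if @choice.unpickle I n is Some t then Q t w else True}.
  apply: ae_foralln => n; case: choice.unpickle => [t|]; first exact: H.
  exact: aeW.
by apply: filterS => w Hw t; have := Hw (choice.pickle t); rewrite choice.pickleK.
Qed.

Section Directions.
Variable d : nat.
Local Notation V := (Zd d).
Implicit Types (x y z : V).

Definition dir (i : 'I_d * bool) : V :=
  [ffun j => if j == i.1 then (-1) ^+ i.2 else 0].

Definition opp_dir (i : 'I_d * bool) := (i.1, ~~ i.2).

Lemma opp_dirK : involutive opp_dir.
Proof. by case=> i b; rewrite /opp_dir negbK. Qed.

Lemma dir_opp i : dir (opp_dir i) = - dir i.
Proof.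
by apply/ffunP => j; rewrite !ffunE /=; case: eqP => _; rewrite ?oppr0 //; case: i.2; rewrite ?expr0 ?expr1 ?opprK.
Qed.

Lemma dir_inj : injective dir.
Proof.
move=> [i b] [j c] /ffunP H; have := H i; rewrite !ffunE /= eqxx.
case: eqP => [<-|_] /eqP; last by rewrite signr_eq0.
by case: b {H}; case: c.
Qed.

Lemma adj_dir x i : lattice_adj x (x + dir i).
Proof.
rewrite /lattice_adj (bigD1 i.1) //= big1 ?addr0 => [|j ji]; rewrite !ffunE.
  by rewrite eqxx opprD addNKr normrN normr_sign.
by rewrite (negPf ji) addr0 subrr normr0.
Qed.

Lemma adj_dirP x y : lattice_adj x y -> exists i, y = x + dir i.
Proof.
rewrite /lattice_adj => /eqP E.
have [i xi] : exists i, x i != y i.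
  have [/existsP //|/existsPn H] := boolP [exists i, x i != y i].
  move: E; rewrite big1 // => i _.
  by have := H i; rewrite negbK => /eqP ->; rewrite subrr normr0.
move: E; rewrite (bigD1 i) //= => E.
have ge0 : 0 <= \sum_(j < d | j != i) `|x j - y j| by apply: sumr_ge0.
have E1 : `|x i - y i| = 1 by move: xi E ge0; move: (x i) (y i) (\sum_(_ | _) _) => a b s; lia.
have E0 : \sum_(j < d | j != i) `|x j - y j| = 0 by move: E; rewrite E1; move: (\sum_(_ | _) _) => s; lia.
have rest j : j != i -> x j = y j.
  move=> ji; apply/eqP; rewrite -subr_eq0 -normr_eq0; move/eqP: E0.
  rewrite psumr_eq0 => [/allP /(_ j)|//]; by rewrite mem_index_enum ji => /(_ isT).
exists (i, x i - y i == 1); apply/ffunP => j; rewrite !ffunE /=.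
have [->|ji] := eqVneq j i; last by rewrite addr0 rest.
by move: E1; move: (x i) (y i) => a b; case: eqP => /=; rewrite ?expr1 ?expr0; lia.
Qed.

Lemma adj_dist x y i : lattice_adj x y -> `|x i - y i| <= 1.
Proof.
rewrite /lattice_adj (bigD1 i) //= => /eqP <-; rewrite lerDl.
by apply: sumr_ge0.
Qed.

End Directions.

Section AlmostSure.
Variables (R : realType) (d : nat) (P : probability (borel_config (Zd d)) R).
Hypothesis hP : is_ust_law P.
Local Notation V := (Zd d).
Implicit Types (x y z : V) (G : config V).

(** The indicator of failure is local, so its expectation is the limit of box averages that are
    eventually 0. *)
Lemma ust_ae (f : config V -> bool) : localf f ->
  (\forall n \near \oo, forall t, t \in spanning_trees (@box_adj d n) -> f (box_config t)) ->
  {ae P, forall G : borel_config V, f G}.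
Proof.
move=> lf H; pose g (G : config V) : R := (~~ f G)%:R.
have lg : localf g by apply: (localf_comp (fun b : bool => (~~ b)%:R)).
have [M bg] := local_bm lg.
have g0 G : 0 <= g G by apply: ler0n.
have E0 : Ex P g = 0.
  have c := ust_lim hP lg g0.
  rewrite -(cvg_lim (@Rhausdorff R) c); apply: cvg_lim => //.
  apply: cvg_near_cst; apply: filterS H => n Hn.
  by rewrite /box_avg big1 ?mulr0 // => t /Hn; rewrite /g => ->.
have := Ex_eq0_ae bg g0 E0; apply: filterS => G /eqP.
by rewrite /g pnatr_eq0 eqb0 negbK.
Qed.

Lemma ust_ae_adj : {ae P, forall G : borel_config V, forall p, G p -> lattice_adj p.1 p.2}.
Proof.
apply: ae_forall_count => -[x y].
have : {ae P, forall G : borel_config V, G (x, y) ==> lattice_adj x y}.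
  apply: ust_ae; first exact: (localf_comp (fun b => b ==> lattice_adj x y) (localf_coord _)).
  by apply: nearW => n t tT; apply/implyP; exact: box_config_adj.
by apply: filterS => G /implyP.
Qed.

Lemma ust_ae_sym : {ae P, forall G : borel_config V, forall p, G p = G (p.2, p.1)}.
Proof.
apply: ae_forall_count => -[x y].
have : {ae P, forall G : borel_config V, G (x, y) == G (y, x)}.
  apply: ust_ae; first exact: (localf_comp2 (fun b c => b == c) (localf_coord _) (localf_coord _)).
  by apply: nearW => n t tT; apply/eqP; exact: box_config_sym.
by apply: filterS => G /eqP.
Qed.

(** Only immediate backtracking is excluded. This holds for every self-avoiding path, and its
    recursion runs parallel to that of [hit], as [branch_hit] requires. *)
Fixpoint nb_path G L x y : bool :=
  if L is L'.+1 then [exists i, [&& G (y, y + dir i), y + dir i != x & nb_path G L' y (y + dir i)]]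
  else true.

Definition nb_root G L x : bool := [exists i, G (x, x + dir i) && nb_path G L x (x + dir i)].

Lemma localf_exists (I : finType) (f : I -> config V -> bool) :
  (forall i, localf (f i)) -> localf (fun G => [exists i, f i G]).
Proof.
move=> H.
have -> : (fun G => [exists i, f i G]) = (fun G => \big[orb/false]_(i <- enum I) f i G).
  by apply/funext => G; rewrite big_enum big_orE; apply: eq_existsb => i.
exact: localf_big.
Qed.

Lemma localf_nb_path L x y : localf (fun G => nb_path G L x y).
Proof.
elim: L x y => [|L IH] x y; first exact: localf_cst.
apply: localf_exists => i.
apply: (localf_comp2 andb (localf_coord _)).
by apply: (localf_comp (andb _)).
Qed.

Lemma localf_nb_root L x : localf (fun G => nb_root G L x).
Proof.
apply: localf_exists => i.
exact: (localf_comp2 andb (localf_coord _) (localf_nb_path _ _ _)).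
Qed.

Lemma uniq_nb_path n (t : {set box d n * box d n}) L u v (p : seq (box d n)) :
  t \in spanning_trees (@box_adj d n) ->
  path (tree_rel t) v p -> uniq [:: u, v & p] -> (L <= size p)%N ->
  nb_path (box_config t) L (box_point u) (box_point v).
Proof.
move=> tT; elim: L u v p => [|L IH] u v [|w p] //= /andP[vw pth] unq szp.
have cvw : box_config t (box_point v, box_point w) by rewrite box_configE.
have [i wE] := adj_dirP (box_config_adj tT cvw).
apply/existsP; exists i; rewrite -wE cvw /=.
move: unq; rewrite !inE !negb_or => /andP[/and3P[uv uw up] unq].
rewrite (inj_eq (@box_point_inj d n)) eq_sym uw /=.
by apply: IH pth _ _ => //=; rewrite inE negb_or.
Qed.

Lemma path_dist n (t : {set box d n * box d n}) i u (p : seq (box d n)) :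
  t \in spanning_trees (@box_adj d n) -> path (tree_rel t) u p ->
  `|box_point u i - box_point (last u p) i| <= (size p)%:Z.
Proof.
move=> tT; elim: p u => [|v p IH] u /=; first by rewrite subrr normr0.
move=> /andP[uv /IH le1].
have cuv : box_config t (box_point u, box_point v) by rewrite box_configE.
have := adj_dist i (box_config_adj tT cuv).
move: (box_point u i) (box_point v i) (box_point (last v p) i) (size p) le1 => a b c s.
lia.
Qed.

(** In a large box the tree joins [x] to a corner, and the simple path between them has more than
    [L] steps because one step moves each coordinate by at most 1. *)
Lemma ust_ae_nb_root (i0 : 'I_d) L x : {ae P, forall G : borel_config V, nb_root G L x}.
Proof.
apply: ust_ae; first exact: localf_nb_root.
exists (radius x + L.+1)%N => // n /= ngt t tT.
pose u := box_inv n x; have uE : box_point u = x.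
  by apply/box_invK/in_box_radius; apply: leq_trans ngt; rewrite leq_addr.
pose y : box d n := [ffun=> ord_max].
have [_ _ /(_ u y) /connectP[q pth lst] _] : is_spanning_tree (@box_adj d n) t.
  by move: tT; rewrite inE => /asboolP.
case/shortenP: pth lst => p pth unq _ lst.
have szp : (L < size p)%N.
  have := path_dist i0 tT pth; rewrite -lst uE.
  have -> : box_point y i0 = n%:Z by rewrite !ffunE /=; lia.
  by have := radiusP x i0; move: (x i0) (radius x) (size p) ngt => a b s; lia.
case: p pth unq lst szp => [|v p] //= /andP[uv pth] unq _ szp.
have cuv : box_config t (box_point u, box_point v) by rewrite box_configE.
have [i vE] := adj_dirP (box_config_adj tT cuv).
apply/existsP; exists i; rewrite -uE -vE cuv /=.
exact: uniq_nb_path pth _ _.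
Qed.

End AlmostSure.

(** * The mean degree *)

Section Degree.
Variables (R : realType) (d : nat) (P : probability (borel_config (Zd d)) R).
Hypothesis hP : is_ust_law P.
Local Notation V := (Zd d).
Implicit Types (x y z : V) (G : config V).

Lemma box_point_in_dir m (w : box d m) i :
  in_box m.+1 (box_point w) && in_box m.+1 (box_point w + dir i).
Proof.
apply/andP; split; apply/forallP => j; have /forallP /(_ j) := box_point_in w.
  by move: (box_point w j) => a; lia.
have := adj_dist j (adj_dir (box_point w) i).
by move: (box_point w j) ((box_point w + dir i) j) => a b; lia.
Qed.

Lemma tree_edges_le m (t : {set box d m.+1 * box d m.+1}) :
  t \in spanning_trees (@box_adj d m.+1) ->
  (\sum_(w : box d m) \sum_(i : 'I_d * bool)
     (box_config t (box_point w, (box_point w + dir i)%R) : nat) <= #|t|)%N.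
Proof.
move=> tT; rewrite pair_big /=.
pose A := [pred wi : box d m * ('I_d * bool) |
  box_config t (box_point wi.1, box_point wi.1 + dir wi.2)].
pose h (wi : box d m * ('I_d * bool)) : box d m.+1 * box d m.+1 :=
  (box_inv m.+1 (box_point wi.1), box_inv m.+1 (box_point wi.1 + dir wi.2)).
have in1 (w : box d m) : in_box m.+1 (box_point w).
  by apply/forallP => i; have /forallP /(_ i) := box_point_in w; move: (box_point w i) => a; lia.
have in2 (w : box d m) i : in_box m.+1 (box_point w + dir i).
  by have /andP[] := box_point_in_dir w i.
have h_inj : injective h.
  move=> [w i] [w' i'] [/(congr1 (@box_point d m.+1)) + /(congr1 (@box_point d m.+1))].
  by rewrite /= !box_invK // => /box_point_inj <- /addrI /dir_inj <-.
have -> : (\sum_(p : box d m * ('I_d * bool)) 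
    (box_config t (box_point p.1, (box_point p.1 + dir p.2)%R) : nat) = #|A|)%N.
  rewrite -sum1_card [RHS]big_mkcond /=; apply: eq_bigr => p _.
  by rewrite inE; case: (box_config _ _).
rewrite -(card_imset _ h_inj); apply: subset_leq_card; apply/fintype.subsetP => q.
case/imsetP => -[w i]; rewrite inE /= => Hwi ->.
by rewrite -box_configE !box_invK.
Qed.

Definition mean_degree : R := \sum_(i : 'I_d * bool) Ex P (cyl R [:: (0, dir i)]).

Lemma bernoulli_ineq (y : R) n : 0 <= y <= 1 -> 1 - n%:R * y <= (1 - y) ^+ n.
Proof.
move=> /andP[y0 y1]; elim: n => [|n IH]; first by rewrite mul0r subr0 expr0.
rewrite exprS; have h1 : 0 <= 1 - y by rewrite subr_ge0.
apply: le_trans (ler_wpM2l h1 IH).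
have : 0 <= n%:R * (y * y) by rewrite !mulr_ge0 // ler0n.
by rewrite -natr1; move: (n%:R) => k; nra.
Qed.

(** The degrees are added up over the box of radius [m]. All their edges lie in the box of radius
    [m.+1], where edge probabilities can only be larger and where a tree on [v] vertices has
    [2 * (v - 1)] ordered adjacent pairs. *)
Lemma mean_degree_box m : (0 < #|spanning_trees (@box_adj d m.+1)|)%N ->
  mean_degree * (m.*2.+1 ^ d)%:R <= 2 * (m.*2.+3 ^ d)%:R.
Proof.
move=> m0.
have bl L : bm (cyl R L : borel_config V -> R) by apply/local_bm/localf_cyl.
have N0 : (0 : R) < #|spanning_trees (@box_adj d m.+1)|%:R by rewrite ltr0n.
have E : mean_degree * (m.*2.+1 ^ d)%:R = \sum_(w : box d m) \sum_(i : 'I_d * bool)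
    Ex P (cyl R [:: (box_point w, box_point w + dir i)]).
  rewrite (eq_bigr (fun=> mean_degree)) => [|w _].
    by rewrite sumr_const card_ffun !card_ord mulr_natr.
  apply: eq_bigr => i _; rewrite -[RHS](Ex_cyl_shift hP (box_point w)).
  congr Ex; apply/funext => G.
  by rewrite cyl_shift /= /shift_pair /= add0r [dir i + _]addrC.
rewrite E.
have le1 (w : box d m) i : Ex P (cyl R [:: (box_point w, box_point w + dir i)]) <=
    box_avg m.+1 (cyl R [:: (box_point w, box_point w + dir i)]).
  by apply: Ex_cyl_le => // p; rewrite inE => /eqP -> /=; apply: box_point_in_dir.
apply: le_trans (ler_sum _ (fun w _ => ler_sum _ (fun i _ => le1 w i))) _.
rewrite /box_avg; under eq_bigr do rewrite -mulr_sumr.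
rewrite -mulr_sumr mulrC ler_pdivrMr //.
under eq_bigr do rewrite exchange_big /=.
rewrite exchange_big /=.
apply: (@le_trans _ _ (\sum_(t in spanning_trees (@box_adj d m.+1)) (2 * (m.*2.+3 ^ d)%:R))).
  apply: ler_sum => t tT.
  have := tree_edges_le tT.
  rewrite (card_spanning_tree (@box_adj_sym d m.+1) (@box_adj_irr d m.+1) [ffun=> ord0] tT).
  rewrite card_ffun !card_ord -(ler_nat R) => H.
  apply: le_trans (le_trans _ H) _.
    rewrite natr_sum; apply: ler_sum => w _; rewrite natr_sum; apply: ler_sum => i _.
    by rewrite /cyl /= andbT.
  by rewrite -natrM ler_nat mul2n leq_double leq_pred.
by rewrite sumr_const -[X in X <= _]mulr_natr.
Qed.

Lemma mean_degree_le2 : mean_degree <= 2.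
Proof.
rewrite leNgt; apply/negP => D2.
have [N _ HN] := trees_eventually hP.
pose e := mean_degree - 2; have e0 : 0 < e by rewrite subr_gt0.
have D0 : 0 < mean_degree by apply: lt_trans D2.
(* With [y = 2 / (2 * m + 3)], Bernoulli's inequality bounds the volume ratio of the two boxes from
   below by [1 - d * y]; this [m] makes the loss [d * y * mean_degree] smaller than [e]. *)
pose m := (N + (Num.truncn (2 * d%:R * mean_degree / e)).+1)%N.
have m0 : (0 < #|spanning_trees (@box_adj d m.+1)|)%N.
  by apply: HN; rewrite /= /m; lia.
have := mean_degree_box m0.
pose y : R := 2 / m.*2.+3%:R.
have k0 : (0 : R) < m.*2.+3%:R by rewrite ltr0n.
have y01 : 0 <= y <= 1.
  by rewrite /y divr_ge0 ?ler0n //= ler_pdivrMr // mul1r ler_nat.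
have := bernoulli_ineq d y01.
have -> : 1 - y = m.*2.+1%:R / m.*2.+3%:R.
  rewrite /y -[X in X - _](divff (lt0r_neq0 k0)) -mulrBl; congr (_ / _).
  by rewrite -[m.*2.+3]addn2 natrD addrK.
rewrite expr_div_n -!natrX => B H.
have K0 : (0 : R) < (m.*2.+3 ^ d)%:R by rewrite ltr0n expn_gt0.
move: B; rewrite ler_pdivlMr // => B.
have : mean_degree * (1 - d%:R * y) <= 2.
  rewrite -(ler_pM2r K0) -mulrA; apply: le_trans H.
  by apply: ler_wpM2l => //; exact: ltW.
apply/negP; rewrite -ltNge mulrBr mulr1 ltrBrDr -ltrBrDl -/e.
rewrite /y !mulrA ltr_pdivrMr //.
have : 2 * d%:R * mean_degree / e < m.*2.+3%:R.
  apply: lt_le_trans (truncnS_gt _) _.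
  by rewrite ler_nat /m; move: (Num.truncn _) => k; lia.
by rewrite ltr_pdivrMr //; nra.
Qed.

End Degree.

(** * Killed walks on forests *)

Lemma cvg_sumr (R : realType) (I : Type) (s : seq I) (p : pred I) (F : I -> nat -> R) (l : I -> R) :
  (forall i, F i n @[n --> \oo] --> l i) ->
  \sum_(i <- s | p i) F i n @[n --> \oo] --> \sum_(i <- s | p i) l i.
Proof.
move=> c; elim: s => [|i s IH].
  by under eq_fun do rewrite big_nil; rewrite big_nil; apply: cvg_cst.
rewrite big_cons; case: ifP => pi; last by under eq_fun do rewrite big_cons pi.
by under eq_fun do rewrite big_cons pi; apply: cvgD.
Qed.

Section Conductance.
Variables (R : realType) (d : nat) (H : config (Zd d)).
Hypothesis Hsym : forall x y, H (x, y) = H (y, x).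
Hypothesis Hadj : forall x y, H (x, y) -> lattice_adj x y.
Local Notation V := (Zd d).
Local Notation I := ('I_d * bool)%type.
Implicit Types (x y : V) (i : I) (n : nat) (z : R).

Definition dg x : R := \sum_(i : I) (H (x, x + dir i))%:R.

(* On a forest, for the walk that survives each step with probability [1 / z]: the
   probability of ever moving from [x] to its neighbour [y], where the branch at
   [x] away from [y] is truncated at depth [n]. *)
Fixpoint hit z n x y : R :=
  if n is n'.+1 then
    if H (x, y) then
      (z * dg x - \sum_(i : I | x + dir i != y) hit z n' (x + dir i) x)^-1
    else 0
  else 0.

Definition dgap z n x := z * dg x - \sum_(i : I) hit z n (x + dir i) x.

Lemma hit_nedge z n x y : ~~ H (x, y) -> hit z n x y = 0.
Proof. by case: n => //= n /negbTE ->. Qed.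

Lemma dir_edge x y : H (x, y) -> exists i, y = x + dir i.
Proof. by move=> /Hadj /adj_dirP. Qed.

Lemma neq_dir x i j : (x + dir j != x + dir i) = (j != i).
Proof. by rewrite (inj_eq (addrI x)) (inj_eq (@dir_inj d)). Qed.

Lemma dgap_split z n x i : dgap z n x + hit z n (x + dir i) x =
  z * dg x - \sum_(j | j != i) hit z n (x + dir j) x.
Proof. by rewrite /dgap (bigD1 (F := fun i => hit _ _ (x + dir i) x) i) //=; ring. Qed.

Lemma hitS z n x y : H (x, y) -> hit z n.+1 x y = (dgap z n x + hit z n y x)^-1.
Proof.
move=> xy; rewrite /= xy; congr (_^-1); have [i yE] := dir_edge xy.
rewrite yE dgap_split (eq_bigl (fun j => j != i)) // => j; exact: neq_dir.
Qed.

Lemma hit_bounds z n x y : 1 <= z -> (0 <= hit z n x y) /\ (hit z n x y <= z^-1) .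
Proof.
move=> z1; have z0 : 0 < z by apply: lt_le_trans z1.
have iz : z^-1 <= 1 by rewrite invf_le1.
elim: n x y => [|n IH] x y; first by split; rewrite //= invr_ge0 ltW.
have [xy|/hit_nedge ->] := boolP (H (x, y)); last by split; rewrite // invr_ge0 ltW.
suff den : z <= dgap z n x + hit z n y x.
  rewrite hitS //; split; last by rewrite lef_pV2 // posrE; apply: lt_le_trans den.
  by rewrite invr_ge0; apply: le_trans den; apply: ltW.
have [i yE] := dir_edge xy.
rewrite /dgap /dg yE (bigD1 i) //= -yE xy (bigD1 (F := fun i => hit _ _ (x + dir i) x) i) //= -yE.
rewrite mulrDr mulr1 mulr_sumr.
suff : 0 <= \sum_(j | j != i) (z * (H (x, x + dir j))%:R - hit z n (x + dir j) x).
  by rewrite sumrB; lra.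
apply: sumr_ge0 => j _; have [xj|nxj] := boolP (H (x, x + dir j)).
  by rewrite mulr1 subr_ge0 (le_trans (IH _ _).2) // (le_trans iz).
by rewrite mulr0 hit_nedge ?subr0 // Hsym.
Qed.

Lemma hit_le1 z n x y : 1 <= z -> hit z n x y <= 1.
Proof.
move=> z1; apply: le_trans (hit_bounds n x y z1).2 _.
by rewrite invf_le1 // (lt_le_trans _ z1).
Qed.

Lemma dgap_edge z n x i : 1 <= z -> 
  (z - 1) * dg x + (H (x, x + dir i))%:R - hit z n (x + dir i) x <= dgap z n x.
Proof.
move=> z1; rewrite /dgap /dg (bigD1 i) //= (bigD1 (F := fun i => hit _ _ (x + dir i) x) i) //=.
have : \sum_(j | j != i) hit z n (x + dir j) x <= \sum_(j | j != i) (H (x, x + dir j))%:R.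
  apply: ler_sum => j _; have [xj|nxj] := boolP (H (x, x + dir j)); first exact: hit_le1.
  by rewrite hit_nedge // Hsym.
lra.
Qed.

Lemma dgap_ge z n x : 1 <= z -> (z - 1) * dg x <= dgap z n x.
Proof.
move=> z1; rewrite /dgap mulrBl mul1r lerD2l lerN2; apply: ler_sum => i _.
have [xj|nxj] := boolP (H (x, x + dir i)); first exact: hit_le1.
by rewrite hit_nedge // Hsym.
Qed.

Lemma dgap_hit_pos z n x y : 1 <= z -> H (x, y) -> 0 < dgap z n x + hit z n y x.
Proof.
move=> z1 xy; have [i yE] := dir_edge xy.
have := dgap_edge n x i z1; rewrite -yE xy /= mulr1n.
have : 0 <= (z - 1) * dg x.
  by rewrite mulr_ge0 ?subr_ge0 // sumr_ge0.
by lra.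
Qed.

Lemma hit_mono_z z z' n x y : 1 <= z' -> z' <= z -> hit z n x y <= hit z' n x y.
Proof.
move=> z1 zz; elim: n x y => [|n IH] x y //=.
case: ifP => // xy; have z1' := le_trans z1 zz.
have p1 := dgap_hit_pos n z1 xy; have p2 := dgap_hit_pos n z1' xy.
have := hitS z n xy; rewrite /= xy => ->; have := hitS z' n xy; rewrite /= xy => ->.
rewrite lef_pV2 ?posrE //.
have [i yE] := dir_edge xy.
rewrite yE !dgap_split.
have : \sum_(j | j != i) hit z n (x + dir j) x <= \sum_(j | j != i) hit z' n (x + dir j) x.
  by apply: ler_sum.
have : z' * dg x <= z * dg x by rewrite ler_wpM2r // sumr_ge0.
lra.
Qed.

(** The truncated walk is lost once it goes deeper than [n], so a larger depth leaves more ways to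
    succeed. *)
Lemma hit_mono z n x y : 1 <= z -> hit z n x y <= hit z n.+1 x y.
Proof.
move=> z1; elim: n x y => [|n IH] x y; first exact: (hit_bounds 1 x y z1).1.
have [xy|nxy] := boolP (H (x, y)); last by rewrite !hit_nedge.
rewrite (hitS z n xy) (hitS z n.+1 xy) lef_pV2 ?posrE ?dgap_hit_pos //.
have [i yE] := dir_edge xy.
rewrite yE !dgap_split.
have : \sum_(j | j != i) hit z n (x + dir j) x <= \sum_(j | j != i) hit z n.+1 (x + dir j) x.
  by apply: ler_sum.
lra.
Qed.

Definition hitoo z x y : R := limn (fun n => hit z n x y).

(* The killed walk from [x] visits [x] on average [z * dg x / dgapoo z x] times. *)
Definition dgapoo z x := z * dg x - \sum_(i : I) hitoo z (x + dir i) x.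

Lemma cvg_hit z x y : 1 <= z -> hit z n x y @[n --> \oo] --> hitoo z x y.
Proof.
move=> z1; apply: nondecreasing_is_cvgn.
  by apply/nondecreasing_seqP => n; apply: hit_mono.
by exists 1 => _ [n _ <-]; apply: hit_le1.
Qed.

Lemma hitoo_bounds z x y : 1 <= z -> 0 <= hitoo z x y <= 1.
Proof.
move=> z1; have c := @cvg_hit z x y z1; apply/andP; split.
  by apply: limr_ge; [exact: cvgP c | apply: nearW => n; exact: (hit_bounds n x y z1).1].
by apply: limr_le; [exact: cvgP c | apply: nearW => n; exact: hit_le1].
Qed.

Lemma hitoo_nedge z x y : ~~ H (x, y) -> hitoo z x y = 0.
Proof.
move=> xy; rewrite /hitoo (_ : (fun n => _) = fun=> 0) ?lim_cst //.
by apply/funext => n; rewrite hit_nedge.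
Qed.

Lemma hitoo_mono_z z z' x y : 1 <= z' -> z' <= z -> hitoo z x y <= hitoo z' x y.
Proof.
move=> z1 zz; apply: ler_lim.
- exact: cvgP (@cvg_hit z x y (le_trans z1 zz)).
- exact: cvgP (@cvg_hit z' x y z1).
- by apply: nearW => n; apply: hit_mono_z.
Qed.

Lemma cvg_dgap z x : 1 <= z -> dgap z n x @[n --> \oo] --> dgapoo z x.
Proof.
move=> z1; apply: cvgB; first exact: cvg_cst.
by apply: cvg_sumr => i; apply: cvg_hit.
Qed.

(** First-step recursion, with the term of [y] added back to complete the sum over the neighbours.
    Hence [hitoo z x y * dgapoo z x] and [hitoo z y x * dgapoo z y] coincide: both are 1 minus the
    product of the two hitting probabilities. *)
Lemma hitoo_eq z x y : 1 <= z -> H (x, y) ->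
  hitoo z x y * (dgapoo z x + hitoo z y x) = 1.
Proof.
move=> z1 xy.
have c : hit z n.+1 x y * (dgap z n x + hit z n y x) @[n --> \oo] -->
    hitoo z x y * (dgapoo z x + hitoo z y x).
  apply: cvgM; first by have := @cvg_hit z x y z1; rewrite -(cvg_shiftS).
  by apply: cvgD; [exact: cvg_dgap | exact: cvg_hit].
rewrite -(cvg_lim (@Rhausdorff R) c); apply: cvg_lim => //.
apply: cvg_near_cst; apply: nearW => n.
by rewrite hitS // mulVf // lt0r_neq0 // dgap_hit_pos.
Qed.

Lemma dgapoo_ge z x : 1 <= z -> (z - 1) * dg x <= dgapoo z x.
Proof.
move=> z1; have c := @cvg_dgap z x z1; rewrite -(cvg_lim (@Rhausdorff R) c).
by apply: limr_ge; [exact: cvgP c | apply: nearW => n; exact: dgap_ge].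
Qed.

End Conductance.

(** * Where the killed walk dies *)

Section Harmonic.
Variables (R : realType) (d : nat) (H : config (Zd d)).
Hypothesis Hsym : forall x y, H (x, y) = H (y, x).
Hypothesis Hadj : forall x y, H (x, y) -> lattice_adj x y.
Local Notation V := (Zd d).
Local Notation I := ('I_d * bool)%type.
Local Notation dH := (dg R H).
Local Notation hH := (@hitoo R d H).
Local Notation gH := (@dgapoo R d H).
Implicit Types (x y : V) (i : I) (n : nat) (z : R).

Lemma dg_ge0 x : 0 <= dH x. Proof. by apply: sumr_ge0. Qed.

Lemma dg_ge1 x y : H (x, y) -> 1 <= dH x.
Proof.
move=> xy; have [i yE] := dir_edge Hadj xy.
rewrite /dg (bigD1 i) //= -yE xy lerDl.
exact: sumr_ge0.
Qed.

Lemma dg_le x : dH x <= (2 * d)%:R.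
Proof.
apply: le_trans (_ : \sum_(i : I) 1 <= _).
  by apply: ler_sum => i _; case: (H _).
by rewrite sumr_const card_prod card_ord card_bool mulnC.
Qed.

(* The killed walk from [x] dies at [x] with probability [kill z x], and in the
   branch beyond its neighbour [y] with probability [harm z x y]. *)
Definition kill z x : R := (z - 1) * dH x / gH z x.

Definition harm z x y : R := (H (x, y))%:R * (1 - hH z y x) / gH z x.

Lemma dgapoo_gt0 z x : 1 < z -> 0 < dH x -> 0 < gH z x.
Proof.
move=> z1 dx; apply: lt_le_trans (dgapoo_ge Hsym Hadj x (ltW z1)).
by rewrite mulr_gt0 // subr_gt0.
Qed.

Lemma harm_sum z x : 1 < z -> 0 < dH x ->
  \sum_(i : I) harm z x (x + dir i) = 1 - kill z x.
Proof.
move=> z1 dx; have Dp := dgapoo_gt0 z1 dx.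
transitivity ((gH z x - (z - 1) * dH x) / gH z x); last first.
  by rewrite mulrBl divff // lt0r_neq0.
rewrite -mulr_suml; congr (_ / _).
rewrite (eq_bigr (fun i => (H (x, x + dir i))%:R - hH z (x + dir i) x)) => [|i _].
  by rewrite sumrB -/(dH x) /dgapoo; ring.
have [xi|xi] := boolP (H (x, x + dir i)); first by rewrite mul1r.
by rewrite mul0r hitoo_nedge ?subrr // Hsym.
Qed.

(** With [a] and [b] the hitting probabilities of the killed walk across the edge, [hitoo_eq] gives
    [harm z x y = (1 - b) * a / (1 - a * b)] and symmetrically for [harm z y x]. This proves the
    bound with [a] and [b] in place of the probabilities at [z = 1], which are larger. *)
Lemma harm_edge z x y : 1 < z -> H (x, y) ->
  harm z x y + harm z y x <= 1 - (1 - hH 1 x y) * (1 - hH 1 y x).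
Proof.
move=> z1 xy; have yx : H (y, x) by rewrite Hsym.
have z1' := ltW z1.
have E1 := hitoo_eq Hsym Hadj z1' xy; have E2 := hitoo_eq Hsym Hadj z1' yx.
have Dx := dgapoo_gt0 z1 (lt_le_trans ltr01 (dg_ge1 xy)).
have Dy := dgapoo_gt0 z1 (lt_le_trans ltr01 (dg_ge1 yx)).
have /andP[a0 a1] := hitoo_bounds Hsym Hadj x y z1'.
have /andP[b0 b1] := hitoo_bounds Hsym Hadj y x z1'.
have ha := hitoo_mono_z Hsym Hadj x y (lexx (1 : R)) z1'.
have hb := hitoo_mono_z Hsym Hadj y x (lexx (1 : R)) z1'.
have /andP[A0 A1] := hitoo_bounds Hsym Hadj x y (lexx (1 : R)).
have /andP[B0 B1] := hitoo_bounds Hsym Hadj y x (lexx (1 : R)).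
apply: (@le_trans _ _ (1 - (1 - hH z x y) * (1 - hH z y x))); last first.
  rewrite lerD2l lerN2; apply: ler_pM; rewrite ?subr_ge0 //; by rewrite lerD2l lerN2.
rewrite /harm xy yx !mul1r.
move: (hH z x y) (hH z y x) (gH z x) (gH z y) E1 E2 Dx Dy a0 a1 b0 b1.
move=> a b Dx Dy E1 E2 Dx0 Dy0 a0 a1 b0 b1.
have ap : 0 < a by rewrite lt_def a0 andbT; apply/eqP => E; move: E1; rewrite E mul0r => /eqP; rewrite eq_sym oner_eq0.
have bp : 0 < b by rewrite lt_def b0 andbT; apply/eqP => E; move: E2; rewrite E mul0r => /eqP; rewrite eq_sym oner_eq0.
have aD : a * Dx = 1 - a * b by lra.
have bD : b * Dy = 1 - a * b by lra.
have k0 : 0 < 1 - a * b by rewrite -aD mulr_gt0.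
have -> : (1 - b) / Dx = (1 - b) * a / (1 - a * b).
  by rewrite -aD; field; rewrite !lt0r_neq0.
have -> : (1 - a) / Dy = (1 - a) * b / (1 - a * b).
  by rewrite -bD; field; rewrite !lt0r_neq0.
rewrite -mulrDl ler_pdivrMr // -subr_ge0.
have -> : (1 - (1 - a) * (1 - b)) * (1 - a * b) - ((1 - b) * a + (1 - a) * b) =
  (a * b) * ((1 - a) * (1 - b)) by ring.
by rewrite !mulr_ge0 ?subr_ge0.
Qed.

Lemma harm_nedge z x y : ~~ H (x, y) -> harm z x y = 0.
Proof. by move=> /negbTE xy; rewrite /harm xy !mul0r. Qed.

Lemma dgapoo_sum z x : gH z x =
  (z - 1) * dH x + \sum_(i : I) ((H (x, x + dir i))%:R - hH z (x + dir i) x).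
Proof. by rewrite sumrB -/(dH x) /dgapoo; ring. Qed.

Lemma hitoo_le_edge z x i : 1 <= z -> 0 <= (H (x, x + dir i))%:R - hH z (x + dir i) x.
Proof.
move=> z1; have [xi|xi] := boolP (H (x, x + dir i)).
  by rewrite subr_ge0; case/andP: (hitoo_bounds Hsym Hadj (x + dir i) x z1).
by rewrite hitoo_nedge ?subr0 // Hsym.
Qed.

(* A branch containing a long path is left slowly: [1 / hit - 1], the
   conductance to infinity of the killed branch, grows linearly with its depth. *)
Lemma branch_hit z L x y : 1 <= z -> (L.+1 ^ 2)%:R * (z - 1) <= 2 ->
  H (x, y) -> nb_path H L x y -> hH z y x * (1 + L.+1%:R * (z - 1) / 2) <= 1.
Proof.
move=> z1; set t := z - 1; have t0 : 0 <= t by rewrite subr_ge0.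
elim: L x y => [|L IH] x y Lt xy /=; have yx : H (y, x) by rewrite Hsym.
all: have E := hitoo_eq Hsym Hadj z1 yx; have [i xE] := dir_edge Hadj yx.
all: have /andP[h0 h1] := hitoo_bounds Hsym Hadj y x z1.
all: have tdg : t <= t * dH y by rewrite ler_peMr // (dg_ge1 yx).
  move=> _; rewrite -[X in _ <= X]E; apply: ler_wpM2l => //.
  rewrite dgapoo_sum (bigD1 i) //= -xE yx -/t.
  have : 0 <= \sum_(j | j != i) ((H (y, y + dir j))%:R - hH z (y + dir j) y).
    by apply: sumr_ge0 => j _; apply: hitoo_le_edge.
  by rewrite mulr1n mul1r; lra.
move=> /existsP[j /and3P[yw wx pth]].
have ji : j != i by apply: contraNneq wx => ->; rewrite -xE.
have Lt' : (L.+1 ^ 2)%:R * t <= 2.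
  apply: le_trans Lt; apply: ler_wpM2r => //.
  by rewrite ler_nat leq_exp2r.
have := IH _ _ Lt' yw pth.
have /andP[] := hitoo_bounds Hsym Hadj (y + dir j) y z1.
rewrite -[X in _ -> _ -> _ -> _ <= X]E => w0 w1 wh; apply: ler_wpM2l => //.
rewrite dgapoo_sum (bigD1 i) //= (bigD1 j) //= -xE yx yw -/t !mulr1n.
have : 0 <= \sum_(k | (k != i) && (k != j)) ((H (y, y + dir k))%:R - hH z (y + dir k) y).
  by apply: sumr_ge0 => k _; apply: hitoo_le_edge.
move: wh Lt' w0 w1; rewrite -(natr1 L.+1) natrX.
have l0 : 0 <= L.+1%:R :> R by exact: ler0n.
move: (\sum_(_ | _) _) (hH z (y + dir j) y) (L.+1%:R : R) l0 => S h l l0 wh Lt' w0 w1 S0.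
(* By induction [h <= 1 / (1 + s)], hence [h <= 1 - s + s * s]. The quadratic error is at most
   [t / 2] because [l ^+ 2 * t <= 2], and is paid for by half of the killing term at [y]; the other
   half makes the linear growth continue. *)
have s2 : (l * t / 2) * (l * t / 2) <= t / 2.
  have -> : (l * t / 2) * (l * t / 2) = (l ^+ 2 * t) * (t / 4) by field.
  have -> : t / 2 = 2 * (t / 4) by field.
  by apply: ler_wpM2r => //; rewrite divr_ge0.
move: wh s2; set s := l * t / 2 => wh s2.
have -> : (l + 1) * t / 2 = s + t / 2 by rewrite /s; field.
suff : h <= 1 - s + s * s by lra.
have s0 : 0 <= s by rewrite /s divr_ge0 // mulr_ge0 // ?ler0n // l0.
have s1 : 0 < 1 + s by rewrite ltr_wpDr.
rewrite -subr_ge0 -(pmulr_lge0 _ s1).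
have -> : (1 - s + s * s - h) * (1 + s) = s * s * s + (1 - h * (1 + s)) by ring.
by rewrite addr_ge0 ?subr_ge0 // !mulr_ge0.
Qed.

(** One deep branch makes [dgapoo z x] at least [s / 2] with [s = L.+1 * (z - 1) / 2], while the
    numerator of [kill] is at most [2 * d * (z - 1)]; the quotient gives the constant [8 * d]. *)
Lemma kill_le z L x : 1 < z -> (L.+1 ^ 2)%:R * (z - 1) <= 2 -> nb_root H L x ->
  kill z x <= (8 * d)%:R / L.+1%:R.
Proof.
move=> z1 Lt /existsP[i /andP[xi pth]].
have := branch_hit (ltW z1) Lt xi pth.
have /andP[] := hitoo_bounds Hsym Hadj (x + dir i) x (ltW z1).
set t := z - 1 in Lt *; have t0 : 0 < t by rewrite subr_gt0.
have l1 : 1 <= L.+1%:R :> R by rewrite ler1n.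
have s1 : L.+1%:R * t / 2 <= 1.
  rewrite ler_pdivrMr // mul1r; apply: le_trans Lt; apply: ler_wpM2r; first exact: ltW.
  by rewrite natrX expr2 ler_peMr // ler0n.
have G : 1 - hH z (x + dir i) x <= gH z x.
  rewrite dgapoo_sum (bigD1 i) //= xi mulr1n -/t.
  have : 0 <= \sum_(j | j != i) ((H (x, x + dir j))%:R - hH z (x + dir j) x).
    by apply: sumr_ge0 => j _; apply: hitoo_le_edge; apply: ltW.
  have : 0 <= t * dH x by rewrite mulr_ge0 ?dg_ge0 // ltW.
  by lra.
move: s1 G; rewrite /kill -/t; move: (hH z (x + dir i) x) (gH z x) => h g s1 G h0 h1.
set s := L.+1%:R * t / 2 in s1 *.
move=> hs; have s0 : 0 < s by rewrite /s divr_gt0 // mulr_gt0 // (lt_le_trans _ l1).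
have g0 : s / 2 <= g by nra.
have g1 : 0 < g by apply: lt_le_trans g0; rewrite divr_gt0.
rewrite ler_pdivrMr //.
have l0 : 0 < L.+1%:R :> R by rewrite ltr0n.
apply: (@le_trans _ _ ((8 * d)%:R / L.+1%:R * (s / 2))); last first.
  by apply: ler_wpM2l => //; rewrite divr_ge0 // ltW.
have -> : (8 * d)%:R / L.+1%:R * (s / 2) = t * (2 * d)%:R.
  by rewrite /s !natrM; field; rewrite lt0r_neq0.
by apply: ler_wpM2l; [exact: ltW | exact: dg_le].
Qed.

(** If [dgapoo] is positive at [x], some neighbour [y] is left for good with positive probability,
    whence [hitoo 1 x y = 1]. The equations of this edge give [1 / dgapoo y = 1 / dgapoo x - 1]: the
    resistance to infinity drops by one and stays positive, which cannot go on forever. *)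
Lemma one_sided_gap0 : (forall x y, H (x, y) -> (1 - hH 1 x y) * (1 - hH 1 y x) = 0) ->
  forall x, gH 1 x = 0.
Proof.
move=> E; have key k x : 0 < gH 1 x -> k%:R * gH 1 x < 1.
  elim: k x => [|k IH] x Dx; first by rewrite mul0r.
  have [/existsP[i /andP[xi nhit]]|/existsPn no] := boolP
      [exists i : I, H (x, x + dir i) && (hH 1 (x + dir i) x != 1)].
    set y := x + dir i in xi nhit *; have yx : H (y, x) by rewrite Hsym.
    have h1 : hH 1 x y = 1.
      have /eqP := E _ _ xi; rewrite mulf_eq0 !subr_eq0 => /orP[/eqP <- //|].
      by rewrite eq_sym (negPf nhit).
    have := hitoo_eq Hsym Hadj (lexx (1 : R)) xi; have := hitoo_eq Hsym Hadj (lexx (1 : R)) yx.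
    rewrite h1 mul1r; have /andP[] := hitoo_bounds Hsym Hadj y x (lexx (1 : R)).
    move: nhit; rewrite -natr1; have := IH y.
    move: (hH 1 y x) (gH 1 x) (gH 1 y) Dx => b Dx Dy Dx0 IHy nb b0 b1 E1 E2.
    have b0' : 0 < b.
      by rewrite lt_def b0 andbT; apply/eqP => E0; move: E1; rewrite E0 mul0r => /eqP; rewrite eq_sym oner_eq0.
    have Dy0 : 0 < Dy by rewrite -(pmulr_rgt0 _ b0'); nra.
    have := IHy Dy0; rewrite -(ltr_pM2l b0').
    have -> : b * (k%:R * Dy) = k%:R * (b * Dy) by ring.
    have -> : b * Dy = Dx by lra.
    by rewrite mulrDl; lra.
  suff D0 : gH 1 x = 0 by rewrite D0 ltxx in Dx.
  rewrite /dgapoo mul1r /dg -sumrB big1 // => i _.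
  have := no i; rewrite negb_and negbK => /orP[xi|/eqP h1].
    by rewrite (negPf xi) hitoo_nedge ?subrr // Hsym.
  have [xi|xi] := boolP (H (x, x + dir i)); first by rewrite h1 subrr.
  by rewrite hitoo_nedge ?subrr // Hsym.
move=> x; apply/eqP/negPn/negP => D0.
have Dp : 0 < gH 1 x.
  have := dgapoo_ge Hsym Hadj x (lexx (1 : R)).
  by rewrite subrr mul0r lt_def D0.
have := key (Num.truncn (gH 1 x)^-1).+1 x Dp.
rewrite -ltr_pdivlMr // div1r; apply/negP; rewrite -leNgt.
exact/ltW/truncnS_gt.
Qed.

End Harmonic.

(** * Recurrence and last collisions *)

Section Walk.
Variables (R : realType) (d : nat) (H : config (Zd d)).
Local Notation V := (Zd d).
Local Notation I := ('I_d * bool)%type.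
Implicit Types (x y u : V) (i j : I) (n N : nat).

Definition stp x y : R := if H (x, y) then (dg R H x)^-1 else 0.

Definition markov (g : V -> R) x : R := \sum_(i : I) stp x (x + dir i) * g (x + dir i).

Definition pn n x y : R := iter n markov (fun z => (z == y)%:R) x.

Definition markov2 (g : V -> V -> R) x y : R :=
  markov (fun x' => markov (fun y' => g x' y') y) x.

(** Time 0 is not tested, so [avoid n u u] concerns two walks that have just met. *)
Fixpoint avoid n : V -> V -> R :=
  if n is n'.+1 then markov2 (fun x y => (x != y)%:R * avoid n' x y) else fun _ _ => 1.

Lemma stp_ge0 x y : 0 <= stp x y.
Proof. by rewrite /stp; case: ifP => // _; rewrite invr_ge0 dg_ge0. Qed.

Lemma markov_ge0 g x : (forall y, 0 <= g y) -> 0 <= markov g x.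
Proof. by move=> g0; apply: sumr_ge0 => i _; rewrite mulr_ge0 ?stp_ge0. Qed.

Lemma markov_le g g' x : (forall y, g y <= g' y) -> markov g x <= markov g' x.
Proof. by move=> gg; apply: ler_sum => i _; rewrite ler_wpM2l ?stp_ge0. Qed.

Lemma markovD g g' x : markov (fun y => g y + g' y) x = markov g x + markov g' x.
Proof. by rewrite /markov -big_split; apply: eq_bigr => i _; rewrite mulrDr. Qed.

Lemma markovZ c g x : markov (fun y => c * g y) x = c * markov g x.
Proof. by rewrite /markov mulr_sumr; apply: eq_bigr => i _; rewrite mulrCA. Qed.

Lemma markov_sum (J : Type) (s : seq J) (F : J -> V -> R) x :
  markov (fun y => \sum_(j <- s) F j y) x = \sum_(j <- s) markov (F j) x.
Proof.
rewrite /markov exchange_big; apply: eq_bigr => i _; exact: mulr_sumr.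
Qed.

Lemma eq_markov g g' x : g =1 g' -> markov g x = markov g' x.
Proof. by move=> gg; apply: eq_bigr => i _; rewrite gg. Qed.

Lemma pn_ge0 n x y : 0 <= pn n x y.
Proof. by elim: n x => [|n IH] x; [exact: ler0n | exact: markov_ge0]. Qed.

Lemma pnSr n x y : pn n.+1 x y = \sum_(i : I) pn n x (y + dir i) * stp (y + dir i) y.
Proof.
elim: n x => [|n IH] x.
  rewrite /pn /= /markov (reindex_inj (can_inj (@opp_dirK d))); apply: eq_bigr => i _.
  rewrite mulrC dir_opp subr_eq; have [->|] := eqVneq x (y + dir i); first by rewrite addrK.
  by rewrite !mul0r.
transitivity (markov (pn n.+1 ^~ y) x) => //.
rewrite (eq_markov _ IH) markov_sum; apply: eq_bigr => i _.
rewrite mulrC -markovZ; apply: eq_markov => z; exact: mulrC.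
Qed.

Section Regular.
Hypothesis Hsym : forall x y, H (x, y) = H (y, x).
Hypothesis Hadj : forall x y, H (x, y) -> lattice_adj x y.
Hypothesis Hdeg : forall x, 1 <= dg R H x.

Lemma dg_neq0 x : dg R H x != 0.
Proof. by rewrite lt0r_neq0 // (lt_le_trans ltr01 (Hdeg x)). Qed.

Lemma markov_cst c x : markov (fun=> c) x = c.
Proof.
rewrite /markov -mulr_suml (eq_bigr (fun i => (dg R H x)^-1 * (H (x, x + dir i))%:R)).
  by rewrite -mulr_sumr -/(dg R H x) mulVf ?mul1r // dg_neq0.
by move=> i _; rewrite /stp; case: (H _); rewrite ?mulr1 ?mulr0.
Qed.

Lemma dg_stp x y : dg R H x * stp x y = dg R H y * stp y x.
Proof.
rewrite /stp [H (y, x)]Hsym; case: (H _); last by rewrite !mulr0.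
by rewrite !mulfV ?dg_neq0.
Qed.

Lemma pn_rev n x y : dg R H x * pn n x y = dg R H y * pn n y x.
Proof.
elim: n x => [|n IH] x.
  by rewrite /pn /= eq_sym; case: eqP => [->|]; rewrite ?mulr0.
rewrite [in RHS]pnSr [in RHS]mulr_sumr.
have -> : pn n.+1 x y = \sum_(i : I) stp x (x + dir i) * pn n (x + dir i) y by [].
rewrite mulr_sumr.
apply: eq_bigr => i _; rewrite mulrA dg_stp -mulrA mulrCA IH.
by rewrite mulrCA; congr (_ * _); exact: mulrC.
Qed.

Lemma pn_le_rev n x y : pn n x y <= (2 * d)%:R * pn n y x.
Proof.
apply: (@le_trans _ _ (dg R H x * pn n x y)).
  by rewrite ler_peMl ?pn_ge0.
by rewrite pn_rev ler_wpM2r ?pn_ge0 // dg_le.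
Qed.

(** Otherwise the Green function [U] towards [x0] is finite. Being superharmonic, it satisfies
    [hit * U y <= U x] by the recursion of [hit] alone, on graphs with cycles too. Inserted into the
    equation for [U] at [x0], this gives [dg x0 <= U x0 * dgapoo x0], contrary to the positive
    degree. *)
Theorem recurrent x0 : dgapoo H (1 : R) x0 = 0 ->
  forall B, exists N, B < \sum_(n < N) pn n x0 x0.
Proof.
move=> D0 B; apply: contrapT => no.
have {no} bnd N : \sum_(n < N) pn n x0 x0 <= B.
  by rewrite leNgt; apply/negP => lt; apply: no; exists N.
pose u N x := \sum_(n < N) pn n x x0.
have uS N x : u N.+1 x = (x == x0)%:R + markov (u N) x.
  rewrite /u big_ord_recl; congr (_ + _).
  by rewrite -(big_mkord xpredT (fun n => pn n.+1 x x0)) -(markov_sum (index_iota 0 N) (fun n x => pn n x x0));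
     apply: eq_markov => y; rewrite big_mkord.
(* Maximum principle: away from [x0] the value is an average of values for a smaller [N]. *)
have u_le N x : u N x <= B.
  have [->|xx0] := eqVneq x x0; first exact: bnd.
  elim: N x xx0 => [|N IH] x xx0; first by have := bnd 0%N; rewrite /u !big_ord0.
  rewrite uS (negPf xx0) add0r -(markov_cst B x); apply: markov_le => y.
  by have [->|] := eqVneq y x0; [exact: bnd | exact: IH].
have u_mono x : nondecreasing_seq (u ^~ x).
  by apply/nondecreasing_seqP => n; rewrite /u big_ord_recr lerDl pn_ge0.
pose U x := limn (u ^~ x).
have cU x : u N x @[N --> \oo] --> U x.
  by apply: nondecreasing_is_cvgn => //; exists B => _ [N _ <-].
have U_ge N x : u N x <= U x.
  by apply: nondecreasing_cvgn_le => //; exact: cvgP (cU x).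
have U0 x : 0 <= U x by apply: le_trans (U_ge 0%N x); rewrite /u big_ord0.
have UE x : U x = (x == x0)%:R + markov U x.
  have c1 : u N.+1 x @[N --> \oo] --> U x by have := cU x; rewrite -(cvg_shiftS).
  have c2 : u N.+1 x @[N --> \oo] --> (x == x0)%:R + markov U x.
    under eq_fun do rewrite uS; apply: cvgD; first exact: cvg_cst.
    by apply: cvg_sumr => i; apply: cvgM; [exact: cvg_cst | exact: cU].
  by rewrite -(cvg_lim (@Rhausdorff R) c1) (cvg_lim (@Rhausdorff R) c2).
have dgU x : dg R H x * markov U x = \sum_(i : I) (H (x, x + dir i))%:R * U (x + dir i).
  rewrite /markov mulr_sumr; apply: eq_bigr => i _; rewrite /stp mulrA.
  by case: (H _); rewrite ?mulr0 // mulfV ?dg_neq0.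
have superharm x : \sum_(i : I) (H (x, x + dir i))%:R * U (x + dir i) <= dg R H x * U x.
  by rewrite -dgU ler_wpM2l ?dg_ge0 // [leRHS]UE lerDr.
have hitU n x y : hit H (1 : R) n x y * U y <= U x.
  elim: n x y => [|n IH] x y; first by rewrite /= mul0r.
  have [xy|xy] := boolP (H (x, y)); last by rewrite hit_nedge // mul0r.
  rewrite hitS // mulrC ler_pdivrMr ?dgap_hit_pos //.
  have [i yE] := dir_edge Hadj xy; rewrite yE dgap_split mul1r mulrBr.
  rewrite lerBrDr mulrC [X in _ <= X]mulrC; apply: le_trans (superharm x).
  rewrite [leRHS](bigD1 i) //= -yE xy mul1r lerD2l mulr_suml; apply: ler_sum => j _.
  have [xj|xj] := boolP (H (x, x + dir j)); first by rewrite mul1r IH.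
  by rewrite hit_nedge ?mul0r // Hsym.
have U1 : 1 <= U x0 by rewrite UE eqxx lerDl markov_ge0.
have le n : dg R H x0 <= U x0 * dgap H (1 : R) n x0.
  have E : dg R H x0 * U x0 = dg R H x0 + \sum_(i : I) (H (x0, x0 + dir i))%:R * U (x0 + dir i).
    by rewrite [in LHS]UE eqxx mulrDr mulr1 dgU.
  rewrite /dgap mul1r mulrBr mulrC E -addrA lerDl subr_ge0 mulrC mulr_suml.
  apply: ler_sum => j _.
  have [xj|xj] := boolP (H (x0, x0 + dir j)); first by rewrite mul1r hitU.
  by rewrite hit_nedge ?mul0r // Hsym.
have c : U x0 * dgap H (1 : R) n x0 @[n --> \oo] --> U x0 * dgapoo H (1 : R) x0.
  by apply: cvgM; [exact: cvg_cst | exact: cvg_dgap].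
have : dg R H x0 <= U x0 * dgapoo H (1 : R) x0.
  rewrite -(cvg_lim (@Rhausdorff R) c); apply: limr_ge; first exact: cvgP c.
  exact: nearW.
rewrite D0 mulr0; apply/negP; rewrite -ltNge.
exact: lt_le_trans (Hdeg x0).
Qed.

End Regular.

End Walk.

(** * Decomposition at the last collision *)

Section WalkSums.
Variables (R : realType) (d : nat) (H : config (Zd d)).
Local Notation V := (Zd d).
Local Notation I := ('I_d * bool)%type.
Local Notation step := (stp R H).
Local Notation mk := (@markov R d H).
Local Notation mk2 := (@markov2 R d H).
Local Notation p := (pn R H).
Local Notation av := (avoid R H).
Implicit Types (x y u : V) (i j : I) (n N : nat).

(** Finite form of a sum over the lattice. The condition [within N n u x] below ensures that a walk
    from [x] stays in this box for [n] steps. *)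
Definition bsum N u (F : V -> R) : R := \sum_(w : box d N) F (u + box_point w).

Definition within N n u x : bool := [forall i, `|x i - u i| + n%:Z <= N%:Z].

Lemma within_dir N n u x i : within N n.+1 u x -> within N n u (x + dir i).
Proof.
move=> /forallP Hx; apply/forallP => j; have := Hx j; have := adj_dist j (adj_dir x i).
by move: (x j) ((x + dir i) j) (u j) => a b c; lia.
Qed.

Lemma within_refl N n u : (n <= N)%N -> within N n u u.
Proof. by move=> nN; apply/forallP => j; rewrite subrr normr0 add0r; lia. Qed.

Lemma bsum_delta N u x (F : V -> R) : within N 0 u x ->
  bsum N u (fun z => (x == z)%:R * F z) = F x.
Proof.
move=> /forallP Hx; have xu : in_box N (x - u).
  by apply/forallP => j; have := Hx j; rewrite !ffunE; move: (x j) (u j) => a b; lia.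
have E : u + box_point (box_inv N (x - u)) = x by rewrite (box_invK xu) addrC subrK.
rewrite /bsum (bigD1 (box_inv N (x - u))) //= big1 ?addr0 => [|w ww].
  by rewrite E eqxx mul1r.
case: eqP => [xE|]; last by rewrite mul0r.
case/eqP: ww; apply: (@box_point_inj d N); apply: (addrI u).
by rewrite E.
Qed.

Lemma eq_markov_dir (g g' : V -> R) x : (forall i, g (x + dir i) = g' (x + dir i)) ->
  mk g x = mk g' x.
Proof. by move=> gg; apply: eq_bigr => i _; rewrite gg. Qed.

Lemma iter_markov_bsum n N u x (g : V -> R) : within N n u x ->
  iter n mk g x = bsum N u (fun z => p n x z * g z).
Proof.
elim: n x => [|n IH] x wx; first by rewrite bsum_delta.
rewrite iterS (@eq_markov_dir _ (fun x => bsum N u (fun z => p n x z * g z))).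
  rewrite markov_sum; apply: eq_bigr => w _.
  rewrite [in RHS]mulrC -[p n.+1 x _]/(mk (p n ^~ (u + box_point w)) x) -markovZ.
  by apply: eq_markov => z; apply: mulrC.
by move=> i; apply: IH; apply: within_dir.
Qed.

Lemma iter_markov2_bsum n N u x y (c : V -> R) : within N n u x -> within N n u y ->
  iter n mk2 (fun x y => (x == y)%:R * c x) x y =
  bsum N u (fun z => p n x z * p n y z * c z).
Proof.
elim: n x y => [|n IH] x y wx wy.
  rewrite (_ : bsum _ _ _ = bsum N u (fun z => (x == z)%:R * ((y == z)%:R * c z))).
    by rewrite bsum_delta //= eq_sym.
  by apply: eq_bigr => w _; rewrite mulrA.
rewrite iterS /markov2.
rewrite (@eq_markov_dir _ (fun x' => bsum N u (fun z => p n x' z * (p n.+1 y z * c z)))).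
  rewrite markov_sum; apply: eq_bigr => w _; rewrite -mulrA.
  rewrite [in RHS]mulrC -[p n.+1 x _]/(mk (p n ^~ (u + box_point w)) x) -markovZ.
  by apply: eq_markov => z; apply: mulrC.
move=> i; rewrite (@eq_markov_dir _ (fun y' => bsum N u (fun z => p n (x + dir i) z * (p n y' z * c z)))).
  rewrite markov_sum; apply: eq_bigr => w _; rewrite markovZ; congr (_ * _).
  rewrite [in RHS]mulrC -[p n.+1 y _]/(mk (p n ^~ (u + box_point w)) y) -markovZ.
  by apply: eq_markov => z; apply: mulrC.
move=> j; rewrite IH; [|exact: within_dir|exact: within_dir].
by apply: eq_bigr => w _; rewrite mulrA.
Qed.

Lemma markov2_le (g g' : V -> V -> R) x y : (forall x y, g x y <= g' x y) ->
  mk2 g x y <= mk2 g' x y.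
Proof. by move=> gg; apply: markov_le => x'; apply: markov_le => y'. Qed.

Lemma iter_markov2_le n (g g' : V -> V -> R) x y : (forall x y, g x y <= g' x y) ->
  iter n mk2 g x y <= iter n mk2 g' x y.
Proof. by move=> gg; elim: n x y => [|n IH] x y //; apply: markov2_le. Qed.

Lemma markov2_ge0 (g : V -> V -> R) x y : (forall x y, 0 <= g x y) -> 0 <= mk2 g x y.
Proof. by move=> g0; apply: markov_ge0 => x'; apply: markov_ge0. Qed.

Lemma avoid_ge0 n x y : 0 <= av n x y.
Proof.
elim: n x y => [|n IH] x y //=; apply: markov2_ge0 => x' y'.
by rewrite mulr_ge0 ?ler0n.
Qed.

Fixpoint met M : V -> V -> R :=
  if M is M'.+1 then fun x y => (x == y)%:R * av M x y + mk2 (met M') x y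
  else fun x y => (x == y)%:R.

Lemma met_ge0 M x y : 0 <= met M x y.
Proof.
elim: M x y => [|M IH] x y /=; first exact: ler0n.
by rewrite addr_ge0 ?mulr_ge0 ?ler0n ?avoid_ge0 // ?markov2_ge0 // => x' y'; rewrite mulr_ge0 ?ler0n ?avoid_ge0.
Qed.

Lemma markov2D (g g' : V -> V -> R) x y :
  mk2 (fun x y => g x y + g' x y) x y = mk2 g x y + mk2 g' x y.
Proof. by rewrite /markov2 -markovD; apply: eq_markov => x'; rewrite markovD. Qed.

Lemma markov2_sum (J : Type) (s : seq J) (F : J -> V -> V -> R) x y :
  mk2 (fun x y => \sum_(j <- s) F j x y) x y = \sum_(j <- s) mk2 (F j) x y.
Proof. by rewrite /markov2 -markov_sum; apply: eq_markov => x'; rewrite markov_sum. Qed.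

Hypothesis Hsym : forall x y, H (x, y) = H (y, x).
Hypothesis Hadj : forall x y, H (x, y) -> lattice_adj x y.
Hypothesis Hdeg : forall x, 1 <= dg R H x.

Lemma markov2_cst (c : R) x y : mk2 (fun _ _ => c) x y = c.
Proof. by rewrite /markov2 !markov_cst. Qed.

Lemma avoid_le n x y : av n.+1 x y <= av n x y.
Proof.
elim: n x y => [|n IH] x y.
  rewrite -[leRHS](markov2_cst 1 x y) /=; apply: markov2_le => x' y'.
  by rewrite mulr1; case: (_ == _); rewrite /= ?ler01.
apply: markov2_le => x' y'; rewrite ler_wpM2l ?ler0n //; exact: IH.
Qed.

(* [met M] adds up, over the time of the last collision up to [M], the
   probability that two walks collide then and avoid each other afterwards. *)
Lemma met_avoid M x y : met M x y + (x != y)%:R * av M x y = 1.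
Proof.
elim: M x y => [|M IH] x y.
  by rewrite /= mulr1; case: (x == y); rewrite ?addr0 ?add0r.
rewrite /= addrAC -mulrDl.
have -> : (x == y)%:R + (x != y)%:R = 1 :> R by case: (x == y); rewrite ?addr0 ?add0r.
rewrite mul1r -markov2D -[RHS](markov2_cst 1 x y); congr (mk2 _ x y).
by apply/funext => x'; apply/funext => y'; rewrite addrC IH.
Qed.

(** In [met M] a collision at time [n] is followed by [M - n] steps of avoidance. Asking for [M]
    steps instead only lowers the probability and makes the factor the same for all [n]. *)
Lemma met_ge k M x y : (k <= M.+1)%N ->
  \sum_(n < k) iter n mk2 (fun x y => (x == y)%:R * av M x y) x y <= met M x y.
Proof.
elim: M k x y => [|M IH] [|k] x y kM; rewrite ?big_ord0 ?met_ge0 //.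
  case: k kM => // _; rewrite big_ord_recl big_ord0 addr0 /=.
  by rewrite mulr1.
rewrite big_ord_recl /=; apply: lerD => //.
rewrite -(big_mkord xpredT (fun n => mk2 (iter n mk2 (fun x y => (x == y)%:R * av M.+1 x y)) x y)).
rewrite -markov2_sum; apply: markov2_le => x' y'; rewrite big_mkord.
apply: le_trans (IH k x' y' kM); apply: ler_sum => n _.
apply: iter_markov2_le => x'' y''; rewrite ler_wpM2l ?ler0n //; exact: avoid_le.
Qed.

Theorem last_collision_sum k M N u : (k <= M.+1)%N -> (k <= N.+1)%N ->
  \sum_(n < k) bsum N u (fun z => p n u z ^+ 2 * av M z z) <= 1.
Proof.
move=> kM kN; apply: (@le_trans _ _ (met M u u)); last first.
  by rewrite -(met_avoid M u u) eqxx mul0r addr0.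
apply: le_trans (met_ge _ _ kM); apply: ler_sum => n _.
have -> : (fun x y => (x == y)%:R * av M x y) = (fun x y => (x == y)%:R * av M x x).
  by apply/funext => x; apply/funext => y; case: eqP => [->|]; rewrite ?mul0r.
have wu : within N n u u by apply: within_refl; rewrite -ltnS (leq_trans (ltn_ord n)).
by rewrite (iter_markov2_bsum (fun x => av M x x) wu wu).
Qed.

Lemma pnD n m x y : p (n + m) x y = iter n mk (p m ^~ y) x.
Proof. by rewrite /pn iterD. Qed.

(** Reversing the first [n] steps costs a ratio of degrees, at most [2 * d]; both factors then
    describe walks that arrive at [u], which is the form of the mass received by [u]. *)
Lemma return_bound n m N u : (n <= N)%N ->
  p (n + m) u u <= (2 * d)%:R * bsum N u (fun z => p n z u * p m z u).
Proof.
move=> nN; rewrite pnD (iter_markov_bsum _ (within_refl u nN)) mulr_sumr.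
apply: ler_sum => w _; rewrite mulrA ler_wpM2r ?pn_ge0 //.
exact: pn_le_rev.
Qed.

(** A return at time [2 * n] costs [2 * d * A n]. An odd return is split into [n] and [n + 1] steps
    and costs [d * (A n + A n.+1)] by the inequality [2 * a * b <= a ^+ 2 + b ^+ 2]. Altogether each
    [A n] is used at most [4 * d] times. *)
Lemma return_sum k N u : (k <= N)%N ->
  \sum_(n < k.*2) p n u u <=
  (4 * d)%:R * \sum_(n < k.+1) bsum N u (fun z => p n z u ^+ 2).
Proof.
move=> kN; set A := fun n => bsum N u (fun z => p n z u ^+ 2).
have A0 n : 0 <= A n by apply: sumr_ge0 => w _; apply: sqr_ge0.
have even n : (n <= N)%N -> p n.*2 u u <= (2 * d)%:R * A n.
  by move=> nN; rewrite -addnn; apply: return_bound.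
have odd n : (n < N)%N -> p n.*2.+1 u u <= d%:R * (A n + A n.+1).
  move=> nN; rewrite -addnn -addnS; apply: le_trans (return_bound _ _ (ltnW nN)) _.
  rewrite natrM mulrAC mulrC ler_wpM2l ?ler0n // mulr_sumr -big_split.
  by apply: ler_sum => w _; rewrite -subr_ge0; set a := p _ _ _; set b := p _ _ _;
    have := sqr_ge0 (a - b); rewrite /=; nra.
have key (j : nat) : (j <= N)%N -> \sum_(n < j.*2) p n u u <=
    (3 * d)%:R * \sum_(n < j) A n + d%:R * \sum_(n < j) A n.+1.
  elim: j => [|j IH] jN; first by rewrite !big_ord0 !mulr0 addr0.
  rewrite doubleS !big_ord_recr /= !mulrDr.
  have := IH (ltnW jN); have := even j (ltnW jN); have /= := odd j jN.
  rewrite !natrM; lra.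
apply: le_trans (key k kN) _.
have S1 : \sum_(n < k) A n <= \sum_(n < k.+1) A n by rewrite big_ord_recr lerDl.
have S2 : \sum_(n < k) A n.+1 <= \sum_(n < k.+1) A n by rewrite [leRHS]big_ord_recl lerDr.
have -> : (4 * d)%:R = (3 * d)%:R + d%:R :> R by rewrite -natrD -mulSnr.
by rewrite mulrDl; apply: lerD; rewrite ler_wpM2l ?ler0n.
Qed.

End WalkSums.

(** * Mass transport *)

Section SymmetricPart.
Variable d : nat.
Local Notation V := (Zd d).
Implicit Types (G : config V) (x y z : V).

(* Almost surely [sg G = G]; passing to [sg G] makes the symmetry and locality of
   the graph unconditional. *)
Definition sg G : config V :=
  fun p => [&& lattice_adj p.1 p.2, G p & G (p.2, p.1)].

Lemma sg_sym G x y : sg G (x, y) = sg G (y, x).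
Proof. by rewrite /sg /= lattice_adj_sym; congr (_ && _); exact: andbC. Qed.

Lemma sg_adj G x y : sg G (x, y) -> lattice_adj x y.
Proof. by case/and3P. Qed.

Lemma sg_shift z G : sg (shift z G) = shift z (sg G).
Proof. by apply/funext => -[x y]; rewrite /sg /shift /shift_pair /= lattice_adjD. Qed.

Lemma localf_sg (A : Type) (f : config V -> A) : localf f -> localf (fun G => f (sg G)).
Proof.
case=> K HK; exists (K ++ [seq (p.2, p.1) | p <- K]) => G G' HG; apply: HK => p pK.
by rewrite /sg !HG // mem_cat ?pK // (map_f (fun p => (p.2, p.1)) pK) orbT.
Qed.

Lemma localf_if (A : Type) (b : config V -> bool) (f g : config V -> A) :
  localf b -> localf f -> localf g -> localf (fun G => if b G then f G else g G).
Proof.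
move=> lb lf lg.
exact: (localf_comp2 (fun (b : bool) (q : A * A) => if b then q.1 else q.2) lb
  (localf_comp2 pair lf lg)).
Qed.

End SymmetricPart.

Section LocalityShift.
Variables (R : realType) (d : nat).
Local Notation V := (Zd d).
Local Notation I := ('I_d * bool)%type.
Implicit Types (G H : config V) (x y z : V).

Lemma shiftE z H x y : shift z H (x, y) = H (x + z, y + z).
Proof. by []. Qed.

Lemma shift_dir z H x i : shift z H (x, x + dir i) = H (x + z, x + z + dir i).
Proof. by rewrite shiftE addrAC. Qed.

Lemma localf_sumI (F : I -> config V -> R) (q : pred I) :
  (forall i, localf (F i)) -> localf (fun H => \sum_(i | q i) F i H).
Proof.
move=> lF; under eq_fun do rewrite big_mkcond.
by apply: localf_big => i; case: (q i) => //; apply: localf_cst.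
Qed.

Lemma localf_bool p : localf (fun H : config V => (H p)%:R : R).
Proof. exact: (localf_comp (fun b : bool => b%:R) (localf_coord p)). Qed.

Lemma localf_dg x : localf (fun H => dg R H x).
Proof. by apply: localf_sumI => i; apply: localf_bool. Qed.

Lemma dg_shift z H x : dg R (shift z H) x = dg R H (x + z).
Proof. by apply: eq_bigr => i _; rewrite shift_dir. Qed.

Lemma localf_hit t n x y : localf (fun H => hit H (t : R) n x y).
Proof.
elim: n x y => [|n IH] x y /=; first exact: localf_cst.
apply: localf_if; [exact: localf_coord | | exact: localf_cst].
apply: (localf_comp (@GRing.inv R)); apply: (localf_comp2 (fun a b : R => a - b)).
  exact/(localf_comp (fun a : R => t * a))/localf_dg.
by apply: localf_sumI => i.
Qed.

Lemma hit_shift t z H n x y : hit (shift z H) (t : R) n x y = hit H t n (x + z) (y + z).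
Proof.
elim: n x y => [|n IH] x y //=; rewrite dg_shift shiftE.
case: ifP => // _; congr (_ - _)^-1; apply: eq_big => [i|i _].
  by rewrite addrAC (inj_eq (addIr z)).
by rewrite IH addrAC.
Qed.

Lemma localf_dgap t n x : localf (fun H => dgap H (t : R) n x).
Proof.
apply: (localf_comp2 (fun a b : R => a - b)).
  exact/(localf_comp (fun a : R => t * a))/localf_dg.
by apply: localf_sumI => i; apply: localf_hit.
Qed.

Lemma hitoo_shift t z H x y : hitoo (shift z H) (t : R) x y = hitoo H t (x + z) (y + z).
Proof.
rewrite /hitoo (_ : (fun n => hit (shift z H) t n x y) =
  (fun n => hit H t n (x + z) (y + z))) //.
by apply/funext => n; exact: hit_shift.
Qed.

Lemma stp_shift z H x y : stp R (shift z H) x y = stp R H (x + z) (y + z).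
Proof. by rewrite /stp shiftE dg_shift. Qed.

Lemma localf_stp x y : localf (fun H => stp R H x y).
Proof.
apply: localf_if; [exact: localf_coord | | exact: localf_cst].
exact/(localf_comp (@GRing.inv R))/localf_dg.
Qed.

Lemma localf_markov (g : config V -> V -> R) x :
  (forall y, localf (fun H => g H y)) -> localf (fun H => markov H (g H) x).
Proof.
move=> lg; apply: localf_sumI => i.
exact: (localf_comp2 *%R (localf_stp _ _) (lg _)).
Qed.

Lemma markov_shift z H (g g' : V -> R) x : (forall y, g y = g' (y + z)) ->
  markov (shift z H) g x = markov H g' (x + z).
Proof.
move=> gg; apply: eq_bigr => i _.
by rewrite stp_shift gg addrAC.
Qed.

Lemma localf_pn n x y : localf (fun H => pn R H n x y).
Proof.
elim: n x => [|n IH] x; first exact: localf_cst.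
exact: (@localf_markov (fun H y' => pn R H n y' y)).
Qed.

Lemma pn_shift z H n x y : pn R (shift z H) n x y = pn R H n (x + z) (y + z).
Proof.
elim: n x => [|n IH] x; first by rewrite /pn /= (inj_eq (addIr z)).
exact: (@markov_shift z H (fun x => pn R (shift z H) n x y) (fun x => pn R H n x (y + z))).
Qed.

Lemma localf_avoid n x y : localf (fun H => avoid R H n x y).
Proof.
elim: n x y => [|n IH] x y /=; first exact: localf_cst.
apply: (@localf_markov (fun H x' => markov H (fun y' => (x' != y')%:R * avoid R H n x' y') y)).
move=> x'; apply: (@localf_markov (fun H y' => (x' != y')%:R * avoid R H n x' y')) => y'.
exact: (localf_comp (fun a : R => (x' != y')%:R * a) (IH x' y')).
Qed.

Lemma avoid_shift z H n x y : avoid R (shift z H) n x y = avoid R H n (x + z) (y + z).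
Proof.
elim: n x y => [|n IH] x y //=; apply: markov_shift => x'; apply: markov_shift => y'.
by rewrite IH (inj_eq (addIr z)).
Qed.

End LocalityShift.

Section RandomForest.
Variables (R : realType) (d : nat) (P : probability (borel_config (Zd d)) R).
Hypothesis hP : is_ust_law P.
Local Notation V := (Zd d).
Local Notation I := ('I_d * bool)%type.
Implicit Types (G H : config V) (x y z u : V).

Lemma local_bmf (f : config V -> R) M : localf f -> (forall G, `|f G| <= M) ->
  bmf M (f : borel_config V -> R).
Proof. by move=> lf bf; split=> //; apply: local_measurable. Qed.

(** Carries translation invariance from local functions to bounded pointwise limits such as
    [harm]. *)
Lemma Ex_shift_lim (F : nat -> config V -> R) (f : config V -> R) M :
  (forall n, localf (F n)) -> (forall n G, `|F n G| <= M) ->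
  (forall G, F n G @[n --> \oo] --> f G) ->
  bmf M (f : borel_config V -> R) /\
  forall z, bmf M ((fun G => f (shift z G)) : borel_config V -> R) /\
    Ex P (fun G => f (shift z G)) = Ex P f.
Proof.
move=> lF bF cF; have bmF n : bmf M (F n : borel_config V -> R) by apply: local_bmf.
have bf : bmf M (f : borel_config V -> R) by apply: bmf_lim bmF _.
split=> // z.
have bmFz n : bmf M ((fun G => F n (shift z G)) : borel_config V -> R).
  by apply: local_bmf => //; apply: localf_shift.
have cFz G : F n (shift z G) @[n --> \oo] --> f (shift z G) by exact: cF.
split; first exact: (bmf_lim bmFz cFz).
have c1 : Ex P (F n) @[n --> \oo] --> Ex P f by exact: (Ex_lim bmF cF).
have c2 : Ex P (fun G => F n (shift z G)) @[n --> \oo] --> Ex P (fun G => f (shift z G)).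
  exact: (Ex_lim bmFz cFz).
rewrite -(cvg_lim (@Rhausdorff R) c1) -(cvg_lim (@Rhausdorff R) c2).
rewrite (_ : (fun n => Ex P (fun G => F n (shift z G))) = fun n => Ex P (F n)) //.
by apply/funext => n; exact: (Ex_local_shift hP).
Qed.

(** When the edge is present the degree is at least 1, so killing keeps every truncated denominator
    above [t - 1]; this gives the uniform bound for dominated convergence. *)
Lemma harm_approx t x y : 1 < t ->
  bmf (t - 1)^-1 ((fun G => harm (sg G) t x y) : borel_config V -> R) /\
  forall z, bmf (t - 1)^-1 ((fun G => harm (sg G) t (x + z) (y + z)) : borel_config V -> R) /\
    Ex P (fun G => harm (sg G) t (x + z) (y + z)) = Ex P (fun G => harm (sg G) t x y).
Proof.
move=> t1; have t1' := ltW t1.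
pose F n G : R := (sg G (x, y))%:R * (1 - hit (sg G) t n y x) / dgap (sg G) t n x.
have lF n : localf (F n).
  apply: (@localf_sg _ _ (fun H => (H (x, y))%:R * (1 - hit H t n y x) / dgap H t n x)).
  apply: (localf_comp2 (fun a b : R => a / b)); last exact: localf_dgap.
  apply: (localf_comp2 *%R); first exact: localf_bool.
  exact/(localf_comp (fun a : R => 1 - a))/localf_hit.
have bF n G : `|F n G| <= (t - 1)^-1.
  rewrite /F; have [xy|xy] := boolP (sg G (x, y)); last first.
    by rewrite !mul0r normr0 invr_ge0 subr_ge0.
  have s := @sg_sym d G; have a := @sg_adj d G.
  have g0 : t - 1 <= dgap (sg G) t n x.
    apply: le_trans (dgap_ge s a n x t1').
    by rewrite ler_peMr ?subr_ge0 // (dg_ge1 R a xy).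
  have g1 : 0 < dgap (sg G) t n x by apply: lt_le_trans g0; rewrite subr_gt0.
  have [h0 _] := hit_bounds s a n y x t1'; have h1 := hit_le1 s a n y x t1'.
  have h2 : 0 <= 1 - hit (sg G) t n y x by rewrite subr_ge0.
  rewrite mul1r ger0_norm; last by rewrite divr_ge0 // ltW.
  rewrite -[leRHS]mul1r; apply: ler_pM => //; first by rewrite invr_ge0 ltW.
    by rewrite gerBl.
  by rewrite lef_pV2 // posrE subr_gt0.
have cF G : F n G @[n --> \oo] --> harm (sg G) t x y.
  rewrite /F /harm; have s := @sg_sym d G; have a := @sg_adj d G.
  have [xy|xy] := boolP (sg G (x, y)); last first.
    by under eq_fun do rewrite !mul0r; rewrite !mul0r; apply: cvg_cst.
  apply: cvgM.
    apply: cvgM; first exact: cvg_cst.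
    by apply: cvgB; [exact: cvg_cst | exact: cvg_hit].
  apply: cvgV; last exact: cvg_dgap.
  rewrite lt0r_neq0 // dgapoo_gt0 //.
  exact: lt_le_trans ltr01 (dg_ge1 R a xy).
have [b1 H] := Ex_shift_lim lF bF cF; split=> // z.
have E : (fun G => harm (sg (shift z G)) t x y) = (fun G => harm (sg G) t (x + z) (y + z)).
  apply/funext => G; rewrite sg_shift /harm shiftE hitoo_shift; congr (_ / _).
  rewrite /dgapoo dg_shift; congr (_ - _); apply: eq_bigr => i _.
  by rewrite hitoo_shift addrAC.
by have [] := H z; rewrite E.
Qed.

Definition one_sided_defect u G : R :=
  \sum_(i : I) (sg G (u, u + dir i))%:R *
    ((1 - hitoo (sg G) (1 : R) u (u + dir i)) * (1 - hitoo (sg G) (1 : R) (u + dir i) u)).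

Lemma one_sided_defect_bm u : bm (one_sided_defect u : borel_config V -> R).
Proof.
apply: bm_sum => i; apply: bmM.
  by apply/local_bm/(localf_sg (localf_bool R _)).
have bh x y : bm ((fun G => 1 - hitoo (sg G) (1 : R) x y) : borel_config V -> R).
  apply: bmD; first exact: bm_cst.
  have c G : - hit (sg G) (1 : R) n x y @[n --> \oo] --> - hitoo (sg G) (1 : R) x y.
    by apply: cvgN; apply: (cvg_hit (@sg_sym d G) (@sg_adj d G)).
  have b n : bmf 1 ((fun G => - hit (sg G) (1 : R) n x y) : borel_config V -> R).
    apply: local_bmf => [|G].
      exact: (localf_sg (localf_comp (fun a : R => - a) (localf_hit 1 n x y))).
    rewrite normrN ger0_norm; last first.
      by case: (hit_bounds (@sg_sym d G) (@sg_adj d G) n x y (lexx (1 : R))).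
    exact: (hit_le1 (@sg_sym d G) (@sg_adj d G) n x y (lexx (1 : R))).
  by exists 1; exact: (bmf_lim b c).
exact: bmM.
Qed.

Lemma one_sided_defect_ge0 u G : 0 <= one_sided_defect u G.
Proof.
apply: sumr_ge0 => i _; rewrite mulr_ge0 ?ler0n // mulr_ge0 // subr_ge0.
  by case/andP: (hitoo_bounds (@sg_sym d G) (@sg_adj d G) u (u + dir i) (lexx (1 : R))).
by case/andP: (hitoo_bounds (@sg_sym d G) (@sg_adj d G) (u + dir i) u (lexx (1 : R))).
Qed.

Lemma sg_ae : {ae P, forall G : borel_config V, sg G = G}.
Proof.
have := ust_ae_sym hP; have := ust_ae_adj hP; apply: filterS2 => G a s.
apply/funext => -[x y]; rewrite /sg /= -(s (x, y)).
by case E : (G (x, y)); rewrite ?andbF //= andbT; apply: (a _ E).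
Qed.

Lemma dg_sg_mean u : Ex P (fun G => dg R (sg G) u) <= 2.
Proof.
apply: le_trans (mean_degree_le2 hP).
have -> : mean_degree P = Ex P (fun G => \sum_(i : I) cyl R [:: (u, u + dir i)] G).
  rewrite Exp_sum => [|i]; last by apply/local_bm/localf_cyl.
  apply: eq_bigr => i _; rewrite -(Ex_cyl_shift hP u); congr Ex; apply/funext => G.
  by rewrite cyl_shift /= /shift_pair /= add0r [dir i + _]addrC.
apply: Exp_le.
- by apply/local_bm/(localf_sg (localf_dg R u)).
- by apply: bm_sum => i; apply/local_bm/localf_cyl.
- move=> G; apply: ler_sum => i _; rewrite /cyl /= andbT /sg ler_nat.
  by case: (G (u, u + dir i)); rewrite ?andbF ?andbT // leq_b1.
Qed.

Variable i0 : 'I_d.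

Lemma sg_nb_root_ae : {ae P, forall G : borel_config V, forall L x, nb_root (sg G) L x}.
Proof.
have : {ae P, forall G : borel_config V, forall Lx : nat * V, nb_root G Lx.1 Lx.2}.
  by apply: ae_forall_count => -[L x]; exact: ust_ae_nb_root.
have := sg_ae; apply: filterS2 => G -> H L x; exact: (H (L, x)).
Qed.

Lemma sg_deg_ae : {ae P, forall G : borel_config V, forall x, 1 <= dg R (sg G) x}.
Proof.
apply: filterS sg_nb_root_ae => G H x.
have /existsP[i /andP[xi _]] := H 0%N x.
exact: (dg_ge1 R (@sg_adj d G) xi).
Qed.

(** By [harm_edge], mass sent plus mass received plus defect is at most the degree of [u], whose
    mean is at most 2. Sent and received mass have the same mean, at least 1 minus the bound of
    [kill_le]; this accounts for the factor 2. *)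
Lemma one_sided_defect_mean L u :
  Ex P (one_sided_defect u) <= 2 * ((8 * d)%:R / L.+1%:R).
Proof.
(* The strongest killing that [kill_le] admits for depth [L]. *)
pose t : R := 1 + 2 / (L.+1 ^ 2)%:R.
have k0 : (0 : R) < (L.+1 ^ 2)%:R by rewrite ltr0n expn_gt0.
have t1 : 1 < t by rewrite /t ltrDl divr_gt0.
have tL : (L.+1 ^ 2)%:R * (t - 1) <= 2.
  by rewrite /t addrC addKr mulrC divfK // lt0r_neq0.
pose S G := \sum_(i : I) harm (sg G) t u (u + dir i).
have bh x y : bm ((fun G => harm (sg G) t x y) : borel_config V -> R).
  by exists (t - 1)^-1; case: (harm_approx x y t1).
have bS : bm (S : borel_config V -> R) by apply: bm_sum.
have bS' : bm ((fun G => \sum_(i : I) harm (sg G) t (u + dir i) u) : borel_config V -> R).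
  exact: bm_sum.
have bd : bm ((fun G => dg R (sg G) u) : borel_config V -> R).
  by apply/local_bm/(localf_sg (localf_dg R u)).
have bD := one_sided_defect_bm u.
have mt : Ex P (fun G => \sum_(i : I) harm (sg G) t (u + dir i) u) = Ex P S.
  rewrite !Exp_sum // (reindex_inj (can_inj (@opp_dirK d))); apply: eq_bigr => i _.
  have [_ /(_ (- dir i)) [_ E]] := harm_approx u (u + dir i) t1.
  by rewrite -E dir_opp addrK.
have le1 : Ex P S + Ex P S + Ex P (one_sided_defect u) <= 2.
  rewrite -[X in _ + X + _]mt -ExpD // -ExpD //; last exact: bmD.
  apply: le_trans (dg_sg_mean u).
  apply: Exp_le => // [|G]; first by apply: bmD => //; exact: bmD.
  rewrite -!big_split; apply: ler_sum => i _ /=.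
  have s := @sg_sym d G; have a := @sg_adj d G.
  have [xy|xy] := boolP (sg G (u, u + dir i)).
    have := harm_edge s a t1 xy; rewrite /= mulr1n mul1r; lra.
  by rewrite mul0r !harm_nedge ?addr0 // s.
have le2 : 1 - (8 * d)%:R / L.+1%:R <= Ex P S.
  rewrite -[leLHS](Ex_cst P); apply: Exp_le_ae => //; first exact: bm_cst.
  have := sg_deg_ae; have := sg_nb_root_ae; apply: filterS2 => G nb dg1.
  have s := @sg_sym d G; have a := @sg_adj d G.
  rewrite /S harm_sum // ?(lt_le_trans ltr01 (dg1 u)) //.
  by rewrite lerD2l lerN2; apply: kill_le.
by move: (_ / _) (Ex P S) (Ex P _) le1 le2 => k a b; lra.
Qed.

Lemma one_sided_ae : {ae P, forall G : borel_config V, forall x y, sg G (x, y) ->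
  (1 - hitoo (sg G) (1 : R) x y) * (1 - hitoo (sg G) (1 : R) y x) = 0}.
Proof.
have : {ae P, forall G : borel_config V, forall u, one_sided_defect u G = 0}.
  apply: ae_forall_count => u; have [M bM] := one_sided_defect_bm u.
  apply: (Ex_eq0_ae bM (one_sided_defect_ge0 u)).
  apply/eqP; rewrite eq_le Ex_ge0 ?andbT; last exact: one_sided_defect_ge0.
  rewrite leNgt; apply/negP => e0.
  have l0 := one_sided_defect_mean (Num.truncn (2 * (8 * d)%:R / Ex P (one_sided_defect u))) u.
  move: l0; rewrite mulrA ler_pdivlMr ?ltr0n // mulrC -ler_pdivlMr // leNgt truncnS_gt //.
apply: filterS => G H x y xy; have [i yE] := dir_edge (@sg_adj d G) xy.
have /eqP := H x; rewrite psumr_eq0 => [/allP /(_ i)|j _]; last first.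
  rewrite mulr_ge0 ?ler0n // mulr_ge0 // subr_ge0.
    by case/andP: (hitoo_bounds (@sg_sym d G) (@sg_adj d G) x (x + dir j) (lexx (1 : R))).
  by case/andP: (hitoo_bounds (@sg_sym d G) (@sg_adj d G) (x + dir j) x (lexx (1 : R))).
by rewrite mem_index_enum -yE xy mul1r => /(_ isT) /eqP.
Qed.

Lemma recurrent_ae : {ae P, forall G : borel_config V, forall x (B : R),
  exists N, B < \sum_(n < N) pn R (sg G) n x x}.
Proof.
have := one_sided_ae; have := sg_deg_ae; apply: filterS2 => G dg1 os x.
apply: recurrent => //; [exact: sg_sym | exact: sg_adj |].
apply: one_sided_gap0 => //; [exact: sg_sym | exact: sg_adj].
Qed.

End RandomForest.

(** * Transport of the last-collision mass *)

Section LastCollision.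
Variables (R : realType) (d : nat) (P : probability (borel_config (Zd d)) R).
Hypothesis hP : is_ust_law P.
Variable i0 : 'I_d.
Local Notation V := (Zd d).
Local Notation I := ('I_d * bool)%type.
Implicit Types (G H : config V) (x y z u : V).

Definition box_opp N (w : box d N) : box d N := [ffun i => rev_ord (w i)].

Lemma box_oppK N : involutive (@box_opp N).
Proof. by move=> w; apply/ffunP => i; rewrite !ffunE rev_ordK. Qed.

Lemma box_point_opp N (w : box d N) : box_point (box_opp w) = - box_point w.
Proof.
apply/ffunP => i; rewrite !ffunE /=; have := ltn_ord (w i).
by move: (nat_of_ord (w i)) => a; lia.
Qed.

Lemma avoid_mass_transport k M N u : (k <= M.+1)%N -> (k <= N.+1)%N ->
  Ex P (fun G => avoid R (sg G) M u u *
     \sum_(n < k) bsum N u (fun z => pn R (sg G) n z u ^+ 2)) <= 1.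
Proof.
move=> kM kN.
pose Phi n x y G := avoid R (sg G) M y y * pn R (sg G) n x y ^+ 2.
have lPhi n x y : localf (Phi n x y).
  apply: (@localf_sg _ _ (fun H => avoid R H M y y * pn R H n x y ^+ 2)).
  apply: (localf_comp2 *%R); first exact: localf_avoid.
  exact/(localf_comp (fun a : R => a ^+ 2))/localf_pn.
have bPhi n x y : bm (Phi n x y : borel_config V -> R) by apply: local_bm.
have bT n : bm ((fun G => \sum_(w : box d N) Phi n (u + box_point w) u G) : borel_config V -> R).
  by apply: bm_sum => w; apply: bPhi.
have bT' n : bm ((fun G => \sum_(w : box d N) Phi n u (u + box_point w) G) : borel_config V -> R).
  by apply: bm_sum => w; apply: bPhi.
have -> : (fun G => avoid R (sg G) M u u *
     \sum_(n < k) bsum N u (fun z => pn R (sg G) n z u ^+ 2)) =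
   (fun G => \sum_(n < k) \sum_(w : box d N) Phi n (u + box_point w) u G).
  apply/funext => G; rewrite mulr_sumr; apply: eq_bigr => n _; exact: mulr_sumr.
rewrite Exp_sum //.
rewrite (eq_bigr (fun n : 'I_k => Ex P (fun G => \sum_(w : box d N) Phi n u (u + box_point w) G))).
  rewrite -Exp_sum // -[leRHS](Ex_cst P); apply: Exp_le_ae.
  - exact: bm_sum.
  - exact: bm_cst.
  - have := sg_deg_ae hP i0; apply: filterS => G dg1.
    apply: le_trans (last_collision_sum dg1 u kM kN).
    by apply: ler_sum => n _; apply: ler_sum => w _; rewrite mulrC.
(* Translation by [- box_point w] turns the mass sent from [u] to [u + w] into the mass sent from
   [u - w] to [u]; reflecting the box matches the two sums term by term. *)
move=> n _; rewrite !Exp_sum // (reindex_inj (can_inj (@box_oppK N))).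
apply: eq_bigr => w _; rewrite box_point_opp.
rewrite -[RHS](Ex_local_shift hP (- box_point w)) //; congr Ex; apply/funext => G.
by rewrite /Phi sg_shift avoid_shift pn_shift addrK.
Qed.

Definition low_return (C : R) k u G : R := ((\sum_(n < k.*2) pn R (sg G) n u u) < C)%R%:R.

Lemma localf_low_return C k u : localf (low_return C k u).
Proof.
apply: (@localf_sg _ _ (fun H => ((\sum_(n < k.*2) pn R H n u u) < C)%R%:R)).
apply: (localf_comp (fun a : R => (a < C)%R%:R)).
by apply: localf_big => n; exact: localf_pn.
Qed.

Lemma low_return_cvg C u : Ex P (low_return C k u) @[k --> \oo] --> (0 : R).
Proof.
rewrite -[X in _ --> X](Ex_cst P 0); apply: (@Ex_lim_ae _ _ _ _ 1).
- move=> k; apply: local_bmf; first exact: localf_low_return.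
  by move=> G; rewrite /low_return; case: (_ < _); rewrite ?normr1 ?normr0.
- by split=> // x; rewrite normr0.
- have := recurrent_ae hP i0; apply: filterS => G rec.
  have [N HN] := rec u C; apply: cvg_near_cst; exists N => // k /= Nk.
  rewrite /low_return ltNge.
  suff -> : C <= \sum_(n < k.*2) pn R (sg G) n u u by [].
  apply: le_trans (ltW HN) _.
  have Nk2 : (N <= k.*2)%N by apply: leq_trans Nk _; rewrite -addnn leq_addr.
  rewrite -(subnKC Nk2) big_split_ord /= lerDl; apply: sumr_ge0 => n _; exact: pn_ge0.
Qed.

(** Where the return sum reaches [C], [return_sum] gives [A >= C / (4 * d)], so [avoid] is at most
    [4 * d / C] times the transported mass [avoid * A], of mean at most 1. Elsewhere the indicator
    [low_return] bounds it. *)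
Lemma avoid_mean k M C u : 0 < C -> (k <= M)%N ->
  Ex P (fun G => avoid R (sg G) M u u) <= (4 * d)%:R / C + Ex P (low_return C k u).
Proof.
move=> C0 kM.
pose A G := \sum_(n < k.+1) bsum k u (fun z => pn R (sg G) n z u ^+ 2).
have lA : localf A.
  apply: (@localf_sg _ _ (fun H => \sum_(n < k.+1) bsum k u (fun z => pn R H n z u ^+ 2))).
  apply: localf_big => n; apply: localf_big => w.
  exact/(localf_comp (fun a : R => a ^+ 2))/localf_pn.
have lav : localf (fun G => avoid R (sg G) M u u).
  exact: (@localf_sg _ _ (fun H => avoid R H M u u) (localf_avoid R M u u)).
have bAv : bm ((fun G => avoid R (sg G) M u u * A G) : borel_config V -> R).
  by apply/local_bm/(localf_comp2 *%R).
have bl : bm (low_return C k u : borel_config V -> R) by apply/local_bm/localf_low_return.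
apply: (@le_trans _ _ (Ex P (fun G => (4 * d)%:R / C * (avoid R (sg G) M u u * A G)
    + low_return C k u G))).
  apply: Exp_le_ae.
  - exact: local_bm.
  - by apply: bmD => //; apply: bmM => //; apply: bm_cst.
  - have := sg_deg_ae hP i0; apply: filterS => G dg1.
    have s := @sg_sym d G.
    have av0 := avoid_ge0 R (sg G) M u u.
    have av1 : avoid R (sg G) M u u <= 1.
      elim: (M) => [|m IH] //; apply: le_trans IH; exact: avoid_le.
    have rs := return_sum s dg1 u (leqnn k).
    rewrite /low_return; case: ltP => Cs.
      apply: ler_wpDl => //; rewrite mulr_ge0 ?divr_ge0 ?ler0n ?(ltW C0) // mulr_ge0 //.
      by apply: sumr_ge0 => n _; apply: sumr_ge0 => w _; apply: sqr_ge0.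
    rewrite addr0 mulrCA -[leLHS]mulr1 ler_wpM2l // mulrAC ler_pdivlMr // mul1r.
    exact: le_trans Cs rs.
rewrite ExpD //; last by apply: bmM => //; apply: bm_cst.
rewrite ExpZ // lerD2r -[leRHS]mulr1 ler_wpM2l ?divr_ge0 ?ler0n ?(ltW C0) //.
exact: avoid_mass_transport.
Qed.

Lemma avoid_mean_cvg u : Ex P (fun G => avoid R (sg G) M u u) @[M --> \oo] --> (0 : R).
Proof.
apply/cvgrPdist_le => e e0.
(* Makes [4 * d / C] at most [e / 2]; the summand 1 keeps [C] positive. *)
pose C := (4 * d)%:R / (e / 2) + 1.
have C0 : 0 < C by rewrite ltr_wpDl // divr_ge0 ?ler0n // divr_ge0 // ltW.
have := low_return_cvg C u => /cvgrPdist_le /(_ (e / 2)) [|k _ Hk]; first by rewrite divr_gt0.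
exists k => // M /= kM.
have E0 : 0 <= Ex P (fun G => avoid R (sg G) M u u).
  by apply: Ex_ge0 => G; apply: avoid_ge0.
rewrite sub0r normrN ger0_norm //; apply: le_trans (avoid_mean u C0 kM) _.
rewrite [e in leRHS]splitr; apply: lerD; last first.
  have := Hk k (leqnn k); rewrite /= sub0r normrN ger0_norm //.
  by apply: Ex_ge0 => G; rewrite ler0n.
rewrite ler_pdivrMr // mulrC -ler_pdivrMr ?divr_gt0 // /C lerDl ler01 //.
Qed.

(** [avoid_le] needs positive degrees, which hold only almost surely. The running minimum decreases
    on every configuration, so its limit exists everywhere and is measurable; almost surely it
    equals [avoid]. *)
Fixpoint avoid_min M u G : R :=
  if M is M'.+1 then Num.min (avoid_min M' u G) (avoid R (sg G) M u u) else 1.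

Lemma localf_avoid_min M u : localf (avoid_min M u).
Proof.
elim: M => [|M IH] /=; first exact: localf_cst.
apply: (localf_comp2 Num.min IH).
exact: (@localf_sg _ _ (fun H => avoid R H M.+1 u u) (localf_avoid R M.+1 u u)).
Qed.

Lemma avoid_min_ge0 M u G : 0 <= avoid_min M u G.
Proof. by elim: M => [|M IH] //=; rewrite le_min IH; exact: (avoid_ge0 R (sg G) M.+1 u u). Qed.

Lemma avoid_min_le1 M u G : avoid_min M u G <= 1.
Proof. by elim: M => [|M IH] //=; rewrite ge_min IH. Qed.

Theorem avoid_ae : {ae P, forall G : borel_config V, forall u,
  avoid R (sg G) M u u @[M --> \oo] --> (0 : R)}.
Proof.
apply: ae_forall_count => u.
have cm G : avoid_min M u G @[M --> \oo] --> limn (fun M => avoid_min M u G).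
  apply: nonincreasing_is_cvgn.
    by apply/nonincreasing_seqP => M /=; rewrite ge_min lexx.
  by exists 0 => _ [M _ <-]; apply: avoid_min_ge0.
have bF M : bmf 1 (avoid_min M u : borel_config V -> R).
  apply: local_bmf; first exact: localf_avoid_min.
  by move=> G; rewrite ger0_norm ?avoid_min_ge0 ?avoid_min_le1.
have bl := bmf_lim bF cm.
have cE : Ex P (avoid_min M u) @[M --> \oo] --> Ex P (fun G => limn (fun M => avoid_min M u G)).
  exact: (Ex_lim bF cm).
have E0 : Ex P (fun G => limn (fun M => avoid_min M u G)) = 0.
  rewrite -(cvg_lim (@Rhausdorff R) cE); apply: cvg_lim => //.
  have av := avoid_mean_cvg u; rewrite -(cvg_shiftS) in av.
  rewrite -(cvg_shiftS).
  apply: (squeeze_cvgr _ (cvg_cst 0) av); apply: nearW => M; apply/andP; split.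
    by apply: Ex_ge0 => G; apply: avoid_min_ge0.
  apply: Exp_le; first by exists 1.
    by apply/local_bm; exact: (@localf_sg _ _ (fun H => avoid R H M.+1 u u) (localf_avoid R M.+1 u u)).
  by move=> G /=; rewrite ge_min lexx orbT.
have l0 G : 0 <= limn (fun M => avoid_min M u G).
  by apply: limr_ge; [exact: cvgP (cm G) | apply: nearW => M; apply: avoid_min_ge0].
have := Ex_eq0_ae bl l0 E0; have := sg_deg_ae hP i0; apply: filterS2 => G dg1 lim0.
have := cm G; rewrite lim0 (_ : (fun M => avoid_min M u G) = (fun M => avoid R (sg G) M u u)) //.
apply/funext; elim=> [|M IH] //=; rewrite IH min_r //.
exact: avoid_le.
Qed.

End LastCollision.

(** * The path measure of simple random walk *)

(** The end point 1 is a null set; without it [digit] always stays below the number of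
    neighbours. *)
Lemma uniform01E (R : realType) (U : set R) : measurable U ->
  uniform_prob (@ltr01 R) U = lebesgue_measure (U `&` `[0, 1[).
Proof.
move=> mU; rewrite /uniform_prob integral_uniform_pdf.
rewrite (eq_integral (fun=> 1%E)); last first.
  by move=> x; rewrite inE => -[_ /=]; rewrite in_itv /= /uniform_pdf => ->; rewrite subr0 invr1.
rewrite integral_cst /=; last exact: measurableI.
rewrite mul1e; have -> : [set` `[0, 1]] = [set` `[0, 1[] `|` [set (1 : R)].
  by rewrite setUitv1 // bnd_simp.
rewrite setIUr measureU0 //; try exact: measurableI.
have sub1 : U `&` [set (1 : R)] `<=` [set 1] by move=> o [].
apply/eqP; rewrite -measure_le0 -(lebesgue_measure_set1 (1 : R)).
by apply: le_measure => //; rewrite inE //; exact: measurableI.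
Qed.

Section PathMeasure.
Variables (R : realType) (V : pointedType) (nb : V -> seq V).
Hypothesis nb_gt0 : forall x, (0 < size (nb x))%N.
Hypothesis nb_uniq : forall x, uniq (nb x).
Implicit Types (x y : V) (o : R).

Definition digit x o : nat := Num.truncn ((size (nb x))%:R * o).

(* The walk driven by a point [o] of the unit interval: the next neighbour is
   the index of the piece of the equipartition containing [o], which is then
   rescaled to the unit interval. *)
Fixpoint pos n x o : V :=
  if n is n'.+1 then pos n' (nth x (nb x) (digit x o)) ((size (nb x))%:R * o - (digit x o)%:R)
  else x.

Definition nb_step x y : R := if y \in nb x then (size (nb x))%:R^-1 else 0.

Definition weight n x (w : nat -> V) : R :=
  (w 0%N == x)%:R * \prod_(i < n) nb_step (w i) (w i.+1).

Lemma weight_ge0 n x w : 0 <= weight n x w.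
Proof.
rewrite mulr_ge0 // prodr_ge0 // => i _.
by rewrite /nb_step; case: ifP => // _; rewrite invr_ge0.
Qed.

(** Choosing neighbour number [j] out of [D] rescales by [o |-> D * o - j]; its inverse moves the
    interval of the remaining trajectory to the left end [(j + s) / D] and divides its length by
    [D]. An impossible trajectory has an empty interval at an arbitrary [s], so the bounds on [s]
    are claimed for positive weight. *)
Lemma pos_event n x (w : nat -> V) : exists s : R,
  [set o | 0 <= o < 1 /\ forall i, (i <= n)%N -> pos i x o = w i] =
  [set o | s <= o < s + weight n x w] /\
  (0 < weight n x w -> 0 <= s /\ s + weight n x w <= 1).
Proof.
elim: n x w => [|n IH] x w.
  exists 0; rewrite /weight big_ord0 mulr1; have [wx|wx] := eqVneq (w 0%N) x.
    rewrite add0r; split=> //; apply/seteqP; split=> o /=; first by case.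
    by move=> o01; split=> // i; rewrite leqn0 => /eqP ->; rewrite /= wx.
  rewrite addr0; split; last by rewrite ltxx.
  apply/seteqP; split=> o /=; last by move=> /andP[a b]; have := le_lt_trans a b; rewrite ltxx.
  by case=> _ /(_ 0%N isT) /= E; rewrite E eqxx in wx.
pose w' i := w i.+1.
have wE : weight n.+1 x w = (w 0%N == x)%:R * (nb_step x (w 1%N) * weight n (w 1%N) w').
  rewrite /weight big_ord_recl eqxx mul1r; case: eqVneq => [->|_]; last by rewrite !mul0r.
  by rewrite !mul1r.
have empty : weight n.+1 x w = 0 ->
    (forall o, 0 <= o < 1 -> ~ (forall i, (i <= n.+1)%N -> pos i x o = w i)) ->
    exists s : R,
  [set o | 0 <= o < 1 /\ forall i, (i <= n.+1)%N -> pos i x o = w i] =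
  [set o | s <= o < s + weight n.+1 x w] /\
  (0 < weight n.+1 x w -> 0 <= s /\ s + weight n.+1 x w <= 1).
  move=> w0 no; exists 0; rewrite w0 addr0 ltxx; split=> //.
  apply/seteqP; split=> o /=; first by case=> /no.
  by move=> /andP[a b]; have := le_lt_trans a b; rewrite ltxx.
have [wx|wx] := eqVneq (w 0%N) x; last first.
  apply: empty; first by rewrite wE (negPf wx) mul0r.
  by move=> o _ /(_ 0%N isT) /= E; rewrite E eqxx in wx.
set D := size (nb x) in wE *; have D0 : (0 : R) < D%:R by rewrite ltr0n nb_gt0.
have dig o : 0 <= o < 1 -> (digit x o)%:R <= D%:R * o < (digit x o).+1%:R /\ (digit x o < D)%N.
  move=> /andP[ o0 o1]; have := truncn_itv (mulr_ge0 (ltW D0) o0); rewrite -/(digit x o) => H.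
  split=> //; rewrite -(ltr_nat R); case/andP: H => H _; apply: le_lt_trans H _.
  by rewrite -[X in _ < X]mulr1 ltr_pM2l.
have [wnb|wnb] := boolP (w 1%N \in nb x); last first.
  apply: empty; first by rewrite wE /nb_step (negPf wnb) mul0r mulr0.
  move=> o /dig [_ dD] /(_ 1%N isT) /= E; case/negP: wnb; rewrite -E; exact: mem_nth.
have [s [sE sb]] := IH (w 1%N) w'.
set j := index (w 1%N) (nb x); have jD : (j < D)%N by rewrite index_mem.
exists ((j%:R + s) / D%:R).
have wE' : weight n.+1 x w = weight n (w 1%N) w' / D%:R.
  by rewrite wE wx eqxx mul1r /nb_step wnb mulrC.
rewrite wE' -mulrDl; split; last first.
  move=> pos0; have p0 : 0 < weight n (w 1%N) w' by move: pos0; rewrite pmulr_lgt0 ?invr_gt0.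
  have [s0 s1] := sb p0; split; first by rewrite divr_ge0 ?addr_ge0 // ltW.
  rewrite ler_pdivrMr // mul1r -addrA; apply: (@le_trans _ _ (j%:R + 1)); first by rewrite lerD2l.
  by rewrite natr1 ler_nat.
have iff o : (s <= o < s + weight n (w 1%N) w') <->
    (0 <= o < 1 /\ forall i, (i <= n)%N -> pos i (w 1%N) o = w' i).
  by have := congr1 (fun A : set R => A o) sE; rewrite /= => ->.
apply/seteqP; split=> o /=.
  case=> o01 H; have [dD1 dD2] := dig o o01.
  have dj : digit x o = j.
    have := H 1%N isT => /= E; rewrite /j -E index_uniq //.
  have : s <= D%:R * o - j%:R < s + weight n (w 1%N) w'.
    apply/iff; split.
      by rewrite -dj subr_ge0 ltrBlDr [1 + _]addrC natr1.
    move=> i iN; have := H i.+1 iN => /=; rewrite dj nth_index //.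
  by rewrite ler_pdivrMr // ltr_pdivlMr // => /andP[a b]; apply/andP; split; lra.
move=> so.
have so' : s <= D%:R * o - j%:R < s + weight n (w 1%N) w'.
  by move: so; rewrite ler_pdivrMr // ltr_pdivlMr // => /andP[a b]; apply/andP; split; lra.
have [/andP[q0 q1] H] := (iff _).1 so'.
have dj : digit x o = j.
  apply: truncn_def; rewrite -natr1; apply/andP; split; lra.
split.
  apply/andP; split; first by rewrite -(pmulr_rge0 _ D0); have : 0 <= j%:R :> R by []; lra.
  rewrite -(ltr_pM2l D0) mulr1; apply: (@lt_le_trans _ _ (j.+1)%:R); last by rewrite ler_nat.
  rewrite -natr1; lra.
by case=> [|i] iN /=; [rewrite wx | rewrite dj nth_index // H].
Qed.

Lemma measurable_pos n x y : measurable [set o | pos n x o = y].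
Proof.
elim: n x => [|n IH] x /=.
  have [->|xy] := eqVneq x y.
    by rewrite (_ : [set _ | _] = setT) //; apply/seteqP.
  by rewrite (_ : [set _ | _] = set0) //; apply/seteqP; split=> // o /eqP; rewrite (negPf xy).
set D := (size (nb x))%:R.
have -> : [set o | pos n (nth x (nb x) (digit x o)) (D * o - (digit x o)%:R) = y] =
    \bigcup_k ([set o | digit x o = k] `&`
      (fun o => D * o - k%:R) @^-1` [set o | pos n (nth x (nb x) k) o = y]).
  apply/seteqP; split=> o /=; first by move=> H; exists (digit x o).
  by case=> k _ [/= <-].
have aff c : measurable_fun setT (fun o => D * o - c).
  apply: continuous_measurable_fun => o.
  apply: cvgB; [apply: cvgM; [exact: cvg_cst | exact: cvg_id] | exact: cvg_cst].
have below k : measurable [set o | (digit x o <= k)%N].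
  rewrite (_ : [set o | _] = (fun o => D * o - 0) @^-1` `]-oo, k.+1%:R[).
    by rewrite -[_ @^-1` _]setTI; apply: aff.
  by apply/seteqP; split=> o /=; rewrite in_itv /= subr0 /digit truncn_le_nat.
apply: bigcup_measurable => k _; apply: measurableI; last first.
  by rewrite -[_ @^-1` _]setTI; apply: aff.
case: k => [|k].
  rewrite (_ : [set o | _] = [set o | (digit x o <= 0)%N]) //.
  by apply/seteqP; split=> o /=; [move=> -> | rewrite leqn0 => /eqP].
rewrite (_ : [set o | _] = [set o | (digit x o <= k.+1)%N] `\` [set o | (digit x o <= k)%N]).
  exact: measurableD.
apply/seteqP; split=> o /=; first by move=> ->; rewrite ltnn leqnn.
by case=> a /negP; rewrite -ltnNge => b; apply/eqP; rewrite eqn_leq a.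
Qed.

Definition walk x : measurableTypeR R -> g_sigma_algebraType (@cylinders V) :=
  fun o n => pos n x o.

Lemma measurable_walk x : measurable_fun setT (walk x).
Proof.
apply: (@measurability _ _ _ (g_sigma_algebraType (@cylinders V)) setT (walk x) (@cylinders V)) => // _ [_ [n [y ->]] <-].
rewrite setTI; exact: measurable_pos.
Qed.

HB.instance Definition _ x := isMeasurableFun.Build _ _ _ _ (walk x) (measurable_walk x).

Definition walk_law x : probability (g_sigma_algebraType (@cylinders V)) R :=
  distribution (uniform_prob (@ltr01 R)) (walk x).

Lemma walk_lawE n x (w : nat -> V) :
  walk_law x [set v | forall i, (i <= n)%N -> v i = w i] = (weight n x w)%:E.
Proof.
have mE : measurable (walk x @^-1` [set v | forall i, (i <= n)%N -> v i = w i]).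
  rewrite (_ : _ @^-1` _ = \bigcap_(i in [set i | (i <= n)%N]) [set o | pos i x o = w i]).
    by apply: bigcap_measurable => [|i _]; [exists 0%N | exact: measurable_pos].
  by apply/seteqP; split=> o H i; exact: H.
rewrite [LHS](uniform01E mE).
have [s [sE sb]] := pos_event n x w.
have -> : walk x @^-1` [set v | forall i, (i <= n)%N -> v i = w i] `&` `[0, 1[ =
    [set` `[s, s + weight n x w[].
  rewrite predeqE => o; rewrite /= !in_itv /=.
  have := congr1 (fun A : set R => A o) sE; rewrite /= => <-.
  by split=> -[].
rewrite lebesgue_measure_itv /= lte_fin ltrDl; case: ltP => [w0|w0].
  by rewrite -EFinB addrC addKr.
by congr EFin; apply/eqP; rewrite eq_le w0 weight_ge0.
Qed.

End PathMeasure.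

(** * Collisions *)

Lemma measure_fin_bigcup_le dT (T : measurableType dT) (R : realType)
    (mu : {measure set T -> \bar R}) (I : finType) (F : I -> set T) (E : set T) :
  measurable E -> (forall i, measurable (F i)) -> E `<=` \bigcup_i F i ->
  (mu E <= \sum_i mu (F i))%E.
Proof.
move=> mE mF sub.
apply: (@le_trans _ _ (mu (\big[setU/set0]_i F i))).
  apply: le_measure; rewrite ?inE //; first exact: bigsetU_measurable.
  apply: subset_trans sub _ => w [i _ Fi]; rewrite -bigcup_seq; exists i => //=.
  by rewrite mem_index_enum.
rewrite /index_enum; elim: Finite.enum => [|i s IH]; first by rewrite !big_nil measure0.
rewrite !big_cons; apply: (@le_trans _ _ (mu (F i) + mu (\big[setU/set0]_(j <- s) F j))%E).
  by apply: measureU2 => //; exact: bigsetU_measurable.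
exact: leeD2l.
Qed.

Section Neighbours.
Variables (R : realType) (d : nat) (G : config (Zd d)).
Local Notation V := (Zd d).
Local Notation I := ('I_d * bool)%type.
Hypothesis Gsg : sg G = G.
Hypothesis Gdeg : forall x, 1 <= dg R G x.

Definition nbs x : seq V := [seq x + dir i | i <- enum {: I} & G (x, x + dir i)].

Lemma sg_fix_adj x y : G (x, y) -> exists i, y = x + dir i.
Proof. by rewrite -Gsg => /sg_adj /adj_dirP. Qed.

Lemma mem_nbs x y : (y \in nbs x) = G (x, y).
Proof.
apply/mapP/idP => [[i] |Gxy]; first by rewrite mem_filter => /andP[Gi _] ->.
by have [i yE] := sg_fix_adj Gxy; exists i => //; rewrite mem_filter -yE Gxy mem_enum.
Qed.

Lemma nbs_uniq x : uniq (nbs x).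
Proof.
rewrite map_inj_uniq; first by rewrite filter_uniq // enum_uniq.
by move=> i j /addrI /dir_inj.
Qed.

Lemma size_nbs x : (size (nbs x))%:R = dg R G x.
Proof.
rewrite size_map size_filter /dg -sum1_count natr_sum big_mkcond /= big_enum /=.
by apply: eq_bigr => i _; case: G.
Qed.

Lemma nbs_gt0 x : (0 < size (nbs x))%N.
Proof. by rewrite -(ltr_nat R) size_nbs (lt_le_trans ltr01). Qed.

Lemma degree_nbs x : degree G x = size (nbs x).
Proof.
rewrite /degree (_ : [set y | G (x, y)] = [set` [fset y in nbs x]%fset]).
  by rewrite set_fsetK card_fseq undup_id // nbs_uniq.
by apply/seteqP; split=> y /=; rewrite inE mem_nbs.
Qed.

Lemma srw_stepE x y : srw_step R G x y = stp R G x y.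
Proof. by rewrite /srw_step /stp degree_nbs size_nbs. Qed.

Lemma exists_srw a : exists mu : probability (g_sigma_algebraType (@cylinders V)) R,
  srw_law G a mu.
Proof.
exists (walk_law R nbs a) => n x; rewrite (walk_lawE R nbs_gt0 nbs_uniq) /weight.
congr (_ * _)%:E; apply: eq_bigr => i _.
by rewrite /nb_step mem_nbs /srw_step degree_nbs.
Qed.

End Neighbours.

(** * Collisions of two independent walks *)

Section TwoWalks.
Variables (R : realType) (d : nat) (G : config (Zd d)).
Local Notation V := (Zd d).
Local Notation I := ('I_d * bool)%type.
Hypothesis Gsg : sg G = G.
Local Notation paths := (g_sigma_algebraType (@cylinders V)).
Variables (a : V) (mu : probability paths R).
Hypothesis mu_srw : srw_law G a mu.
Local Notation Q := (mu \x mu)%E.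

Definition prefix n (x : nat -> V) : set paths := [set w | forall i, (i <= n)%N -> w i = x i].

Definition prefix_weight n (x : nat -> V) : R :=
  (x 0%N == a)%:R * \prod_(i < n) stp R G (x i) (x i.+1).

Lemma prefixE n x : mu (prefix n x) = (prefix_weight n x)%:E.
Proof.
rewrite /prefix (mu_srw n x); congr (_ * _)%:E; apply: eq_bigr => i _; exact: srw_stepE.
Qed.

Lemma measurable_coord n v : measurable [set w : paths | w n = v].
Proof. by apply: sub_sigma_algebra; exists n, v. Qed.

Lemma measurable_prefix n x : measurable (prefix n x).
Proof.
rewrite (_ : prefix n x = \bigcap_(i in [set i | (i <= n)%N]) [set w | w i = x i]).
  by apply: bigcap_measurable => [|i _]; [exists 0%N | exact: measurable_coord].
by apply/seteqP; split=> w H i; exact: H.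
Qed.

Definition extend n (x : nat -> V) v i := if (i <= n)%N then x i else v.

Lemma prefix_extend n x v w : prefix n x w -> w n.+1 = v -> prefix n.+1 (extend n x v) w.
Proof.
move=> H Hv i; rewrite /extend leq_eqVlt ltnS => /orP[/eqP ->|iN]; first by rewrite ltnn.
by rewrite iN H.
Qed.

Definition branch n (x : nat -> V) (i : I) := extend n x (x n + dir i).

Lemma weight_extend n x v :
  prefix_weight n.+1 (extend n x v) = prefix_weight n x * stp R G (x n) v.
Proof.
rewrite /prefix_weight big_ord_recr /= /extend leq0n leqnn ltnn mulrA; congr (_ * _ * _).
by apply: eq_bigr => i _; rewrite ltn_ord ltnW.
Qed.

(** Finite sequences are countable, and a prefix whose last step is not an edge of [G] has measure
    0. *)
Lemma lattice_path_ae : {ae mu, forall w : paths, forall n, exists i, w n.+1 = w n + dir i}.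
Proof.
(* A sequence of size [n + 2] encodes positions [0] to [n + 1], its last step starting at index
   [(size s).-2 = n]; shorter sequences are padded with [point]. *)
have H : {ae mu, forall w : paths, forall s : seq V,
    prefix (size s).-2.+1 (nth point s) w ->
    exists i, nth point s (size s).-2.+1 = nth point s (size s).-2 + dir i}.
  apply: ae_forall_count => s.
  have [Gs|nGs] := boolP (G (nth point s (size s).-2, nth point s (size s).-2.+1)).
    by apply: aeW => w _; exact: (sg_fix_adj Gsg).
  exists (prefix (size s).-2.+1 (nth point s)); split; first exact: measurable_prefix.
    by rewrite [LHS]prefixE /prefix_weight big_ord_recr /= /stp (negPf nGs) !mulr0.
  by move=> w /= Hw; apply: contrapT => nw; apply: Hw => /nw.
apply: filterS H => w H n.
have := H (mkseq w n.+2); rewrite size_mkseq -[n.+2.-2]/n.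
rewrite (nth_mkseq _ _ (ltnSn _)) (nth_mkseq _ _ (ltnW (ltnSn _))); apply=> i iN.
by rewrite nth_mkseq.
Qed.

Definition diag n : set (paths * paths) := [set w | w.1 n = w.2 n].

Lemma measurable_diag n : measurable (diag n).
Proof.
rewrite (_ : diag n = \bigcup_v ([set w | w n = v] `*` [set w | w n = v])).
  apply: countable_bigcupT_measurable => [|v]; first exact: countableP.
  by apply: measurableX; exact: measurable_coord.
apply/seteqP; split=> w /=; first by move=> E; exists (w.1 n).
by case=> v _ [/= w1 w2]; rewrite /diag /= w1 w2.
Qed.

Definition apart n M : set (paths * paths) :=
  [set w | forall m, (n < m <= n + M)%N -> w.1 m <> w.2 m].

Lemma measurable_apart n M : measurable (apart n M).
Proof.
rewrite (_ : apart n M =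
    \bigcap_m (if (n < m <= n + M)%N then ~` diag m else setT)).
  apply: bigcapT_measurable => m; case: ifP => // _.
  by apply: measurableC; exact: measurable_diag.
apply/seteqP; split=> w Hw m; first by move=> _; case: ifP => // nm; exact: Hw.
by move=> nm; have := Hw m Logic.I; rewrite nm.
Qed.

Definition both n x y : set (paths * paths) := prefix n x `*` prefix n y.

Lemma measurable_both n x y : measurable (both n x y).
Proof. by apply: measurableX; exact: measurable_prefix. Qed.

Lemma bothE n x y : Q (both n x y) = (prefix_weight n x * prefix_weight n y)%:E.
Proof.
rewrite product_measure1E; [|exact: measurable_prefix..].
by rewrite EFinM; congr (_ * _)%E; exact: prefixE.
Qed.

(** Up to two null sets of pairs with a non-lattice step, the next positions range over finitely
    many pairs of directions; by subadditivity, bounds on these branches add up to one application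
    of [markov2]. *)
Lemma pair_step (E : set (paths * paths)) n x y (g : V -> V -> R) : measurable E ->
  (forall i j, (Q (both n.+1 (branch n x i) (branch n y j) `&` E) <=
    (prefix_weight n.+1 (branch n x i) *
     prefix_weight n.+1 (branch n y j) * g (x n + dir i) (y n + dir j))%:E)%E) ->
  (Q (both n x y `&` E) <= (prefix_weight n x * prefix_weight n y * markov2 G g (x n) (y n))%:E)%E.
Proof.
move=> mE H; have [N [mN N0 Nsub]] := lattice_path_ae.
pose B i j := both n.+1 (branch n x i) (branch n y j) `&` E.
pose F (k : bool + I * I) := match k with
  | inr ij => B ij.1 ij.2
  | inl b => if b then N `*` setT else setT `*` N
  end.
have QN : Q (N `*` setT) = 0%E by rewrite product_measure1E // [X in (X * _)%E]N0 mul0e.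
have QN' : Q (setT `*` N) = 0%E by rewrite product_measure1E // [X in (_ * X)%E]N0 mule0.
apply: (@le_trans _ _ (\sum_k Q (F k))%E).
  apply: measure_fin_bigcup_le.
  - by apply: measurableI => //; exact: measurable_both.
  - case=> [[]|ij] /=; [exact: measurableX | exact: measurableX |].
    by apply: measurableI => //; exact: measurable_both.
  - move=> w [[xw yw] Ew].
    have [w1|w1] := pselect (N w.1); first by exists (inl true).
    have [w2|w2] := pselect (N w.2); first by exists (inl false).
    have good v : ~ N v -> exists i, v n.+1 = v n + dir i.
      by move=> nNv; apply: contrapT => bad; apply: nNv; apply: Nsub => /= /(_ n).
    have [i iE] := good _ w1; have [j jE] := good _ w2.
    exists (inr (i, j)) => //; split=> //; split=> /=.
      by apply: prefix_extend => //; rewrite iE xw.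
    by apply: prefix_extend => //; rewrite jE yw.
rewrite big_sumType /= big_bool /= QN QN' !add0e.
apply: (@le_trans _ _ (\sum_(ij : I * I) (prefix_weight n.+1 (branch n x ij.1) *
     prefix_weight n.+1 (branch n y ij.2) *
     g (x n + dir ij.1) (y n + dir ij.2))%:E)%E).
  by apply: lee_sum => -[i j] _; exact: H.
rewrite sumEFin lee_fin -(pair_bigA _ (fun i j => prefix_weight n.+1 (branch n x i) *
     prefix_weight n.+1 (branch n y j) * g (x n + dir i) (y n + dir j))) /=.
rewrite /markov2 /markov mulr_sumr; apply: ler_sum => i _.
rewrite !mulr_sumr; apply: ler_sum => j _; rewrite /branch !weight_extend le_eqVlt; apply/orP; left.
by apply/eqP; ring.
Qed.

Lemma apart_bound M n x y :
  (Q (both n x y `&` apart n M) <=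
   (prefix_weight n x * prefix_weight n y * avoid R G M (x n) (y n))%:E)%E.
Proof.
elim: M n x y => [|M IH] n x y.
  rewrite mulr1 -bothE; apply: le_measure; rewrite ?inE; last by move=> w [].
    by apply: measurableI; [exact: measurable_both | exact: measurable_apart].
  exact: measurable_both.
apply: (pair_step (g := fun u v => (u != v)%:R * avoid R G M u v)).
  exact: measurable_apart.
move=> i j; set x' := branch n x i; set y' := branch n y j.
have x'E : x' n.+1 = x n + dir i by rewrite /x' /branch /extend ltnn.
have y'E : y' n.+1 = y n + dir j by rewrite /y' /branch /extend ltnn.
have [E|ne] := eqVneq (x n + dir i) (y n + dir j).
  rewrite (_ : _ `&` _ = set0) ?measure0 ?mul0r ?mulr0 //.
  rewrite -subset0 => w [[/= /(_ n.+1 (leqnn _)) w1 /(_ n.+1 (leqnn _)) w2] /(_ n.+1)].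
  by apply; [rewrite ltnSn addnS ltnS leq_addr | rewrite w1 w2 x'E y'E].
rewrite mul1r -x'E -y'E; apply: le_trans (IH n.+1 x' y').
apply: le_measure; rewrite ?inE.
- by apply: measurableI; [exact: measurable_both | exact: measurable_apart].
- by apply: measurableI; [exact: measurable_both | exact: measurable_apart].
by move=> w [bw aw]; split=> // m /andP[nm mM]; apply: aw; rewrite (ltnW nm) addnS -addSn.
Qed.

Definition last_meeting n M := diag n `&` apart n M.

Lemma measurable_last_meeting n M : measurable (last_meeting n M).
Proof. by apply: measurableI; [exact: measurable_diag | exact: measurable_apart]. Qed.

Lemma last_meeting_bound k n M x y :
  (Q (both n x y `&` last_meeting (n + k) M) <=
   (prefix_weight n x * prefix_weight n y *
    iter k (markov2 G) (fun u v => (u == v)%:R * avoid R G M u u) (x n) (y n))%:E)%E.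
Proof.
elim: k n x y => [|k IH] n x y /=.
  rewrite addn0; have [E|ne] := eqVneq (x n) (y n); last first.
    rewrite (_ : _ `&` _ = set0) ?measure0 ?mul0r ?mulr0 //.
    rewrite -subset0 => w [[/= /(_ n (leqnn _)) w1 /(_ n (leqnn _)) w2] [/eqP]].
    by rewrite w1 w2 (negPf ne).
  rewrite mul1r {2}E; apply: le_trans (apart_bound M n x y); apply: le_measure; rewrite ?inE.
  - by apply: measurableI; [exact: measurable_both | exact: measurable_last_meeting].
  - by apply: measurableI; [exact: measurable_both | exact: measurable_apart].
  by move=> w [? []].
apply: pair_step; first exact: measurable_last_meeting.
move=> i j; set x' := branch n x i; set y' := branch n y j.
have x'E : x' n.+1 = x n + dir i by rewrite /x' /branch /extend ltnn.
have y'E : y' n.+1 = y n + dir j by rewrite /y' /branch /extend ltnn.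
by rewrite -x'E -y'E -addSnnS; exact: IH.
Qed.

Hypothesis avoid0 : forall u, avoid R G M u u @[M --> \oo] --> (0 : R).

(** The event is bounded for every [M] by a sum over the positions at time [n]. These lie in a
    finite box, so convergence of [avoid] at each single vertex suffices. *)
Lemma last_meeting_null n :
  Q (both 0 (fun=> a) (fun=> a) `&` \bigcap_M last_meeting n M) = 0%E.
Proof.
set L := _ `&` _; pose c M := bsum n a (fun z => pn R G n a z * pn R G n a z * avoid R G M z z).
have mL : measurable L.
  apply: measurableI; first exact: measurable_both.
  by apply: bigcapT_measurable => M; exact: measurable_last_meeting.
have bound M : (Q L <= (c M)%:E)%E.
  rewrite /c -(iter_markov2_bsum G (fun z => avoid R G M z z)); try exact: within_refl.
  have := last_meeting_bound n 0 M (fun=> a) (fun=> a).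
  rewrite /prefix_weight !big_ord0 eqxx !mul1r; apply: le_trans.
  apply: le_measure; rewrite ?inE //.
    by apply: measurableI; [exact: measurable_both | exact: measurable_last_meeting].
  by move=> w [bw Lw]; split=> //; exact: Lw.
have c0 : c M @[M --> \oo] --> (0 : R).
  rewrite [X in _ --> X](_ : _ = bsum n a (fun=> 0)); last by rewrite /bsum big1.
  apply: cvg_sumr => w; set z := a + box_point w.
  rewrite -[X in _ --> X](mulr0 (pn R G n a z * pn R G n a z)).
  by apply: cvgM; [exact: cvg_cst | exact: avoid0].
apply/eqP; rewrite -measure_le0; apply/lee_addgt0Pr => e e0; rewrite add0e.
have /cvgrPdist_le /(_ e e0) [M _ HM] := c0; apply: le_trans (bound M) _.
have := HM M (leqnn M); rewrite /= sub0r normrN lee_fin; exact: le_trans (ler_norm _).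
Qed.

Lemma collisions_ge (w : paths * paths) K :
  w.1 0%N = w.2 0%N -> (forall n, w.1 n = w.2 n -> exists2 m, (n < m)%N & w.1 m = w.2 m) ->
  exists n, w.1 n = w.2 n /\ (K < \sum_(i < n.+1) (w.1 i == w.2 i))%N.
Proof.
move=> w0 next; elim: K => [|K [n [wn Kn]]].
  by exists 0%N; split=> //; rewrite big_ord1 w0 eqxx.
have [m nm wm] := next n wn; exists m; split=> //.
rewrite big_ord_recr /= wm eqxx addn1 ltnS; apply: leq_trans Kn _.
rewrite -!(big_mkord xpredT (fun i => (w.1 i == w.2 i) : nat)).
by rewrite (big_cat_nat (leq0n n.+1) nm) /= leq_addr.
Qed.

Lemma collisions_ge0 (w : paths * paths) n : (0 <= (w.1 n == w.2 n)%:R%:E :> \bar R)%E.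
Proof. by rewrite lee_fin ler0n. Qed.

Lemma collisions_infty (w : paths * paths) :
  w.1 0%N = w.2 0%N -> (forall n, w.1 n = w.2 n -> exists2 m, (n < m)%N & w.1 m = w.2 m) ->
  collisions R w = +oo%E.
Proof.
move=> w0 next; apply/eqyP => A A0.
have [n [_ Kn]] := collisions_ge (Num.truncn A) w0 next.
apply: le_trans (nneseries_lim_ge n.+1 (fun i _ _ => collisions_ge0 w i)).
rewrite sumEFin lee_fin big_mkord -natr_sum; apply: le_trans (ltW (truncnS_gt A)) _.
by rewrite ler_nat.
Qed.

Lemma measurable_collisions : measurable [set w : paths * paths | collisions R w = +oo%E].
Proof.
pose f (w : paths * paths) : \bar R := collisions R w.
have mf : measurable_fun setT f.
  apply: ge0_emeasurable_sum => [n w _ _|n _]; first exact: collisions_ge0.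
  rewrite (_ : (fun _ => _) = EFin \o \1_(diag n)).
    apply/measurable_EFinP; exact: measurable_indic (measurable_diag n).
  apply/funext => w /=; rewrite indicE; congr (_%:R)%:E; apply: congr1.
  by apply/eqP/idP; rewrite inE.
rewrite (_ : [set w | _] = setT `&` f @^-1` [set +oo%E]); last by rewrite setTI.
exact: mf.
Qed.

(** The walks start together, and outside a countable union of null events no collision is the last
    one, so there is always a later one. *)
Lemma collisions_srw : Q [set w | collisions R w = +oo%E] = 1%E.
Proof.
pose B := both 0 (fun=> a) (fun=> a).
pose L := \bigcup_n (B `&` \bigcap_M last_meeting n M).
have mB : measurable B by exact: measurable_both.
have mBL n : measurable (B `&` \bigcap_M last_meeting n M).
  apply: measurableI => //; apply: bigcapT_measurable => M; exact: measurable_last_meeting.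
have mL : measurable L by exact: bigcupT_measurable.
have L0 : Q L = 0%E.
  apply: measure_negligible => //; apply: negligible_bigcup => n.
  by apply/negligibleP => //; exact: last_meeting_null.
apply/eqP; rewrite eq_le; apply/andP; split.
  have <- : Q setT = 1%E.
    rewrite -setXTT product_measure1E // -[RHS]mule1.
    by congr (_ * _)%E; exact: probability_setT.
  by apply: le_measure; rewrite ?inE //; exact: measurable_collisions.
have <- : Q B = 1%E by rewrite bothE /prefix_weight !big_ord0 eqxx !mul1r.
have mS := measurable_collisions; set S := [set w | _] in mS *.
apply: (@le_trans _ _ (Q (S `|` L))); last first.
  by rewrite -[leRHS]adde0 -[in leRHS]L0; exact: measureU2.
apply: le_measure; rewrite ?inE //; first exact: measurableU.
move=> w Bw; have [|nL] := pselect (L w); first by right.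
left; apply: collisions_infty; first by case: Bw => /(_ 0%N isT) /= -> /(_ 0%N isT) /= ->.
move=> n wn; apply: contrapT => no; apply: nL; exists n => //; split=> // M _; split=> //.
by move=> m /andP[nm _] wm; apply: no; exists m.
Qed.

End TwoWalks.

Theorem corollary1p2 (R : realType) (P : probability (borel_config (Zd 3)) R)
    (hP : is_ust_law P) :
  {ae P, forall U : borel_config (Zd 3), infinite_collision_property R U}.
Proof.
have := avoid_ae hP ord0; have := sg_deg_ae hP ord0; have := sg_ae hP.
apply: filterS3 => G Gsg; rewrite Gsg => Gdeg Gavoid a.
have [mu mu_srw] := exists_srw Gsg Gdeg a; exists mu => //.
exact: (collisions_srw Gsg mu_srw Gavoid).
Qed.
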